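(* Let $V\in C^3(0,+\infty)$ and suppose that $V'(r)=0$ has a unique solution $t_1>0$ and that $rV'(r)$ is strictly increasing on $(0,+\infty)$. For each $n$ let $(\sigma_1,\dots,\sigma_n)$ be a random vector in $\mathbb{C}^n$ with joint probability density (with respect to Lebesgue measure) proportional to $\prod_{i=1}^n e^{-nV(|z_i|)}\prod_{1\le j<k\le n}|z_j-z_k|^2$. Then, as $n\to\infty$: (1) $$\sup_{t\in\mathbb{R}}\Bigl|\mathbb{P}\Bigl(\min_{1\le i\le n}|\sigma_i|\ge t_1-\frac{\sqrt{\tau_n}}{\sqrt{V''(t_1)n}}+\frac{t}{\sqrt{V''(t_1)n\tau_n}}\Bigr)-e^{-e^{t}}\Bigr|\sim\frac{2\log\log n}{e\log n}.$$ (2) For any fixed $0<t<t_1$, $$\mathbb{P}\bigl(\min_{1\le i\le n}|\sigma_i|\le t\bigr)\sim\frac{\sqrt{V''(t_1)}\,t_1t}{\sqrt{2\pi n}\,(t_1^2-t^2)(-V'(t))}\exp(-nV(t)+nV(t_1)).$$ (3) For any fixed $t>1$, $$\mathbb{P}\Bigl(\min_{1\le i\le n}|\sigma_i|\le t_1-\frac{t\sqrt{\tau_n}}{\sqrt{V''(t_1)n}}\Bigr)\sim t^{-2}\Bigl(\frac{8\pi(\log n)^2}{V''(t_1)nt_1^2}\Bigr)^{\frac{t^2-1}{2}}.$$ (4) For any sequence $v_n$ with $1\ll v_n\ll\log n$, $$\mathbb{P}\Bigl(\min_{1\le i\le n}|\sigma_i|\le t_1-\frac{\sqrt{\tau_n}}{\sqrt{V''(t_1)n}}-\frac{v_n}{\sqrt{V''(t_1)n\tau_n}}\Bigr)\sim\exp\Bigl(-v_n-\frac{v_n^2}{2\tau_n}\Bigr).$$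 (5) For any sequence $d_n>0$: if $\frac{\sqrt{\log n}}{\sqrt n}\ll d_n\ll n^{-1/3}$, then $$\mathbb{P}\bigl(\min_{1\le i\le n}|\sigma_i|\le t_1-d_n\bigr)\sim\frac{t_1}{2\sqrt{2\pi V''(t_1)n}\,d_n^2}\exp\Bigl(-\frac12V''(t_1)nd_n^2\Bigr);$$ if $n^{-1/3}\lesssim d_n\ll1$, then $$\mathbb{P}\bigl(\min_{1\le i\le n}|\sigma_i|\le t_1-d_n\bigr)\sim\frac{t_1\exp(-nV(t_1-d_n)+nV(t_1))}{2\sqrt{2\pi V''(t_1)n}\,d_n^2}.$$
   Context: $V:(0,\infty)\to\mathbb{R}$ is a fixed function (independent of $n$), with $V''(t_1)>0$. Define $$\tau_n=\log\frac{nV''(t_1)t_1^2}{8\pi(\log n)^2},$$ which is positive for $n$ large enough. $a_n\sim b_n$ means $a_n/b_n\to1$; $a_n\ll b_n$ means $a_n/b_n\to0$; $a_n\lesssim b_n$ means $a_n\le Cb_n$ for some constant $C>0$ and all large $n$; all as $n\to\infty$. *)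

(* Defs.v *)
From HB Require Import structures.
From mathcomp Require Import all_boot all_order all_algebra.
From mathcomp Require Import all_classical all_reals all_analysis.
From mathcomp Require Import complex.

Set Implicit Arguments.
Unset Strict Implicit.
Unset Printing Implicit Defensive.

Import Order.TTheory GRing.Theory Num.Theory.
Import numFieldNormedType.Exports.

Local Open Scope classical_set_scope.
Local Open Scope ring_scope.
Local Open Scope complex_scope.

(* The library's sigma-finiteness instance for m1 \x m2 is shadowed by the one
   for subprobabilities and cannot be inferred, hence the explicit proof here. *)
Section product_image.
Context d1 d2 d3 (T1 : measurableType d1) (T2 : measurableType d2)
  (T3 : measurableType d3) (R : realType).
Variable m1 : {sigma_finite_measure set T1 -> \bar R}.
Variable m2 : {sigma_finite_measure set T2 -> \bar R}.
Variables (f : T1 * T2 -> T3) (g : T3 -> T1 * T2).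
Hypotheses (mf : measurable_fun [set: T1 * T2] f).
Hypotheses (mg : measurable_fun [set: T3] g) (fK : cancel f g).

Let product_sigma_finite : sigma_finite [set: T1 * T2] (m1 \x m2)%E.
Proof.
have /sigma_finiteP[F [TF ndF Foo]] := sigma_finiteT m1.
have /sigma_finiteP[G [TG ndG Goo]] := sigma_finiteT m2.
exists (fun n => F n `*` G n).
  rewrite -setXTT TF TG predeqE => -[x y]; split.
    move=> [/= [n _ Fnx] [k _ Gky]]; exists (maxn n k) => //; split.
    - by move: x Fnx; exact/subsetPset/ndF/leq_maxl.
    - by move: y Gky; exact/subsetPset/ndG/leq_maxr.
  by move=> [n _ []/= ? ?]; split; exists n.
move=> k; have [? ?] := Foo k; have [? ?] := Goo k.
split; first exact: measurableX.
by rewrite product_measure1E// lte_mul_pinfty// ge0_fin_numE.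
Qed.

Let mu : set T3 -> \bar R := pushforward (m1 \x m2)%E f.

Let mu0 : mu set0 = 0%E.
Proof. by rewrite /mu /pushforward preimage_set0 measure0. Qed.

Let mu_ge0 A : (0 <= mu A)%E.
Proof. exact: measure_ge0. Qed.

Let mu_sigma_additive : semi_sigma_additive mu.
Proof. by rewrite /mu; apply: measure_semi_sigma_additive. Qed.

HB.instance Definition _ := isMeasure.Build _ _ _ mu
  mu0 mu_ge0 mu_sigma_additive.

Let mu_sigma_finite : sigma_finite [set: T3] mu.
Proof.
have [F FT Foo] := product_sigma_finite.
exists (fun k => g @^-1` F k).
  by rewrite -preimage_bigcup -FT preimage_setT.
move=> k; have [mF mFoo] := Foo k; split.
  by rewrite -[X in measurable X]setTI; exact: mg.
rewrite /mu /pushforward (_ : f @^-1` (g @^-1` F k) = F k)//.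
by apply/seteqP; split => x /=; rewrite fK.
Qed.

HB.instance Definition _ := Measure_isSigmaFinite.Build _ _ _ mu
  mu_sigma_finite.

Lemma pushforward_product_sigma_finite :
  exists nu : {sigma_finite_measure set T3 -> \bar R},
    pushforward (m1 \x m2)%E f = nu.
Proof. by exists mu. Qed.

End product_image.

Section complex_measurable.
Context {R : realType}.

HB.instance Definition _ := isPointed.Build R[i] 0.

Definition complex_of_pair (p : R * R) : R[i] := p.1 +i* p.2.
Definition pair_of_complex (z : R[i]) : R * R := (complex.Re z, complex.Im z).

Lemma complex_of_pairK : cancel complex_of_pair pair_of_complex.
Proof. by case. Qed.

Lemma pair_of_complexK : cancel pair_of_complex complex_of_pair.
Proof. by case. Qed.

(* The Borel sigma-algebra of R[i], transported from that of R * R. *)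
Definition complex_measurable : set (set R[i]) :=
  [set A | measurable (complex_of_pair @^-1` A)].

Let complex_measurable0 : complex_measurable set0.
Proof. by rewrite /complex_measurable/= preimage_set0. Qed.

Let complex_measurableC A : complex_measurable A -> complex_measurable (~` A).
Proof. by move=> mA; rewrite /complex_measurable/= preimage_setC; exact: measurableC. Qed.

Let complex_measurable_bigcup (F : (set R[i])^nat) :
  (forall k, complex_measurable (F k)) -> complex_measurable (\bigcup_k F k).
Proof.
move=> mF; rewrite /complex_measurable/= preimage_bigcup.
by apply: bigcupT_measurable => k; exact: mF.
Qed.

HB.instance Definition _ := @isMeasurable.Build default_measure_display R[i]
  complex_measurable complex_measurable0 complex_measurableC
  complex_measurable_bigcup.

Lemma measurable_complex_of_pair : measurable_fun [set: R * R] complex_of_pair.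
Proof. by move=> _ A mA; rewrite setTI. Qed.

Lemma measurable_pair_of_complex : measurable_fun [set: R[i]] pair_of_complex.
Proof.
move=> _ A mA; rewrite setTI /measurable/= /complex_measurable/=.
rewrite (_ : _ @^-1` _ = A)//.
by apply/seteqP; split => -[].
Qed.

Definition lebesgue_C : set R[i] -> \bar R :=
  pushforward (lebesgue_measure \x lebesgue_measure)%E complex_of_pair.

Let lebesgue_C_sfm :
  exists mu : {sigma_finite_measure set R[i] -> \bar R}, lebesgue_C = mu.
Proof.
exact: (pushforward_product_sigma_finite
  (@lebesgue_measure R) (@lebesgue_measure R)
  measurable_complex_of_pair measurable_pair_of_complex complex_of_pairK).
Qed.

Let lebesgue_C0 : lebesgue_C set0 = 0%E.
Proof. by have [mu ->] := lebesgue_C_sfm. Qed.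

Let lebesgue_C_ge0 A : (0 <= lebesgue_C A)%E.
Proof. by have [mu ->] := lebesgue_C_sfm. Qed.

Let lebesgue_C_sigma_additive : semi_sigma_additive lebesgue_C.
Proof. by have [mu ->] := lebesgue_C_sfm; exact: measure_semi_sigma_additive. Qed.

Let lebesgue_C_sigma_finite : sigma_finite [set: R[i]] lebesgue_C.
Proof. by have [mu ->] := lebesgue_C_sfm; exact: sigma_finiteT. Qed.

HB.instance Definition _ := isMeasure.Build _ _ _ lebesgue_C
  lebesgue_C0 lebesgue_C_ge0 lebesgue_C_sigma_additive.

HB.instance Definition _ := Measure_isSigmaFinite.Build _ _ _ lebesgue_C
  lebesgue_C_sigma_finite.

End complex_measurable.

Section lebesgue_complex_space.
Context {R : realType}.

Definition cons_pair n (p : R[i] * n.-tuple R[i]) : n.+1.-tuple R[i] :=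
  [tuple of p.1 :: p.2].

Definition uncons_pair n (z : n.+1.-tuple R[i]) : R[i] * n.-tuple R[i] :=
  (thead z, [tuple of behead z]).

Lemma cons_pairK n : cancel (@cons_pair n) (@uncons_pair n).
Proof. by case=> z zs; congr pair; apply/val_inj. Qed.

Lemma measurable_cons_pair n : measurable_fun setT (@cons_pair n).
Proof. exact: measurable_cons. Qed.

Lemma measurable_uncons_pair n : measurable_fun setT (@uncons_pair n).
Proof.
apply: measurable_fun_pair; first exact: measurable_tnth.
exact: measurable_behead.
Qed.

Fixpoint lebesgue_Cn n : set (n.-tuple R[i]) -> \bar R :=
  match n with
  | 0 => \d_ [tuple]
  | n'.+1 => pushforward (lebesgue_C \x @lebesgue_Cn n')%E (@cons_pair n')
  end.

Let lebesgue_Cn_sfm n :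
  exists mu : {sigma_finite_measure set (n.-tuple R[i]) -> \bar R},
    @lebesgue_Cn n = mu.
Proof.
elim: n => [|n [mu mE]] /=; first by exists (\d_ [tuple]).
rewrite mE; exact: (pushforward_product_sigma_finite lebesgue_C mu
  (@measurable_cons_pair n) (@measurable_uncons_pair n) (@cons_pairK n)).
Qed.

Let lebesgue_Cn0 n : @lebesgue_Cn n set0 = 0%E.
Proof. by have [mu ->] := lebesgue_Cn_sfm n. Qed.

Let lebesgue_Cn_ge0 n A : (0 <= @lebesgue_Cn n A)%E.
Proof. by have [mu ->] := lebesgue_Cn_sfm n. Qed.

Let lebesgue_Cn_sigma_additive n : semi_sigma_additive (@lebesgue_Cn n).
Proof.
by have [mu ->] := lebesgue_Cn_sfm n; exact: measure_semi_sigma_additive.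
Qed.

Let lebesgue_Cn_sigma_finite n : sigma_finite setT (@lebesgue_Cn n).
Proof. by have [mu ->] := lebesgue_Cn_sfm n; exact: sigma_finiteT. Qed.

HB.instance Definition _ n := isMeasure.Build _ _ _ (@lebesgue_Cn n)
  (lebesgue_Cn0 n) (@lebesgue_Cn_ge0 n) (@lebesgue_Cn_sigma_additive n).

HB.instance Definition _ n := Measure_isSigmaFinite.Build _ _ _ (@lebesgue_Cn n)
  (@lebesgue_Cn_sigma_finite n).

End lebesgue_complex_space.

Arguments lebesgue_Cn {R} n.

Section random_point_configurations.
Context {R : realType}.
Implicit Types (V : R -> R) (n : nat).

Definition C3_on_pos V := forall x : R, 0 < x ->
  [/\ derivable V x 1, derivable (derive1 V) x 1, derivable (derive1n 2 V) x 1 &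
      {for x, continuous (derive1n 3 V)}].

Definition joint_weight V n (z : n.-tuple R[i]) : R :=
  \prod_(i < n) expR (- (n%:R * V (Normc.normc (tnth z i)))) *
  \prod_(j < n) \prod_(k < n | (j < k)%N)
    Normc.normc (tnth z j - tnth z k) ^+ 2.

(* Finiteness and positivity of the total mass of w are part of this
   condition: take A to be the whole space. *)
Definition density_proportional_to d (T : measurableType d)
    (P : probability T R) n (X : {RV P >-> n.-tuple R[i]})
    (w : n.-tuple R[i] -> R) :=
  exists2 c : R, 0 < c & forall A : set (n.-tuple R[i]), measurable A ->
    distribution P X A = (\int[lebesgue_Cn n]_(z in A) (c * w z)%:E)%E.

(* Extended real valued so that the empty minimum (n = 0) makes sense. *)
Definition min_modulus n (z : n.-tuple R[i]) : \bar R :=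
  \big[Order.min/+oo%E]_(i < n) (Normc.normc (tnth z i))%:E.

Definition prob_min_le d (T : measurableType d) (P : probability T R) n
    (X : T -> n.-tuple R[i]) (s : R) : R :=
  fine (P [set x | (min_modulus (X x) <= s%:E)%E]).

Definition prob_min_ge d (T : measurableType d) (P : probability T R) n
    (X : T -> n.-tuple R[i]) (s : R) : R :=
  fine (P [set x | (s%:E <= min_modulus (X x))%E]).

Definition tau V (t1 : R) n : R :=
  ln (n%:R * derive1n 2 V t1 * t1 ^+ 2 / (8 * pi * ln n%:R ^+ 2)).

End random_point_configurations.

Section asymptotic_comparison.
Context {R : realType}.
Implicit Types a b : nat -> R.

Definition asym_equiv a b := a n / b n @[n --> \oo] --> (1 : R).

(* As x / 0 = 0 and signs are not otherwise constrained, the dominating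
   sequence is required to be eventually positive; e.g. asym_ll (fun=> 1) v
   then means that v tends to +oo. *)
Definition asym_ll a b :=
  (\forall n \near \oo, 0 < b n) /\ a n / b n @[n --> \oo] --> (0 : R).

Definition asym_lesssim a b :=
  exists2 C : R, 0 < C & \forall n \near \oo, a n <= C * b n.

End asymptotic_comparison.

(* Main.v *)
Require Import Defs.
From HB Require Import structures.
From mathcomp Require Import all_boot all_order all_algebra.
From mathcomp Require Import all_classical all_reals all_analysis.
From mathcomp Require Import complex.
From mathcomp Require Import perm cyclic separable cyclotomic.
From mathcomp Require Import measurable_realfun ring lra.

Set Implicit Arguments.
Unset Strict Implicit.
Unset Printing Implicit Defensive.

Import Order.TTheory GRing.Theory Num.Theory.
Import numFieldNormedType.Exports.

Local Open Scope classical_set_scope.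
Local Open Scope ring_scope.

(** Only the moduli of the points matter, and they are independent in the sense of Kostlan. Lebesgue
    measure and the radial factors are invariant under rotating each coordinate separately.
    Averaging the squared Vandermonde product over such rotations kills all off-diagonal terms of
    its Leibniz expansion and leaves the sum over permutations s of the products of |z_i|^(2 s(i)).
    So, on events that constrain every modulus in the same way, the n points behave like independent
    variables indexed by j = 0, ..., n-1 with radial densities proportional to r^(2j+1) e^(-nV(r))
    ([ge0_integral_Cn_vandermonde], [distribution_all_logmod_ratio]). Consequently the law of the
    minimum is a product of factors 1 - p_j(s), where p_j(s) is the probability that the j-th
    variable lies below s ([prob_min_geE], [prob_min_leE]).

    In the variable v = ln r the exponent is W(v) = V(e^v), with W' = rV'(r) increasing. Hence W is
    convex, with minimum at w0 = ln t1 and W''(w0) = t1^2 V''(t1). At b = w0 - u the numerator of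
    p_j is governed by the tangent of W at b, its denominator by Laplace's method at w0. To leading
    order the index enters only through e^(-2(j+1)u), so the p_j are nearly geometric, and their sum
    is the explicit function [approx] up to a relative error of order 1/(n(t1-s)^2) + n^(-1/10)
    ([tail_sum_bounds], [tsum_bounds]).

    When that sum tends to 0, the probability that the minimum is at most s is equivalent to it
    ([prob_min_le_equiv]). The left-tail estimates are then simplifications of [approx] at s = t1 -
    x: the prefactor linearises for small x, and the exponent becomes quadratic when n x^3 tends to
    0 ([approx_gap]). With x = sqrt(y / (V''(t1) n)) the result is (ln n / y) e^((tau-y)/2), which
    is exactly what tau is designed for ([approx3E]).

    For the Gumbel limit, y = (sqrt tau - t / sqrt tau)^2 and tau = ln n - 2 ln ln n + const, so the
    sum of the p_j is e^t (1 + 2 ln ln n / ln n + O((1+t^2) / ln n)) uniformly for |t| <= ln ln n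
    ([prob_min_ge_gumbel]). The distance to e^(-e^t) is therefore x e^(-x) 2 ln ln n / ln n with x =
    e^t, up to O(1 / ln n). The maximum 1/e of x e^(-x) is reached at t = 0, and monotonicity
    controls the remaining t ([gumbel_distance_bounds], [sup_gumbel_distance]). *)

(** * Change of variables along measure-preserving maps *)

Section comp_preserving.
Context d1 d2 (X : measurableType d1) (Y : measurableType d2) (R : realType).
Variables (phi : X -> Y) (mphi : measurable_fun setT phi).

(* The library's measure instance for pushforward is shadowed by the one
   for product images and cannot be inferred. *)
Definition image_measure (m : {measure set X -> \bar R}) :
    {measure set Y -> \bar R} :=
  measure_function_pushforward__canonical__measure_function_Measure m mphi.

Lemma ge0_integral_comp_preserving (m1 : {measure set X -> \bar R})
    (m2 : {measure set Y -> \bar R}) (f : Y -> \bar R) :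
  (forall A, measurable A -> m2 A = m1 (phi @^-1` A)) ->
  measurable_fun setT f -> (forall y, 0 <= f y)%E ->
  (\int[m1]_x f (phi x) = \int[m2]_y f y)%E.
Proof.
move=> m21 mf f0.
rewrite -[LHS]/(\int[m1]_(x in phi @^-1` setT) (f \o phi) x)%E.
rewrite -ge0_integral_pushforward//.
have H A : measurable A -> A `<=` setT -> image_measure m1 A = m2 A.
  by move=> mA _; rewrite m21.
exact: (eq_measure_integral m2 H).
Qed.

End comp_preserving.

(** * Translations and scalings of the line *)

Section lebesgue_affine.
Context {R : realType}.
Local Notation mu := (@lebesgue_measure R).

(** Lebesgue measure is determined by its values on half-open intervals, so it suffices to compare
    both sides there. *)
Lemma lebesgue_measure_translate (a : R) (A : set (measurableTypeR R)) :
  measurable A -> mu A = mu ((fun x : measurableTypeR R => x + a) @^-1` A).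
Proof.
pose phi : measurableTypeR R -> measurableTypeR R := fun x => x + a.
have mphi : measurable_fun setT phi by exact: measurable_funD.
move: A; apply: (@lebesgue_measure_unique _ (image_measure mphi mu)).
move=> _ [[x y] _ <-]; rewrite /= /pushforward.
have -> : phi @^-1` `]x, y]%classic = `]x - a, y - a]%classic.
  by apply/seteqP; split => z /=; rewrite !in_itv/= /phi ltrBlDr lerBrDr.
rewrite !lebesgue_measure_itv/= !lte_fin ltrD2r.
by case: ifPn => // _; rewrite -!EFinB; congr EFin; ring.
Qed.

Lemma lebesgue_measure_scale (a : R) (A : set (measurableTypeR R)) : 0 < a ->
  measurable A ->
  mu A = (a%:E * mu ((fun x : measurableTypeR R => (a * x)%R) @^-1` A))%E.
Proof.
move=> a0.
pose phi : measurableTypeR R -> measurableTypeR R := fun x => a * x.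
have mphi : measurable_fun setT phi by exact: measurable_funM.
move: A.
apply: (@lebesgue_measure_unique _
  (mscale (NngNum (ltW a0)) (image_measure mphi mu))).
move=> _ [[x y] _ <-].
rewrite [RHS](_ : _ = (a%:E * mu (phi @^-1` `]x, y]%classic))%E)//.
have -> : phi @^-1` `]x, y]%classic = `]x / a, y / a]%classic.
  apply/seteqP; split => z /=; rewrite !in_itv/= /phi.
    by rewrite ltr_pdivrMr// ler_pdivlMr// mulrC.
  by rewrite ltr_pdivrMr// ler_pdivlMr// mulrC.
rewrite !lebesgue_measure_itv/= !lte_fin ltr_pM2r ?invr_gt0//.
case: ifPn => _; last by rewrite mule0.
by rewrite -!EFinB -EFinM; congr EFin; field; rewrite gt_eqF.
Qed.

Lemma ge0_integral_translate (f : measurableTypeR R -> \bar R) (a : R) :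
  measurable_fun setT f -> (forall x, 0 <= f x)%E ->
  (\int[mu]_x f (x + a)%R = \int[mu]_x f x)%E.
Proof.
pose phi : measurableTypeR R -> measurableTypeR R := fun x => x + a.
have mphi : measurable_fun setT phi by exact: measurable_funD.
move=> mf f0.
exact: (ge0_integral_comp_preserving mphi (@lebesgue_measure_translate a)).
Qed.

Lemma ge0_integral_scale (f : measurableTypeR R -> \bar R) (a : R) : 0 < a ->
  measurable_fun setT f -> (forall x, 0 <= f x)%E ->
  (a%:E * \int[mu]_x f (a * x)%R = \int[mu]_x f x)%E.
Proof.
move=> a0 mf f0.
pose phi : measurableTypeR R -> measurableTypeR R := fun x => a * x.
have mphi : measurable_fun setT phi by exact: measurable_funM.
rewrite [RHS](@eq_measure_integral _ _ _ setT
  (mscale (NngNum (ltW a0)) (image_measure mphi mu)) mu); last first.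
  by move=> A mA _; exact: lebesgue_measure_scale.
rewrite [RHS]ge0_integral_mscale//; congr (_ * _)%E.
by rewrite ge0_integral_pushforward.
Qed.

End lebesgue_affine.

(** * Scalings and rotations of the complex plane *)

Section lebesgue_C_invariance.
Context {R : realType}.
Local Notation mu := (@lebesgue_measure R).
Local Notation RT := (measurableTypeR R).
Implicit Types (f : RT * RT -> \bar R) (G : R[i] -> \bar R).

Lemma ge0_integral_shear1 f (t : R) :
  measurable_fun setT f -> (forall p, 0 <= f p)%E ->
  (\int[mu]_x \int[mu]_y f ((x + t * y)%R, y) =
   \int[mu]_x \int[mu]_y f (x, y))%E.
Proof.
move=> mf f0.
pose g (p : RT * RT) : RT * RT := (p.1 + t * p.2, p.2).
have mg : measurable_fun setT g.
  apply: measurable_fun_pair => //=.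
  by apply: measurable_funD => //; exact: measurable_funM.
rewrite (fubini_tonelli (f \o g) (measurableT_comp mf mg) (fun p => f0 (g p))).
rewrite (fubini_tonelli f mf f0).
apply: eq_integral => y _.
rewrite -(ge0_integral_translate (f := fun x => f (x, y)) (t * y))//.
exact: (measurable_fun_pair1 _ mf).
Qed.

Lemma ge0_integral_shear2 f (t : R) :
  measurable_fun setT f -> (forall p, 0 <= f p)%E ->
  (\int[mu]_x \int[mu]_y f (x, (y + t * x)%R) =
   \int[mu]_x \int[mu]_y f (x, y))%E.
Proof.
move=> mf f0; apply: eq_integral => x _.
rewrite -(ge0_integral_translate (f := fun y => f (x, y)) (t * x))//.
exact: (measurable_fun_pair2 _ mf).
Qed.

(* measurable_complex_of_pair, for the measurable structure on which
   lebesgue_measure lives. *)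
Lemma measurable_complex_of_pairT :
  measurable_fun [set: RT * RT] (complex_of_pair : RT * RT -> R[i]).
Proof. exact: measurable_complex_of_pair. Qed.

Lemma ge0_integral_lebesgue_C G :
  measurable_fun setT G -> (forall z, 0 <= G z)%E ->
  (\int[lebesgue_C]_z G z = \int[mu]_x \int[mu]_y G ((x : R) +i* (y : R))%C)%E.
Proof.
move=> mG G0.
have mGc := measurableT_comp mG measurable_complex_of_pairT.
rewrite -(@ge0_integral_comp_preserving _ _ _ _ _ _ measurable_complex_of_pairT
    (mu \x mu)%E lebesgue_C G (fun A _ => erefl) mG G0).
exact: (@fubini_tonelli1 _ _ RT RT _ mu mu
  (fun p : RT * RT => G (complex_of_pair p)) mGc (fun p => G0 _)).
Qed.

Lemma measurable_Re : measurable_fun setT (@complex.Re R : R[i] -> R).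
Proof.
exact: (measurableT_comp measurable_fst (@measurable_pair_of_complex R)).
Qed.

Lemma measurable_Im : measurable_fun setT (@complex.Im R : R[i] -> R).
Proof.
exact: (measurableT_comp measurable_snd (@measurable_pair_of_complex R)).
Qed.

Lemma measurable_complex d (T : measurableType d) (f g : T -> R) :
  measurable_fun setT f -> measurable_fun setT g ->
  measurable_fun setT (fun t => (f t +i* g t)%C : R[i]).
Proof.
move=> mf mg; apply: (measurableT_comp (@measurable_complex_of_pair R)
  (g := fun t => (f t, g t))).
exact: measurable_fun_pair.
Qed.

Lemma measurable_complexM d (T : measurableType d) (f g : T -> R[i]) :
  measurable_fun setT f -> measurable_fun setT g ->
  measurable_fun setT (fun t => f t * g t).
Proof.
move=> mf mg.
have -> : (fun t => f t * g t) = fun t =>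
    ((complex.Re (f t) * complex.Re (g t) - complex.Im (f t) * complex.Im (g t)) +i*
     (complex.Re (f t) * complex.Im (g t) + complex.Im (f t) * complex.Re (g t)))%C.
  by apply/funext => t; case: (f t) => a b; case: (g t).
by apply: measurable_complex; [apply: measurable_funB|apply: measurable_funD];
  apply: measurable_funM; (exact: (measurableT_comp measurable_Re) ||
    exact: (measurableT_comp measurable_Im)).
Qed.

Lemma measurable_complexB d (T : measurableType d) (f g : T -> R[i]) :
  measurable_fun setT f -> measurable_fun setT g ->
  measurable_fun setT (fun t => f t - g t).
Proof.
move=> mf mg.
have -> : (fun t => f t - g t) = fun t =>
    ((complex.Re (f t) - complex.Re (g t)) +i* (complex.Im (f t) - complex.Im (g t)))%C.
  by apply/funext => t; case: (f t) => a b; case: (g t).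
by apply: measurable_complex; apply: measurable_funB;
  (exact: (measurableT_comp measurable_Re) ||
    exact: (measurableT_comp measurable_Im)).
Qed.

Lemma measurable_normc : measurable_fun setT (@Normc.normc R : R[i] -> R).
Proof.
have -> : @Normc.normc R = Num.sqrt \o
    (fun z : R[i] => complex.Re z ^+ 2 + complex.Im z ^+ 2).
  by apply/funext => -[].
apply: measurableT_comp.
  by apply: continuous_measurable_fun; exact: sqrt_continuous.
by apply: measurable_funD; apply: measurable_funX;
  [exact: measurable_Re|exact: measurable_Im].
Qed.

Lemma ge0_integral_complex_scale G (r : R) : 0 < r ->
  measurable_fun setT G -> (forall z, 0 <= G z)%E ->
  ((r ^+ 2)%:E * \int[lebesgue_C]_z G (r%:C%C * z)%R = \int[lebesgue_C]_z G z)%E.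
Proof.
move=> r0 mG G0.
have mr : measurable_fun setT (fun z : R[i] => r%:C%C * z).
  by apply: measurable_complexM.
have mGc := measurableT_comp mG measurable_complex_of_pairT.
have mGr := measurableT_comp mG mr.
have mGrc := measurableT_comp mGr measurable_complex_of_pairT.
rewrite !ge0_integral_lebesgue_C//.
pose f (p : RT * RT) := G (complex_of_pair p).
pose F (x : RT) := (\int[mu]_y f (x, y))%E.
have mF : measurable_fun setT F.
  exact: (measurable_fun_fubini_tonelli_F f mGc (fun p => G0 _)).
have F0 x : (0 <= F x)%E by apply: integral_ge0 => y _; exact: G0.
rewrite -[RHS](ge0_integral_scale r0 mF F0).
rewrite expr2 EFinM -muleA; congr (_ * _)%E.
rewrite -ge0_integralZl_EFin//; last 3 first.
- by move=> x _; apply: integral_ge0 => y _; exact: G0.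
- exact: (measurable_fun_fubini_tonelli_F _ mGrc (fun p => G0 _)).
- exact: ltW.
apply: eq_integral => x _.
rewrite /F -(ge0_integral_scale (f := fun y => f (r * x, y)) r0)//; last 2 first.
- exact: (measurable_fun_pair2 _ mGc).
- by move=> y; exact: G0.
congr (_ * _)%E; apply: eq_integral => y _; congr (G _).
by rewrite /complex_of_pair/=; simpc.
Qed.

(** A rotation by an angle that is not a multiple of pi is a product of three shears, and each shear
    preserves area because, with one coordinate fixed, it is a translation of the other. *)
Lemma ge0_integral_complex_rotate G (w : R[i]) : Normc.normc w = 1 ->
  measurable_fun setT G -> (forall z, 0 <= G z)%E ->
  (\int[lebesgue_C]_z G (w * z)%R = \int[lebesgue_C]_z G z)%E.
Proof.
pose rot (w : R[i]) := forall G, measurable_fun setT G ->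
  (forall z, 0 <= G z)%E ->
  (\int[lebesgue_C]_z G (w * z)%R = \int[lebesgue_C]_z G z)%E.
have mM v : measurable_fun setT (fun z : R[i] => v * z).
  by apply: measurable_complexM.
have rotM v u : rot v -> rot u -> rot (v * u).
  move=> rv ru H mH H0.
  rewrite -(rv H mH H0) -(ru (fun z => H (v * z)%R))//.
    by apply: eq_integral => z _; rewrite mulrA.
  exact: measurableT_comp.
suff: Normc.normc w = 1 -> rot w by move=> /[apply]; exact.
have rot_im a b : a ^+ 2 + b ^+ 2 = 1 -> b != 0 -> rot (a +i* b)%C.
  move=> ab b0 {}G mG G0.
  have mGc := measurableT_comp mG measurable_complex_of_pairT.
  have mGr := measurableT_comp mG (mM (a +i* b)%C).
  rewrite (ge0_integral_lebesgue_C mG G0).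
  rewrite (ge0_integral_lebesgue_C mGr (fun z => G0 _)).
  (* For a + ib = e^(i theta) the outer shear parameter is t = (a-1)/b = -tan(theta/2); the middle
     one is b. The two identities are what makes the composite equal to the rotation. *)
  have [t [tb ta]] : exists t, t * b = a - 1 /\ t * (2 + t * b) = - b.
    exists (- ((1 - a) / b)); split; first by field.
    apply/eqP; rewrite -subr_eq0; apply/eqP.
    transitivity ((a ^+ 2 + b ^+ 2 - 1) / b); first by field.
    by rewrite ab subrr mul0r.
  pose f0 (p : RT * RT) := G (complex_of_pair p).
  pose f1 (p : RT * RT) := f0 (p.1 + t * p.2, p.2).
  pose f2 (p : RT * RT) := f1 (p.1, p.2 + b * p.1).
  have mf1 : measurable_fun setT f1.
    apply: (measurableT_comp mGc
      (g := fun p : RT * RT => (p.1 + t * p.2, p.2))).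
    apply: measurable_fun_pair => //=.
    by apply: measurable_funD => //; exact: measurable_funM.
  have mf2 : measurable_fun setT f2.
    apply: (measurableT_comp mf1
      (g := fun p : RT * RT => (p.1, p.2 + b * p.1))).
    apply: measurable_fun_pair => //=.
    by apply: measurable_funD => //; exact: measurable_funM.
  rewrite -[RHS](@ge0_integral_shear1 f0 t mGc (fun p => G0 _)).
  rewrite -[RHS](@ge0_integral_shear2 f1 b mf1 (fun p => G0 _)).
  rewrite -[RHS](@ge0_integral_shear1 f2 t mf2 (fun p => G0 _)).
  apply: eq_integral => x _; apply: eq_integral => y _; congr (G _).
  rewrite /complex_of_pair/=; simpc.
  have re : x + t * y + t * (y + b * (x + t * y)) =
      x * (1 + t * b) + y * (t * (2 + t * b)) by ring.
  have im : y + b * (x + t * y) = b * x + y * (1 + t * b) by ring.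
  rewrite re im ta tb; congr (_ +i* _)%C; ring.
case: w => a b /(congr1 (fun x => x ^+ 2)).
rewrite /Normc.normc sqr_sqrtr ?addr_ge0 ?sqr_ge0// expr1n => ab.
have [b0|b0] := eqVneq b 0; last exact: rot_im.
move: ab; rewrite b0 expr0n addr0 => /eqP; rewrite sqrf_eq1 => /orP[]/eqP ->.
  by move=> H mH H0; apply: eq_integral => z _; rewrite mul1r.
(* Division by the imaginary part is impossible for -1, which is therefore reached as the square of
   i. *)
have -> : (-1 +i* 0)%C = (0 +i* 1)%C * (0 +i* 1)%C :> R[i].
  by simpc.
by apply: rotM; apply: rot_im; rewrite ?oner_eq0// expr0n expr1n add0r.
Qed.

End lebesgue_C_invariance.

(** * Integration of radial functions in logarithmic polar form *)

Section radial_integral.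
Context {R : realType}.
Local Notation mu := (@lebesgue_measure R).
Local Notation RT := (measurableTypeR R).
Implicit Types (z : R[i]).

Definition logmod z : R := ln (Normc.normc z).

Lemma measurable_logmod : measurable_fun setT logmod.
Proof.
by apply: measurableT_comp; [exact: measurable_ln|exact: measurable_normc].
Qed.

Lemma measurable_set1C z : measurable [set z].
Proof.
rewrite (_ : [set z] = pair_of_complex @^-1` [set pair_of_complex z]).
  rewrite -[X in measurable X]setTI; apply: measurable_pair_of_complex => //.
  case: (pair_of_complex z) => a b.
  rewrite (_ : [set (a, b)] = [set a] `*` [set b]).
    exact: measurableX.
  by apply/seteqP; split => [[x y] /= [-> ->]|[x y] /= [-> ->]].
apply/seteqP; split => [_ /= -> //|w /=].
exact: (can_inj (@pair_of_complexK R)).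
Qed.

Lemma lebesgue_C_set1 z : lebesgue_C [set z] = 0%E.
Proof.
rewrite /lebesgue_C /pushforward.
rewrite (_ : _ @^-1` _ = [set complex.Re z] `*` [set complex.Im z]).
  rewrite product_measure1E//.
  rewrite /= lebesgue_measure_set1.
  by rewrite mul0e.
case: z => a b; apply/seteqP; split => [[x y] /= [-> ->]//|[x y] /= [-> ->]//].
Qed.

Lemma normc_gt0 z : z != 0 -> 0 < Normc.normc z.
Proof.
case: z => a b; rewrite eq_complex/= negb_and => ab.
rewrite sqrtr_gt0; case/orP: ab => h.
  by rewrite ltr_pwDl ?sqr_ge0// exprn_even_gt0.
by rewrite ltr_wpDl ?sqr_ge0// exprn_even_gt0.
Qed.

Lemma logmodM (r : R) z : 0 < r -> z != 0 ->
  logmod (r%:C%C * z) = ln r + logmod z.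
Proof.
move=> r0 z0; rewrite /logmod -lnM ?posrE ?normc_gt0//; congr ln.
case: z {z0} => a b /=; simpc.
rewrite !exprMn -mulrDr sqrtrM ?sqr_ge0// sqrtr_sqr ger0_norm//.
exact: ltW.
Qed.

Definition radial_const : \bar R :=
  (\int[lebesgue_C]_z
    (\1_[set~ (0 : R[i])] z * \1_(`]0, 1]) (logmod z)
       * expR (- (2 * logmod z)))%:E)%E.

Lemma integral_window (x : R) :
  (\int[mu]_v (\1_(`]0%R, 1%R]%classic : set R) (x - v)%R)%:E = 1)%E.
Proof.
rewrite (_ : (fun v => _) = (fun v => (\1_(`[x - 1, x[%classic : set R) v)%:E)).
  rewrite integral_indic// setIT /= lebesgue_measure_itv/= lte_fin.
  by rewrite ltrBlDr ltrDl ltr01 -EFinB; congr EFin; ring.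
apply/funext => v; congr EFin; rewrite !indicE !mem_setE !in_itv/=.
by congr ((_ : bool)%:R); apply/idP/idP => /andP[? ?]; apply/andP; split; lra.
Qed.

(* Haar's trick: insert the window 1 = \int 1_(0,1](ln|z| - v) dv, exchange
   the integrals and rescale z by e^v. *)
Lemma ge0_integral_radial (g : RT -> \bar R) :
  measurable_fun setT g -> (forall v, 0 <= g v)%E ->
  (\int[lebesgue_C]_z ((\1_[set~ (0 : R[i])] z)%:E * g (logmod z)) =
   radial_const * \int[mu]_v (g v * (expR (2 * v))%:E))%E.
Proof.
move=> mg g0.
pose one z : R := \1_[set~ (0 : R[i])] z.
pose phi (x : R) : R := \1_(`]0%R, 1%R]%classic : set R) x.
have one0 z : 0 <= one z by rewrite /one indicE.
have phi0 x : 0 <= phi x by rewrite /phi indicE.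
have mone : measurable_fun setT one.
  by apply: measurable_indic; apply: measurableC; exact: measurable_set1C.
have mphi : measurable_fun setT phi by apply: measurable_indic.
have mL := measurable_logmod.
have mgL : measurable_fun setT (g \o logmod).
  exact: (measurableT_comp mg mL).
pose G z := ((one z)%:E * g (logmod z))%E.
have mG : measurable_fun setT G.
  by apply: emeasurable_funM => //; exact/measurable_EFinP.
have G0 z : (0 <= G z)%E by rewrite mule_ge0// lee_fin.
pose F (p : R[i] * RT) : \bar R := (G p.1 * (phi (logmod p.1 - p.2))%:E)%E.
have mF : measurable_fun setT F.
  apply: emeasurable_funM; first exact: (measurableT_comp mG).
  apply/measurable_EFinP; apply: measurableT_comp => //.
  by apply: measurable_funB => //; exact: measurableT_comp.
have F0 p : (0 <= F p)%E by rewrite mule_ge0// lee_fin.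
pose K (p : R[i] * RT) : \bar R :=
  ((one p.1 * phi (logmod p.1))%:E * (g (p.2 + logmod p.1)%R * (expR (2 * p.2))%:E))%E.
have mK : measurable_fun setT K.
  apply: emeasurable_funM.
    apply/measurable_EFinP; apply: measurable_funM; first exact: measurableT_comp.
    by apply: measurableT_comp => //; exact: measurableT_comp.
  apply: emeasurable_funM.
    apply: (measurableT_comp mg (g := fun p : R[i] * RT => p.2 + logmod p.1)).
    by apply: measurable_funD => //; exact: measurableT_comp.
  apply/measurable_EFinP; apply: measurableT_comp; first exact: measurable_expR.
  exact: measurable_funM.
have K0 p : (0 <= K p)%E.
  by rewrite !mule_ge0// lee_fin ?expR_ge0// mulr_ge0.
transitivity (\int[lebesgue_C]_z \int[mu]_v F (z, v))%E.
  apply: eq_integral => z _; rewrite /F/= ge0_integralZl//; last first.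
  - by move=> v _; rewrite lee_fin.
  - apply/measurable_EFinP; apply: measurableT_comp => //.
    exact: measurable_funB.
  by rewrite integral_window mule1.
rewrite (fubini_tonelli F mF F0).
transitivity (\int[mu]_v \int[lebesgue_C]_z K (z, v))%E.
  apply: eq_integral => v _.
  rewrite -(ge0_integral_complex_scale (G := fun z => F (z, v)) (expR_gt0 v))//;
    last exact: (measurable_fun_pair1 _ mF).
  have mFv : measurable_fun setT (fun z => F ((expR v)%:C%C * z, v)).
    apply: (measurableT_comp (measurable_fun_pair1 v mF)
      (g := fun z => (expR v)%:C%C * z)).
    exact: measurable_complexM.
  rewrite -(ge0_integralZl_EFin _ measurableT _ mFv (sqr_ge0 _))//.
  apply: eq_integral => z _; rewrite /F /G /K /=.
  have [->|z0] := eqVneq z 0.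
    have o0 : one 0 = 0 by rewrite /one indicE memNset//=; exact.
    by rewrite mulr0 o0 mul0r !mul0e mule0.
  have ez0 : (expR v)%:C%C * z != 0.
    by rewrite mulf_neq0// (inj_eq (@complexI R)) gt_eqF// expR_gt0.
  rewrite logmodM ?expR_gt0// expRK.
  have -> : one ((expR v)%:C%C * z) = 1.
    by rewrite /one indicE mem_set//=; exact/eqP.
  have -> : one z = 1 by rewrite /one indicE mem_set//=; exact/eqP.
  rewrite mul1e mul1r addrAC subrr add0r muleC -muleA [RHS]muleC -muleA; congr (_ * _)%E.
  by rewrite muleC -expRM_natl.
rewrite -(fubini_tonelli K mK K0).
have ge_ge0 v : (0 <= g v * (expR (2 * v))%:E)%E.
  by rewrite mule_ge0// lee_fin expR_ge0.
have mge (c : R) : measurable_fun [set: RT] (fun v => g v * (expR (2 * (v - c)))%:E)%E.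
  apply: emeasurable_funM => //.
  apply/measurable_EFinP; apply: measurableT_comp; first exact: measurable_expR.
  by apply: measurable_funM => //; exact: measurable_funB.
have mge0 : measurable_fun [set: RT] (fun v => g v * (expR (2 * v))%:E)%E.
  by have := mge 0; under eq_fun do rewrite subr0.
have mh : measurable_fun setT (fun z =>
    (one z * phi (logmod z) * expR (- (2 * logmod z)))%:E).
  apply/measurable_EFinP; apply: measurable_funM.
    by apply: measurable_funM => //; exact: measurableT_comp.
  apply: measurableT_comp; first exact: measurable_expR.
  by apply: measurableT_comp => //; exact: measurable_funM.
rewrite /radial_const -(ge0_integralZr _ measurableT mh)//; last 2 first.
- by move=> z _; rewrite lee_fin !mulr_ge0// expR_ge0.
- exact: integral_ge0.
apply: eq_integral => z _; rewrite /K/=.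
have mKz : measurable_fun [set: RT]
    (fun v => g (v + logmod z)%R * (expR (2 * v))%:E)%E.
  apply: emeasurable_funM.
    apply: (measurableT_comp mg (g := fun v : RT => v + logmod z)).
    exact: measurable_funD.
  apply/measurable_EFinP; apply: measurableT_comp; first exact: measurable_expR.
  exact: measurable_funM.
rewrite (ge0_integralZl _ measurableT mKz)//; last 2 first.
- by move=> v _; rewrite mule_ge0// lee_fin expR_ge0.
- by rewrite lee_fin mulr_ge0.
rewrite [in RHS]EFinM -muleA; congr (_ * _)%E.
transitivity (\int[mu]_v (g v * (expR (2 * (v - logmod z)))%:E))%E.
  rewrite -(ge0_integral_translate (logmod z) (mge (logmod z))).
    by apply: eq_integral => v _; rewrite addrK.
  by move=> v; rewrite mule_ge0// lee_fin expR_ge0.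
have e0 : (0 <= (expR (- (2 * logmod z)))%:E)%E by rewrite lee_fin expR_ge0.
rewrite -(ge0_integralZl _ measurableT mge0 (fun v _ => ge_ge0 v) e0).
apply: eq_integral => v _; rewrite muleCA -EFinM -expRD.
by congr (_ * (expR _)%:E)%E; ring.
Qed.

End radial_integral.

(** * Tonelli and coordinatewise rotations in n complex variables *)

Section lebesgue_Cn_integral.
Context {R : realType}.
Local Notation Ct := (R[i]).

Lemma ge0_integral_Cn0 (G : 0.-tuple Ct -> \bar R) : measurable_fun setT G ->
  (\int[lebesgue_Cn 0]_z G z = G [tuple])%E.
Proof. by move=> mG; rewrite /= integral_dirac// diracT mul1e. Qed.

Lemma ge0_integral_CnS n (G : n.+1.-tuple Ct -> \bar R) :
  measurable_fun setT G -> (forall z, 0 <= G z)%E ->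
  (\int[lebesgue_Cn n.+1]_z G z =
   \int[lebesgue_C]_z \int[lebesgue_Cn n]_zs G (cons_pair (z, zs)))%E.
Proof.
move=> mG G0.
have mGc := measurableT_comp mG (@measurable_cons_pair R n).
rewrite -(@ge0_integral_comp_preserving _ _ _ _ _ _ (@measurable_cons_pair R n)
  (lebesgue_C \x @lebesgue_Cn R n)%E (lebesgue_Cn n.+1) G
  (fun A _ => erefl) mG G0).
exact: (@fubini_tonelli1 _ _ _ _ _ lebesgue_C (@lebesgue_Cn R n)
  (fun p => G (cons_pair p)) mGc (fun p => G0 _)).
Qed.

Lemma measurable_mktuple n d (T : measurableType d) (f : 'I_n -> T -> Ct) :
  (forall i, measurable_fun setT (f i)) ->
  measurable_fun setT (fun t => [tuple f i t | i < n]).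
Proof.
move=> mf; apply/measurable_fun_tnthP => i.
rewrite (_ : _ \o _ = f i)//.
by apply/funext => t /=; rewrite tnth_mktuple.
Qed.

Lemma tnth_cons_pair n (z : Ct) (zs : n.-tuple Ct) (i : 'I_n) :
  tnth (cons_pair (z, zs)) (lift ord0 i) = tnth zs i.
Proof. by rewrite /cons_pair tnthS. Qed.

Lemma ge0_integral_Cn_prod n (f : 'I_n -> Ct -> \bar R) :
  (forall i, measurable_fun setT (f i)) -> (forall i z, 0 <= f i z)%E ->
  (\int[lebesgue_Cn n]_z (\prod_(i < n) f i (tnth z i)) =
   \prod_(i < n) \int[lebesgue_C]_z f i z)%E.
Proof.
elim: n f => [|n IH] f mf f0.
  rewrite big_ord0 (eq_integral (fun=> 1%E)).
    by rewrite ge0_integral_Cn0.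
  by move=> z _; rewrite big_ord0.
have mprod m (g : 'I_m -> Ct -> \bar R) : (forall i, measurable_fun setT (g i)) ->
    measurable_fun setT (fun z : m.-tuple Ct => \prod_(i < m) g i (tnth z i))%E.
  move=> mg.
  elim: (index_enum _) => [|i s IHs].
    rewrite (_ : (fun _ => _) = cst 1%E); first exact: measurable_cst.
    by apply/funext => z; rewrite big_nil.
  under eq_fun do rewrite big_cons.
  apply: emeasurable_funM => //.
  exact: (measurableT_comp (mg i) (measurable_tnth i)).
rewrite ge0_integral_CnS; last 2 first.
- exact: mprod.
- by move=> z; apply: prode_ge0 => i _.
rewrite big_ord_recl -(IH (fun i => f (lift ord0 i)))//.
have mp := mprod _ (fun i => f (lift ord0 i)) (fun i => mf _).
rewrite -ge0_integralZr//; last first.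
  by apply: integral_ge0 => zs _; apply: prode_ge0.
apply: eq_integral => z _.
rewrite -(ge0_integralZl _ measurableT mp)//; last first.
  by move=> zs _; apply: prode_ge0.
apply: eq_integral => zs _.
rewrite big_ord_recl; congr (f ord0 _ * _)%E.
by apply: eq_bigr => i _; rewrite tnth_cons_pair.
Qed.

Lemma ge0_integral_Cn_rotate n (w : 'I_n -> Ct) (G : n.-tuple Ct -> \bar R) :
  (forall i, Normc.normc (w i) = 1) ->
  measurable_fun setT G -> (forall z, 0 <= G z)%E ->
  (\int[lebesgue_Cn n]_z G [tuple (w i * tnth z i)%R | i < n] =
   \int[lebesgue_Cn n]_z G z)%E.
Proof.
elim: n w G => [|n IH] w G w1 mG G0.
  apply: eq_integral => z _; congr G; apply: eq_from_tnth; case=> //.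
have mw m (u : 'I_m -> Ct) : measurable_fun setT
    (fun z : m.-tuple Ct => [tuple u i * tnth z i | i < m]).
  apply: measurable_mktuple => i; apply: measurable_complexM => //.
  exact: measurable_tnth.
rewrite ge0_integral_CnS//; last exact: (measurableT_comp mG (mw _ w)).
rewrite (ge0_integral_CnS mG G0).
pose H z := (\int[lebesgue_Cn n]_zs G (cons_pair (z, zs)))%E.
have mGc := measurableT_comp mG (@measurable_cons_pair R n).
have mH : measurable_fun setT H.
  exact: (measurable_fun_fubini_tonelli_F _ mGc (fun p => G0 _)).
have H0 z : (0 <= H z)%E by apply: integral_ge0.
rewrite -[RHS](ge0_integral_complex_rotate (w1 ord0) mH H0).
apply: eq_integral => z _; rewrite /H.
rewrite -(IH (fun i => w (lift ord0 i)) (fun zs => G (cons_pair (w ord0 * z, zs))))//;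
  last exact: (measurable_fun_pair2 (w ord0 * z) mGc).
apply: eq_integral => zs _; congr G; apply: eq_from_tnth => i.
rewrite tnth_mktuple; case: (unliftP ord0 i) => [j ->|->].
  by rewrite !tnth_cons_pair tnth_mktuple.
by rewrite /cons_pair !tnth0.
Qed.

End lebesgue_Cn_integral.

(** * Averaging the squared Vandermonde product over roots of unity *)

Section vandermonde_average.
Context {R : realType}.
Local Notation Ct := (R[i]).
Local Notation normc := (@Normc.normc R).

(** The polynomial X^n - 1 splits over the complex numbers and is separable, so it has n distinct
    roots, one of which must be primitive. *)
Lemma complex_prim_root n : (0 < n)%N -> exists w : Ct, n.-primitive_root w.
Proof.
move=> n0; have [rs rsE] := closed_field_poly_normal ('X^n - 1 : {poly Ct}).
rewrite (monicP (monicXnsubC 1 n0)) scale1r in rsE.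
have unity : all n.-unity_root rs.
  by apply/allP => z zrs; rewrite /root_of_unity rsE root_prod_XsubC.
have rs_uniq : uniq rs.
  rewrite -separable_prod_XsubC -rsE separable_Xn_sub_1//.
  by rewrite pnatr_eq0 -lt0n.
have rs_size : (n <= size rs)%N.
  by rewrite -ltnS -(size_prod_XsubC rs id) -rsE size_XnsubC.
by have /hasP[w _ wn] := has_prim_root n0 unity rs_uniq rs_size; exists w.
Qed.

Lemma normc_sqrE (z : Ct) : ((normc z ^+ 2)%:C)%C = z * conjc z.
Proof.
case: z => a b; rewrite /Normc.normc sqr_sqrtr ?addr_ge0 ?sqr_ge0//; simpc.
by congr (_ +i* _)%C; ring.
Qed.

Lemma normcX (z : Ct) k : normc (z ^+ k) = normc z ^+ k.
Proof. by elim: k => [|k IH]; rewrite ?expr0 ?Normc.normc1// !exprS Normc.normcM IH. Qed.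

Lemma normc_ge0 (z : Ct) : 0 <= normc z.
Proof. by case: z => a b; exact: sqrtr_ge0. Qed.

Lemma normc_unity_root (w : Ct) n : (0 < n)%N -> w ^+ n = 1 -> normc w = 1.
Proof.
move=> n0 /(congr1 normc); rewrite normcX Normc.normc1 => /eqP.
by rewrite pexpr_eq1 ?normc_ge0 ?n0// => /eqP.
Qed.

Lemma conjc_normc1 (w : Ct) : normc w = 1 -> conjc w = w^-1.
Proof.
move=> w1; have /eqP : w * conjc w = 1 by rewrite -normc_sqrE w1 expr1n.
have w0 : w != 0 by apply/eqP => w0; move/eqP: w1; rewrite w0 Normc.normc0 eq_sym oner_eq0.
by rewrite -{1}(divff w0) => /eqP /(mulfI w0).
Qed.

Definition vandermonde_sqr n (z : 'I_n -> Ct) : R :=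
  \prod_(j < n) \prod_(k < n | (j < k)%N) normc (z j - z k) ^+ 2.

(** Leibniz expansion of the Vandermonde determinant multiplied by that of its conjugate; each term
    is a product over coordinates, which is what makes coordinatewise averaging effective. *)
Lemma vandermonde_sqrE n (z : 'I_n -> Ct) :
  ((vandermonde_sqr z)%:C)%C =
  \sum_(s : 'S_n) \sum_(t : 'S_n) (-1) ^+ s * (-1) ^+ t *
    \prod_(i < n) (z i ^+ s i * conjc (z i) ^+ t i).
Proof.
have -> : ((vandermonde_sqr z)%:C)%C =
    \det (Vandermonde n (\row_i z i)) * conjc (\det (Vandermonde n (\row_i z i))).
  rewrite det_Vandermonde !rmorph_prod/= -big_split/=.
  apply: eq_bigr => j _; rewrite !rmorph_prod/= -big_split/=.
  apply: eq_bigr => k _; rewrite normc_sqrE !mxE.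
  by rewrite -[z j - z k]opprB [in X in _ * X = _]rmorphN mulrNN.
have -> : \det (Vandermonde n (\row_i z i)) =
    \sum_(s : 'S_n) (-1) ^+ s * \prod_(i < n) z i ^+ s i.
  rewrite -det_tr; apply: eq_bigr => s _; congr (_ * _).
  by apply: eq_bigr => i _; rewrite !mxE.
rewrite rmorph_sum/= mulr_suml; apply: eq_bigr => s _.
rewrite mulr_sumr; apply: eq_bigr => t _.
have -> : conjc ((-1) ^+ t * \prod_(i < n) z i ^+ t i) =
    (-1) ^+ t * \prod_(i < n) conjc (z i) ^+ t i.
  rewrite rmorphM/= rmorph_sign rmorph_prod/=; congr (_ * _).
  by apply: eq_bigr => i _; rewrite rmorphXn.
by rewrite big_split/= mulrACA.
Qed.

(* Averaging over all coordinatewise rotations by n-th roots of unity keeps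
   only the diagonal of the double sum over permutations. *)
Lemma vandermonde_sqr_average n (w : Ct) (z : 'I_n -> Ct) :
  n.-primitive_root w ->
  \sum_(k : {ffun 'I_n -> 'I_n}) vandermonde_sqr (fun i => w ^+ k i * z i) =
  (n ^ n)%:R * \sum_(s : 'S_n) \prod_(i < n) normc (z i) ^+ (2 * s i).
Proof.
move=> wn; have n0 := prim_order_gt0 wn; have wn1 := prim_expr_order wn.
have w1 := normc_unity_root n0 wn1.
have w0 : w != 0.
  by apply/eqP => w0; move: w1; rewrite w0 Normc.normc0 => /eqP; rewrite eq_sym oner_eq0.
(* Orthogonality of characters. Both exponents lie below n, so w^(a-b) = 1 forces a = b; this is why
   finitely many rotations replace an integral over the circle. *)
have geom (a b : 'I_n) :
    \sum_(k < n) (w ^+ k) ^+ a * conjc (w ^+ k) ^+ b = (a == b)%:R * n%:R.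
  pose u := w ^+ a * conjc w ^+ b.
  rewrite (eq_bigr (fun k : 'I_n => u ^+ k)); last first.
    move=> k _; rewrite rmorphXn/= /u exprMn -!exprM.
    by rewrite (mulnC k a) (mulnC k b).
  have [ab|ab] := eqVneq a b.
    have -> : u = 1.
      by rewrite /u ab conjc_normc1// exprVn divff// expf_neq0.
    rewrite (eq_bigr (fun=> 1)); last by move=> k _; rewrite expr1n.
    by rewrite sumr_const card_ord mul1r.
  have u1 : u != 1.
    apply: contra ab => /eqP; rewrite /u conjc_normc1// exprVn => wab.
    have /eqP : w ^+ a = w ^+ b.
      by rewrite -[LHS]mulr1 -(mulVf (expf_neq0 b w0)) mulrA wab mul1r.
    by rewrite (eq_prim_root_expr wn) !modn_small// => /eqP/val_inj/eqP.
  have un : u ^+ n = 1.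
    have cn1 : conjc w ^+ n = 1 by rewrite -rmorphXn wn1 rmorph1.
    by rewrite /u exprMn -!exprM (mulnC a) (mulnC b) !exprM wn1 cn1 !expr1n mulr1.
  rewrite mul0r; apply/eqP; move: u1; rewrite -subr_eq0 => u1.
  by rewrite -(mulrI_eq0 _ (mulfI u1)) -subrX1 un subrr.
apply: (@complexI R); rewrite rmorph_sum/=.
transitivity (\sum_(k : {ffun 'I_n -> 'I_n}) \sum_(s : 'S_n) \sum_(t : 'S_n)
    (-1) ^+ s * (-1) ^+ t * \prod_(i < n) (z i ^+ s i * conjc (z i) ^+ t i *
      ((w ^+ k i) ^+ s i * conjc (w ^+ k i) ^+ t i))).
  apply: eq_bigr => k _; rewrite vandermonde_sqrE.
  apply: eq_bigr => s _; apply: eq_bigr => t _; congr (_ * _).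
  apply: eq_bigr => i _; rewrite rmorphM/= !exprMn.
  by rewrite mulrACA mulrC.
rewrite exchange_big/= rmorphM/= rmorph_nat rmorph_sum/= mulr_sumr.
apply: eq_bigr => s _; rewrite exchange_big/=.
have inner (t : 'S_n) : \sum_(k : {ffun 'I_n -> 'I_n})
    (-1) ^+ s * (-1) ^+ t * \prod_(i < n) (z i ^+ s i * conjc (z i) ^+ t i *
      ((w ^+ k i) ^+ s i * conjc (w ^+ k i) ^+ t i)) =
    (-1) ^+ s * (-1) ^+ t * \prod_(i < n) (z i ^+ s i * conjc (z i) ^+ t i *
      ((s i == t i)%:R * n%:R)).
  rewrite -mulr_sumr; congr (_ * _).
  rewrite -(bigA_distr_bigA (fun i (j : 'I_n) =>
    z i ^+ s i * conjc (z i) ^+ t i * ((w ^+ j) ^+ s i * conjc (w ^+ j) ^+ t i))).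
  by apply: eq_bigr => i _; rewrite -mulr_sumr geom.
rewrite (eq_bigr _ (fun t _ => inner t)) (bigD1 s)//= [X in _ + X]big1.
  rewrite addr0 -expr2 sqrr_sign mul1r natrX rmorph_prod/=.
  rewrite -[X in X%:R ^+ X]card_ord -prodr_const -big_split/=.
  apply: eq_bigr => i _; rewrite eqxx mul1r mulrC exprM rmorphXn/= normc_sqrE.
  by rewrite exprMn card_ord.
move=> t ts; have [i sti] : exists i, s i != t i.
  apply/existsP; apply: contraR ts; rewrite negb_exists => /forallP st.
  by apply/eqP/permP => i; apply/esym/eqP; rewrite -[_ == _]negbK.
by rewrite (bigD1 i)//= (negbTE sti) mul0r mulr0 mul0r mulr0.
Qed.

End vandermonde_average.

(** * Integrals of radial weights against the squared Vandermonde product *)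

Section radial_weight_integral.
Context {R : realType}.
Local Notation Ct := (R[i]).
Local Notation normc := (@Normc.normc R).

Lemma measurable_vandermonde_sqr n :
  measurable_fun setT (fun z : n.-tuple Ct => vandermonde_sqr (tnth z)).
Proof.
apply: measurable_prod => j _.
have mk k : measurable_fun setT
    (fun z : n.-tuple Ct => normc (tnth z j - tnth z k) ^+ 2).
  apply: measurable_funX; apply: (measurableT_comp (@measurable_normc R)
    (g := fun z : n.-tuple Ct => tnth z j - tnth z k)).
  by apply: measurable_complexB; exact: measurable_tnth.
under eq_fun do rewrite big_mkcond/=.
apply: measurable_prod => k _; case: (j < k)%N; first exact: mk.
exact: measurable_cst.
Qed.

Lemma vandermonde_sqr_ge0 n (z : 'I_n -> Ct) : 0 <= vandermonde_sqr z.
Proof. by apply: prodr_ge0 => j _; apply: prodr_ge0 => k _; exact: sqr_ge0. Qed.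

(** The integral is unchanged by each of the n^n rotations, hence equals their average. The averaged
    integrand is a sum over permutations of products of one-variable functions, and the n! resulting
    products of integrals differ only by the order of their factors. *)
Lemma ge0_integral_Cn_vandermonde n (g : Ct -> R) : (0 < n)%N ->
  measurable_fun setT g -> (forall z, 0 <= g z) ->
  (forall w z, normc w = 1 -> g (w * z) = g z) ->
  (\int[lebesgue_Cn n]_z
      ((\prod_(i < n) g (tnth z i)) * vandermonde_sqr (tnth z))%:E =
   (n`!)%:R%:E * \prod_(j < n) \int[lebesgue_C]_z (g z * normc z ^+ (2 * j))%:E)%E.
Proof.
move=> n0 mg g0 grot; have [w wn] := @complex_prim_root R n n0.
have w1 := normc_unity_root n0 (prim_expr_order wn).
pose H (z : n.-tuple Ct) : R := (\prod_(i < n) g (tnth z i)) * vandermonde_sqr (tnth z).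
have mH : measurable_fun setT (fun z => (H z)%:E).
  apply/measurable_EFinP; apply: measurable_funM.
    apply: measurable_prod => i _.
    exact: (measurableT_comp mg (measurable_tnth i)).
  exact: measurable_vandermonde_sqr.
have H0 z : (0 <= (H z)%:E)%E.
  by rewrite lee_fin mulr_ge0 ?vandermonde_sqr_ge0// prodr_ge0.
pose rot (k : {ffun 'I_n -> 'I_n}) (z : n.-tuple Ct) :=
  [tuple w ^+ k i * tnth z i | i < n].
have mrot k : measurable_fun setT (rot k).
  apply: measurable_mktuple => i; apply: measurable_complexM => //.
  exact: measurable_tnth.
have wk1 (k : {ffun 'I_n -> 'I_n}) i : normc (w ^+ k i) = 1.
  by rewrite normcX w1 expr1n.
pose N : R := (n ^ n)%:R.
have N0 : 0 < N by rewrite ltr0n expn_gt0 n0.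
have gn_ge0 (j : nat) z : (0 <= (g z * normc z ^+ (2 * j))%:E)%E.
  by rewrite lee_fin mulr_ge0// exprn_ge0// normc_ge0.
have mgn (j : nat) : measurable_fun setT (fun z => (g z * normc z ^+ (2 * j))%:E).
  apply/measurable_EFinP; apply: measurable_funM => //; apply: measurable_funX.
  exact: measurable_normc.
pose Pi (s : 'S_n) (z : n.-tuple Ct) :=
  (\prod_(i < n) (g (tnth z i) * normc (tnth z i) ^+ (2 * s i))%:E)%E.
have Pi0 s z : (0 <= Pi s z)%E by apply: prode_ge0.
have mPi s : measurable_fun setT (Pi s).
  rewrite (_ : Pi s = fun z =>
    (\prod_(i < n) (g (tnth z i) * normc (tnth z i) ^+ (2 * s i)))%:E); last first.
    by apply/funext => z; rewrite /Pi prodEFin.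
  apply/measurable_EFinP; apply: measurable_prod => i _.
  have /measurable_EFinP mgs := mgn (s i).
  exact: (measurableT_comp mgs (measurable_tnth i)).
have avg z : (\sum_(k : {ffun 'I_n -> 'I_n}) (H (rot k z))%:E =
    N%:E * \sum_(s : 'S_n) Pi s z)%E.
  rewrite sumEFin.
  rewrite (eq_bigr (fun k : {ffun 'I_n -> 'I_n} => (\prod_(i < n) g (tnth z i)) *
      vandermonde_sqr (fun i => w ^+ k i * tnth z i))); last first.
    move=> k _; rewrite /H; congr (_ * _).
      by apply: eq_bigr => i _; rewrite tnth_mktuple grot.
    by congr vandermonde_sqr; apply/funext => i; rewrite tnth_mktuple.
  rewrite -mulr_sumr vandermonde_sqr_average// mulrCA EFinM; congr (_ * _)%E.
  rewrite mulr_sumr -sumEFin; apply: eq_bigr => s _.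
  by rewrite /Pi prodEFin -big_split.
(* Both sides are compared after multiplication by the number n^n of rotations, which is then
   cancelled. *)
suff : (N%:E * \int[lebesgue_Cn n]_z (H z)%:E =
    N%:E * ((n`!)%:R%:E *
      \prod_(j < n) \int[lebesgue_C]_z (g z * normc z ^+ (2 * j))%:E))%E.
  move=> /(congr1 (fun x => (N^-1)%:E * x)%E).
  by rewrite !muleA -!EFinM mulVf ?gt_eqF// mul1e mul1r.
transitivity (\int[lebesgue_Cn n]_z
    (\sum_(k : {ffun 'I_n -> 'I_n}) (H (rot k z))%:E))%E.
  rewrite ge0_integral_sum//; last first.
    by move=> k; exact: (measurableT_comp mH (mrot k)).
  rewrite (eq_bigr (fun=> \int[lebesgue_Cn n]_z (H z)%:E)%E); last first.
    move=> k _; exact: (ge0_integral_Cn_rotate (wk1 k) mH H0).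
  by rewrite sumr_const card_ffun !card_ord mule_natl.
rewrite (eq_integral (fun z => N%:E * \sum_(s : 'S_n) Pi s z)%E); last first.
  by move=> z _; exact: avg.
rewrite ge0_integralZl//; last 3 first.
- exact: emeasurable_sum.
- by move=> z _; exact: sume_ge0.
- by rewrite lee_fin ltW.
congr (_ * _)%E; rewrite ge0_integral_sum//.
rewrite (eq_bigr (fun=> \prod_(j < n)
    \int[lebesgue_C]_z (g z * normc z ^+ (2 * j))%:E)%E); last first.
  move=> s _; rewrite /Pi.
  rewrite (ge0_integral_Cn_prod (f := fun i z => (g z * normc z ^+ (2 * s i))%:E))//.
  by rewrite [RHS](reindex_inj (@perm_inj _ s)).
by rewrite sumr_const card_Sn mule_natl.
Qed.

End radial_weight_integral.

(** * Independence of the moduli and product formulas for the minimum *)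

Section kostlan.
Context {R : realType}.
Local Notation Ct := (R[i]).
Local Notation RT := (measurableTypeR R).
Local Notation mu := (@lebesgue_measure R).
Local Notation normc := (@Normc.normc R).
Variables (V : R -> R) (n : nat).
Hypothesis n0 : (0 < n)%N.
Hypothesis cV : forall r, 0 < r -> {for r, continuous V}.

(** Unnormalised density of ln r when r has density r^(2j+1) e^(-nV(r)); the exponent 2(j+1)
    contains one more factor r from dr = r dv. *)
Definition radial_density j (v : R) : R :=
  expR (2 * j.+1%:R * v - n%:R * V (expR v)).

Definition radial_mass j (A : set RT) : \bar R :=
  (\int[mu]_(v in A) (radial_density j v)%:E)%E.

Let wgt (r : R) := expR (- (n%:R * V r)).

Lemma continuous_radial_density j : continuous (radial_density j).
Proof.
move=> v; apply: continuous_comp; last exact: continuous_expR.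
apply: continuousB; first by apply: continuousM; [exact: cst_continuous|exact: cvg_id].
apply: continuousM; first exact: cst_continuous.
apply: continuous_comp; first exact: continuous_expR.
exact/cV/expR_gt0.
Qed.

Lemma measurable_radial_density j :
  measurable_fun setT (radial_density j : RT -> R).
Proof. by apply: continuous_measurable_fun; exact: continuous_radial_density. Qed.

Lemma continuous_wgt_expR : continuous (fun v => wgt (expR v)).
Proof.
rewrite /wgt => v; apply: continuous_comp; last exact: continuous_expR.
apply: continuousN; apply: continuousM; first exact: cst_continuous.
by apply: continuous_comp; [exact: continuous_expR|exact/cV/expR_gt0].
Qed.

Lemma measurable_wgt_normc : measurable_fun setT (fun z : Ct => wgt (normc z)).
Proof.
(* The value of V at 0 is arbitrary and continuity holds only at positive radii, so the origin is
   separated before passing to the logarithm. *)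
have -> : (fun z : Ct => wgt (normc z)) = fun z =>
    if z == 0 then wgt 0 else (wgt \o expR) (logmod z).
  apply/funext => z; have [->|z0] := eqVneq z 0; first by rewrite Normc.normc0.
  by rewrite /= /logmod lnK// posrE normc_gt0.
apply: measurable_fun_ifT.
- apply: (@measurable_fun_bool _ _ _ _ true).
  rewrite (_ : _ @^-1` _ = [set 0]); first by rewrite setTI; exact: measurable_set1C.
  by apply/seteqP; split => z /= /eqP.
- exact: measurable_cst.
- apply: measurableT_comp; last exact: measurable_logmod.
  by apply: continuous_measurable_fun; exact: continuous_wgt_expR.
Qed.

(** The origin is excluded explicitly because the default value [ln 0 = 0] would give it the
    log-modulus of the unit circle. *)
Let restricted (A : set RT) (z : Ct) : R :=
  \1_[set~ (0 : Ct)] z * \1_A (logmod z) * wgt (normc z).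

Lemma restricted_ge0 A z : 0 <= restricted A z.
Proof. by rewrite /restricted !mulr_ge0 ?expR_ge0// indicE. Qed.

Lemma measurable_restricted A : measurable A -> measurable_fun setT (restricted A).
Proof.
move=> mA; apply: measurable_funM; last exact: measurable_wgt_normc.
apply: measurable_funM.
  by apply: measurable_indic; apply: measurableC; exact: measurable_set1C.
apply: (measurableT_comp (f := \1_A : RT -> R)); first exact: measurable_indic.
exact: measurable_logmod.
Qed.

Lemma integral_restricted A j : measurable A ->
  (\int[lebesgue_C]_z (restricted A z * normc z ^+ (2 * j))%:E =
   @radial_const R * radial_mass j A)%E.
Proof.
move=> mA.
pose h (v : RT) : R := \1_A v * (wgt (expR v) * expR (2 * j%:R * v)).
have mh : measurable_fun setT (fun v => (h v)%:E).
  apply/measurable_EFinP; apply: measurable_funM; first exact: measurable_indic.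
  apply: measurable_funM.
    by apply: continuous_measurable_fun; exact: continuous_wgt_expR.
  apply: measurableT_comp; first exact: measurable_expR.
  exact: measurable_funM.
have h0 v : (0 <= (h v)%:E)%E by rewrite lee_fin !mulr_ge0 ?expR_ge0// indicE.
transitivity (\int[lebesgue_C]_z ((\1_[set~ (0 : Ct)] z)%:E * (h (logmod z))%:E))%E.
  apply: eq_integral => z _; rewrite -EFinM; congr EFin.
  have [->|z0] := eqVneq z 0.
    by rewrite /restricted indicE memNset ?mul0r//=; exact.
  have ez : expR (logmod z) = normc z by rewrite lnK// posrE normc_gt0.
  rewrite /restricted /h ez -!mulrA; congr (_ * (_ * (_ * _))).
  by rewrite -ez -expRM_natl natrM mulrA.
rewrite (ge0_integral_radial mh h0); congr (_ * _)%E.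
rewrite /radial_mass [RHS]integral_mkcond; apply: eq_integral => v _.
rewrite patchE /h indicE; case: ifPn => vA; last by rewrite mul0r mul0e.
rewrite mul1r -EFinM -!expRD; congr (expR _)%:E.
by rewrite -[j.+1%:R]natr1; ring.
Qed.

(** The origin is a null set, so excluding it does not change the total mass. *)
Lemma integral_unrestricted j :
  (\int[lebesgue_C]_z (wgt (normc z) * normc z ^+ (2 * j))%:E =
   @radial_const R * radial_mass j setT)%E.
Proof.
rewrite -integral_restricted//.
have mn : measurable_fun setT (fun z : Ct => normc z ^+ (2 * j)).
  by apply: measurable_funX; exact: measurable_normc.
apply: ge0_ae_eq_integral => //.
- by apply/measurable_EFinP; apply: measurable_funM => //; exact: measurable_wgt_normc.
- by apply/measurable_EFinP; apply: measurable_funM => //; exact: measurable_restricted.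
- by move=> z _; rewrite lee_fin mulr_ge0 ?expR_ge0// exprn_ge0// normc_ge0.
- by move=> z _; rewrite lee_fin mulr_ge0 ?restricted_ge0// exprn_ge0// normc_ge0.
exists [set 0]; split; [exact: measurable_set1C|exact: lebesgue_C_set1|].
move=> z /= zP; apply: contrapT => z0; apply: zP => _.
by rewrite /restricted !indicE mem_set//= in_setT !mul1r.
Qed.

Variables (d : measure_display) (Omega : measurableType d)
  (P : probability Omega R) (X : {RV P >-> n.-tuple Ct}).
Hypothesis dX : density_proportional_to X (joint_weight V (n := n)).

Lemma measurable_joint_weight :
  measurable_fun setT (joint_weight V (n := n) : n.-tuple Ct -> R).
Proof.
apply: measurable_funM; last exact: measurable_vandermonde_sqr.
apply: measurable_prod => i _.
exact: (measurableT_comp measurable_wgt_normc (measurable_tnth i)).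
Qed.

Lemma joint_weight_ge0 (z : n.-tuple Ct) : 0 <= joint_weight V z.
Proof.
by rewrite mulr_ge0 ?vandermonde_sqr_ge0// prodr_ge0// => i _; exact: expR_ge0.
Qed.

Let all_logmod (A : set RT) : set (n.-tuple Ct) :=
  [set z | forall i, tnth z i != 0 /\ A (logmod (tnth z i))].

Lemma measurable_all_logmod A : measurable A -> measurable (all_logmod A).
Proof.
move=> mA.
have -> : all_logmod A = \bigcap_(i in [set: 'I_n])
    ((fun z : n.-tuple Ct => tnth z i) @^-1` ([set~ 0] `&` (@logmod R @^-1` A))).
  apply/seteqP; split => z /=.
    by move=> h i _; have [/eqP ? ?] := h i.
  by move=> h i; have [/= /eqP ? ?] := h i I.
apply: fin_bigcap_measurable => // i _.
rewrite -[X in measurable X]setTI; apply: measurable_tnth => //.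
apply: measurableI; first by apply: measurableC; exact: measurable_set1C.
by rewrite -[X in measurable X]setTI; apply: measurable_logmod.
Qed.

(** One constant serves the total mass and all events at once, so that it disappears when the two
    formulas are divided. *)
Lemma distribution_all_logmod : exists2 C : R, 0 < C &
  (1 = C%:E * \prod_(j < n) (@radial_const R * radial_mass j setT))%E /\
  forall A, measurable A -> (distribution P X (all_logmod A) =
    C%:E * \prod_(j < n) (@radial_const R * radial_mass j A))%E.
Proof.
have [c c0 dXE] := dX.
have mw : measurable_fun setT (fun z : n.-tuple Ct => (joint_weight V z)%:E).
  by apply/measurable_EFinP; exact: measurable_joint_weight.
exists (c * (n`!)%:R); first by rewrite mulr_gt0// ltr0n fact_gt0.
split.
  transitivity (distribution P X setT); first by rewrite probability_setT.
  rewrite dXE//.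
  under eq_integral do rewrite EFinM.
  rewrite ge0_integralZl//; last 2 first.
  - by move=> z _; rewrite lee_fin joint_weight_ge0.
  - by rewrite lee_fin ltW.
  rewrite EFinM -muleA; congr (_ * _)%E.
  rewrite (@ge0_integral_Cn_vandermonde R n (fun z => wgt (normc z)))//.
  - by congr (_ * _)%E; apply: eq_bigr => j _; rewrite integral_unrestricted.
  - exact: measurable_wgt_normc.
  - by move=> z; exact: expR_ge0.
  - by move=> w z w1; rewrite Normc.normcM w1 mul1r.
move=> A mA; rewrite dXE; last exact: measurable_all_logmod.
rewrite integral_mkcond.
rewrite (eq_integral (fun z => c%:E * ((\prod_(i < n) restricted A (tnth z i)) *
    vandermonde_sqr (tnth z))%:E)%E); last first.
  move=> z _; rewrite patchE; case: ifPn => zA.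
    rewrite -EFinM; congr (EFin (c * _)); congr (_ * _); apply: eq_bigr => i _.
    move: zA; rewrite inE => /(_ i)[/eqP zi0 ziA].
    by rewrite /restricted !indicE !mem_set//= !mul1r.
  move: zA; rewrite notin_setE => /existsNP[i zi].
  rewrite (bigD1 i)//= (_ : restricted A (tnth z i) = 0) ?mul0r ?mule0//.
  rewrite /restricted !indicE; have [zi0|zi0] := eqVneq (tnth z i) 0.
    by rewrite memNset ?mul0r//= zi0; exact.
  by rewrite [X in _ * (nat_of_bool X)%:R]memNset ?mulr0 ?mul0r// => ziA; apply: zi.
have mrA := measurable_restricted mA.
rewrite ge0_integralZl//; last 3 first.
- apply/measurable_EFinP; apply: measurable_funM; last exact: measurable_vandermonde_sqr.
  by apply: measurable_prod => i _; exact: (measurableT_comp mrA (measurable_tnth i)).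
- move=> z _; rewrite lee_fin mulr_ge0 ?vandermonde_sqr_ge0// prodr_ge0// => i _.
  exact: restricted_ge0.
- by rewrite lee_fin ltW.
rewrite EFinM -muleA; congr (_ * _)%E.
rewrite (@ge0_integral_Cn_vandermonde R n (restricted A))//.
- by congr (_ * _)%E; apply: eq_bigr => j _; rewrite integral_restricted.
- by move=> z; exact: restricted_ge0.
- move=> w z w1; rewrite /restricted /logmod Normc.normcM w1 mul1r.
  congr (_ * _ * _); rewrite !indicE; congr ((_ : bool)%:R).
  have w0 : w <> 0.
    by move=> w0; move: w1; rewrite w0 Normc.normc0 => /eqP; rewrite eq_sym oner_eq0.
  apply/idP/idP; rewrite !inE /= => h.
    by move=> z0; apply: h; rewrite z0 mulr0.
  by move=> /eqP; rewrite mulf_eq0 => /orP[/eqP|/eqP].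
Qed.


Lemma radial_mass_ge0 j A : (0 <= radial_mass j A)%E.
Proof. by apply: integral_ge0 => v _; rewrite lee_fin expR_ge0. Qed.

Lemma radial_const_ge0 : (0 <= @radial_const R)%E.
Proof.
apply: integral_ge0 => z _.
by rewrite lee_fin !mulr_ge0 ?expR_ge0// indicE.
Qed.

(** A zero factor would annihilate the product; an infinite one would make it infinite, since the
    remaining factors have a nonzero product. *)
Lemma prode_ge0_factor (a : 'I_n -> \bar R) (C : R) (i : 'I_n) :
  (forall j, 0 <= a j)%E -> (1 = C%:E * \prod_(j < n) a j)%E ->
  (0 < a i < +oo)%E.
Proof.
move=> a0 H; have ai0 := a0 i.
have ne0 : (\prod_(j < n) a j != 0)%E.
  by apply/eqP => E; move: H; rewrite E mule0 => /eqP; rewrite onee_eq0.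
have fin : (\prod_(j < n) a j < +oo)%E.
  rewrite ltey; apply/eqP => E; move: H; rewrite E.
  have [C0|C0|->] := ltgtP C 0.
  - by rewrite lt0_muley ?lte_fin.
  - by rewrite gt0_muley ?lte_fin.
  - by rewrite mul0e => /eqP; rewrite onee_eq0.
have a_neq0 : (a i != 0)%E.
  by apply: contra ne0 => /eqP E; rewrite (bigD1 i)//= E mul0e.
rewrite lt0e a_neq0 ai0/= ltey; apply/eqP => E.
move: ne0 fin; rewrite (bigD1 i)//= E.
have : (0 <= \prod_(j < n | j != i) a j)%E by apply: prode_ge0 => j _.
rewrite le_eqVlt => /orP[/eqP <-|pos]; first by rewrite mule0 eqxx.
by rewrite gt0_mulye.
Qed.

(** Integrability is inherited from the density hypothesis: in the normalisation identity no factor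
    can be zero or infinite, which yields the finiteness and positivity of the radial constant here,
    and of the radial masses in [radial_mass_finite]. *)
Lemma radial_mass_factor : exists2 C : R, 0 < C & exists2 k : R, 0 < k &
  @radial_const R = k%:E /\
  (1 = C%:E * \prod_(j < n) (k%:E * radial_mass j setT))%E /\
  forall A, measurable A -> (distribution P X (all_logmod A) =
    C%:E * \prod_(j < n) (k%:E * radial_mass j A))%E.
Proof.
have [C C0 [H1 HA]] := distribution_all_logmod.
have a0 (j : 'I_n) : (0 <= @radial_const R * radial_mass j setT)%E.
  by rewrite mule_ge0 ?radial_const_ge0 ?radial_mass_ge0.
have := prode_ge0_factor (Ordinal n0) a0 H1.
have := radial_const_ge0; have := radial_mass_ge0 (Ordinal n0) setT.
rewrite le_eqVlt => /orP[/eqP <-|m0]; first by rewrite mule0 ltxx.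
case E : (@radial_const R) => [k| |] //; last by rewrite gt0_mulye// ltxx andbF.
rewrite lee_fin le_eqVlt => /orP[/eqP <-|k0 _]; first by rewrite mul0e ltxx.
by exists C => //; exists k; rewrite // -E.
Qed.

Lemma radial_mass_finite (j : 'I_n) : (0 < radial_mass j setT < +oo)%E.
Proof.
have [C C0 [k k0 [_ [H1 _]]]] := radial_mass_factor.
have a0 (i : 'I_n) : (0 <= k%:E * radial_mass i setT)%E.
  by rewrite mule_ge0 ?radial_mass_ge0// lee_fin ltW.
have := prode_ge0_factor j a0 H1.
have := radial_mass_ge0 j setT.
case: (radial_mass j setT) => [m| |] //.
  by move=> _ /andP[+ _]; rewrite !lte_fin ltry andbT pmulr_rgt0.
by rewrite gt0_muley ?lte_fin// ltxx andbF.
Qed.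

Definition left_tail j (b : R) : R :=
  fine (radial_mass j `]-oo, b]) / fine (radial_mass j setT).

Lemma le_radial_mass j (A : set RT) : measurable A ->
  (radial_mass j A <= radial_mass j setT)%E.
Proof.
move=> mA; apply: ge0_subset_integral => //.
- by apply/measurable_EFinP; exact: measurable_radial_density.
- by move=> v _; rewrite lee_fin expR_ge0.
Qed.

Lemma radial_mass_fineK (j : 'I_n) (A : set RT) : measurable A ->
  (fine (radial_mass j A))%:E = radial_mass j A.
Proof.
move=> mA; have /andP[_ jT] := radial_mass_finite j.
rewrite fineK// ge0_fin_numE ?radial_mass_ge0//.
exact: le_lt_trans (le_radial_mass _ mA) jT.
Qed.

(** Kostlan's independence, for events imposing the same condition on every modulus: the probability
    is a product of the probabilities of n one-dimensional laws. *)
Lemma distribution_all_logmod_ratio A : measurable A ->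
  distribution P X (all_logmod A) =
  (\prod_(j < n) (fine (radial_mass j A) / fine (radial_mass j setT)))%:E.
Proof.
move=> mA; have [C C0 [k k0 [_ [H1 ->//]]]] := radial_mass_factor.
rewrite (eq_bigr (fun j : 'I_n => (k%:E * radial_mass j setT) *
    (fine (radial_mass j A) / fine (radial_mass j setT))%:E)%E); last first.
  move=> j _; have /andP[j0 _] := radial_mass_finite j.
  rewrite -muleA; congr (_ * _)%E.
  rewrite -[X in _ = (X * _)%E]radial_mass_fineK// -[LHS]radial_mass_fineK//.
  rewrite -EFinM; congr EFin; rewrite mulrCA divff ?mulr1//.
  by rewrite gt_eqF// -lte_fin radial_mass_fineK.
by rewrite big_split/= muleA -H1 mul1e prodEFin.
Qed.

Lemma radial_mass_right j b :
  radial_mass j `[b, +oo[ = radial_mass j `]b, +oo[.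
Proof.
rewrite /radial_mass -integral_itv_obnd_cbnd//.
apply/measurable_EFinP/measurable_funTS.
exact: measurable_radial_density.
Qed.

Lemma right_tailE (j : 'I_n) b :
  fine (radial_mass j `]b, +oo[) / fine (radial_mass j setT) = 1 - left_tail j b.
Proof.
have /andP[j0 _] := radial_mass_finite j.
have f0 : fine (radial_mass j setT) != 0.
  by rewrite gt_eqF// -lte_fin radial_mass_fineK.
apply: (mulIf f0); rewrite mulrBl mul1r !divfK//.
apply/eqP; rewrite eq_sym subr_eq; apply/eqP/EFin_inj.
rewrite EFinD !radial_mass_fineK// addeC /radial_mass -ge0_integral_setU//=.
- by rewrite -itv_bndbnd_setU// set_itvE.
- apply/measurable_EFinP/measurable_funTS.
  exact: measurable_radial_density.
- by move=> v _; rewrite lee_fin expR_ge0.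
apply/disj_setPS => v /= []; rewrite !in_itv/= andbT => vb bv.
by move: (le_lt_trans vb bv); rewrite ltxx.
Qed.

Lemma min_modulus_geE (z : n.-tuple Ct) (s : R) : 0 < s ->
  (s%:E <= min_modulus z)%E <-> all_logmod `[ln s, +oo[ z.
Proof.
move=> s0; split=> [/bigmin_geP[_ H] i|H].
  have := H i isT; rewrite lee_fin => szi.
  have zi0 : 0 < normc (tnth z i) by exact: lt_le_trans szi.
  split; first by apply: contraTneq zi0 => ->; rewrite Normc.normc0 ltxx.
  by rewrite /= in_itv/= andbT ler_ln// posrE.
apply/bigmin_geP; split=> [|i _]; first exact: leey.
have [zi0] := H i; rewrite /= in_itv/= andbT ler_ln ?posrE ?normc_gt0//.
Qed.

Lemma min_modulus_gtE (z : n.-tuple Ct) (s : R) : 0 < s ->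
  (s%:E < min_modulus z)%E <-> all_logmod `]ln s, +oo[ z.
Proof.
move=> s0; split=> [/bigmin_gtP[_ H] i|H].
  have := H i isT; rewrite lte_fin => szi.
  have zi0 : 0 < normc (tnth z i) by exact: lt_trans szi.
  split; first by apply: contraTneq zi0 => ->; rewrite Normc.normc0 ltxx.
  by rewrite /= in_itv/= andbT ltr_ln// posrE.
apply/bigmin_gtP; split=> [|i _]; first exact: ltry.
have [zi0] := H i; rewrite /= in_itv/= andbT ltr_ln ?posrE ?normc_gt0//.
Qed.

Lemma prob_min_geE s : 0 < s ->
  prob_min_ge P X s = \prod_(j < n) (1 - left_tail j (ln s)).
Proof.
move=> s0; rewrite /prob_min_ge.
have -> : [set x | (s%:E <= min_modulus (X x))%E] =
    X @^-1` (all_logmod `[ln s, +oo[).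
  by apply/seteqP; split => x /= /(min_modulus_geE _ s0).
rewrite -[P _]/(distribution P X _) distribution_all_logmod_ratio//=.
by apply: eq_bigr => j _; rewrite radial_mass_right right_tailE.
Qed.

Lemma prob_min_leE s : 0 < s ->
  prob_min_le P X s = 1 - \prod_(j < n) (1 - left_tail j (ln s)).
Proof.
move=> s0; rewrite /prob_min_le.
have -> : [set x | (min_modulus (X x) <= s%:E)%E] =
    ~` (X @^-1` (all_logmod `]ln s, +oo[)).
  apply/seteqP; split => x /=.
    by move=> + /(min_modulus_gtE _ s0); rewrite leNgt => /negP.
  by move=> H; rewrite leNgt; apply/negP => /(min_modulus_gtE _ s0).
have mE : measurable (X @^-1` (all_logmod `]ln s, +oo[)).
  rewrite -[X in measurable X]setTI; apply: measurable_funP => //.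
  exact: measurable_all_logmod.
rewrite probability_setC// -[P _]/(distribution P X _).
rewrite distribution_all_logmod_ratio//=; congr (_ - _).
by apply: eq_bigr => j _; rewrite right_tailE.
Qed.

(** The supremum over all real t also meets thresholds that are not positive, where [ln s] carries
    no information. *)
Lemma prob_min_ge_npos s : s <= 0 -> prob_min_ge P X s = 1.
Proof.
move=> s0; rewrite /prob_min_ge (_ : [set x | _] = setT) ?probability_setT//.
apply/seteqP; split => // x _ /=; apply/bigmin_geP; split => [|i _].
  exact: leey.
by rewrite lee_fin (le_trans s0)// normc_ge0.
Qed.

Lemma left_tail_ge0 (j : 'I_n) b : 0 <= left_tail j b.
Proof. by rewrite divr_ge0// fine_ge0// radial_mass_ge0. Qed.

Lemma left_tail_le1 (j : 'I_n) b : left_tail j b <= 1.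
Proof.
have /andP[j0 _] := radial_mass_finite j.
rewrite /left_tail ler_pdivrMr; last by rewrite -lte_fin radial_mass_fineK.
by rewrite mul1r -lee_fin !radial_mass_fineK// le_radial_mass.
Qed.

Lemma left_tail_le (j : 'I_n) b c : b <= c -> left_tail j b <= left_tail j c.
Proof.
move=> bc; rewrite ler_wpM2r ?invr_ge0 ?fine_ge0 ?radial_mass_ge0//.
rewrite -lee_fin !radial_mass_fineK//; apply: ge0_subset_integral => //.
- apply/measurable_EFinP/measurable_funTS.
  exact: measurable_radial_density.
- by move=> v _; rewrite lee_fin expR_ge0.
- by move=> v /=; rewrite !in_itv/= => /le_trans; apply.
Qed.

End kostlan.

(** * Exponential and Gaussian integrals *)

Section elementary_integrals.
Context {R : realType}.
Local Notation mu := (@lebesgue_measure R).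
Implicit Types (f F : R -> R).

Lemma derivable_continuous F : (forall x : R, derivable F x 1) -> continuous F.
Proof. by move=> dF x; apply/differentiable_continuous/derivable1_diffP. Qed.

Lemma is_derive_continuous F f : (forall x : R, is_derive x 1 F (f x)) -> continuous F.
Proof.
by move=> dF; apply: derivable_continuous => x; have [] := dF x.
Qed.

Lemma FTC2_is_derive F f a b : a < b -> (forall x : R, is_derive x 1 F (f x)) ->
  continuous f -> (\int[mu]_(x in `[a, b]) (f x)%:E = (F b - F a)%:E)%E.
Proof.
move=> ab dF cf; have cF := is_derive_continuous dF.
rewrite (@continuous_FTC2 _ f F)//.
- exact: continuous_subspaceT.
- split.
  + by move=> x _; have [] := dF x.
  + exact/cvg_at_right_filter/cF.
  + exact/cvg_at_left_filter/cF.
- by move=> x _; rewrite derive1E; have [_ ->] := dF x.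
Qed.

Lemma continuous_expRM (A : R) : continuous (fun x : R => expR (A * x)).
Proof.
move=> x; apply: continuous_comp; last exact: continuous_expR.
by apply: continuousM; [exact: cst_continuous|exact: cvg_id].
Qed.

Lemma integral_expR_right (A b : R) : 0 < A ->
  (\int[mu]_(x in `[b, +oo[) (expR (- A * x))%:E = (expR (- A * b) / A)%:E)%E.
Proof.
move=> A0; have A00 : A != 0 by rewrite gt_eqF.
pose F (x : R) := - (expR (- A * x) / A).
have dF (x : R) : is_derive x 1 F (expR (- A * x)).
  rewrite /F; apply: is_derive_eq.
  by rewrite /GRing.scale/=; field.
have cF := is_derive_continuous dF.
rewrite (@ge0_continuous_FTC2y _ (fun x => expR (- A * x)) F b 0).
- by rewrite /F -EFinB sub0r opprK.
- by move=> x _; exact: expR_ge0.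
- by apply: continuous_subspaceT; exact: continuous_expRM.
- rewrite /F -oppr0; apply: cvgN; rewrite -[X in _ --> X](mul0r A^-1).
  apply: cvgM; last exact: cvg_cst.
  rewrite (_ : (fun x => expR (- A * x)) = (fun z => expR (- z)) \o (fun z => A * z));
    last by apply/funext => x /=; rewrite mulNr.
  apply: (@cvg_comp _ _ _ _ _ _ (pinfty_nbhs R)); last exact: cvgr_expR.
  exact: gt0_cvgMry.
- by move=> x _; have [] := dF x.
- exact/cvg_at_right_filter/cF.
- by move=> x _; rewrite derive1E; have [_ ->] := dF x.
Qed.

Lemma integral_expR_left (A b : R) : 0 < A ->
  (\int[mu]_(x in `]-oo, b]) (expR (A * x))%:E = (expR (A * b) / A)%:E)%E.
Proof.
move=> A0; rewrite -[b in LHS]opprK.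
rewrite (@ge0_integration_by_substitutionNy _ (fun x => expR (A * x)) (- b)).
- rewrite (eq_integral (fun x : measurableTypeR R => (expR (- A * x))%:E)).
    by rewrite integral_expR_right// mulrNN.
  by move=> x _ /=; rewrite mulrN mulNr.
- by apply: continuous_subspaceT; exact: continuous_expRM.
- by move=> x _; exact: expR_ge0.
Qed.

Lemma integral_gaussian (k m : R) : 0 < k ->
  (\int[mu]_x (expR (- (k * (x - m) ^+ 2 / 2)))%:E = (Num.sqrt (2 * pi / k))%:E)%E.
Proof.
move=> k0; have pi0 : 0 < pi :> R by exact: pi_gt0.
pose s := Num.sqrt k^-1.
have s2 : s ^+ 2 = k^-1 by rewrite sqr_sqrtr// invr_ge0 ltW.
have s0 : s != 0 by rewrite gt_eqF// sqrtr_gt0 invr_gt0.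
have := integral_normal_pdf m s.
rewrite (eq_integral (fun x : measurableTypeR R => (normal_peak s)%:E *
    (expR (- (k * (x - m) ^+ 2 / 2)))%:E)%E); last first.
  move=> x _; rewrite normal_pdfE// -EFinM; congr (_ * expR _)%:E.
  by rewrite s2; field; rewrite gt_eqF.
have mg : measurable_fun [set: measurableTypeR R] (fun x : measurableTypeR R => (expR (- (k * (x - m) ^+ 2 / 2)))%:E).
  apply/measurable_EFinP; apply: measurableT_comp; first exact: measurable_expR.
  apply: measurableT_comp => //; apply: measurable_funM => //.
  apply: measurable_funM => //; apply: measurable_funX.
  exact: measurable_funB.
rewrite (ge0_integralZl _ measurableT mg); last 2 first.
- by move=> x _; rewrite lee_fin expR_ge0.
- by rewrite lee_fin ltW// normal_peak_gt0.
move=> /(congr1 (fun x => (normal_peak s)^-1%:E * x)%E).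
rewrite muleA -EFinM mulVf ?gt_eqF ?normal_peak_gt0// mul1e mule1 => ->.
congr EFin; rewrite /normal_peak invrK s2; congr Num.sqrt.
by rewrite -[RHS]mulrA -mulr_natl; ring.
Qed.

Lemma integral_gaussian_odd (k m e : R) : 0 < k -> 0 < e ->
  (\int[mu]_(x in `[(m - e)%R, (m + e)%R])
    ((x - m) * expR (- (k * (x - m) ^+ 2 / 2)))%:E = 0)%E.
Proof.
move=> k0 e0; pose F (x : R) := - (expR (- (k * (x - m) ^+ 2 / 2)) / k).
have k00 : k != 0 by rewrite gt_eqF.
have dF (x : R) : is_derive x 1 F ((x - m) * expR (- (k * (x - m) ^+ 2 / 2))).
  rewrite /F; apply: is_derive_eq.
  by rewrite /GRing.scale/=; field.
rewrite (FTC2_is_derive _ dF).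
- rewrite /F (_ : m + e - m = e); last by ring.
  by rewrite (_ : m - e - m = - e) ?sqrrN ?subrr//; ring.
- by rewrite ltrBlDr -addrA ltrDl addr_gt0.
- by apply: derivable_continuous => x; exact: ex_derive.
Qed.

(* The integrand becomes negative beyond distance kappa^(-1/2) <= 1, so
   truncating the integral at distance 1 can only increase it. *)
Lemma integral_expR_quad_ge (A kappa b : R) : 0 < A -> 1 <= kappa ->
  ((1 / A - 2 * kappa / A ^+ 3)%:E <= \int[mu]_(x in `[(b - 1)%R, b])
    (expR (A * (x - b)) * (1 - kappa * (x - b) ^+ 2))%:E)%E.
Proof.
move=> A0 k1; have A00 : A != 0 by rewrite gt_eqF.
pose F (x : R) := expR (A * (x - b)) * (1 / A - kappa *
  ((x - b) ^+ 2 / A - 2 * (x - b) / A ^+ 2 + 2 / A ^+ 3)).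
have dF (x : R) : is_derive x 1 F (expR (A * (x - b)) * (1 - kappa * (x - b) ^+ 2)).
  rewrite /F; apply: is_derive_eq.
  by rewrite /GRing.scale/=; field.
rewrite (FTC2_is_derive _ dF).
- rewrite lee_fin /F subrr mulr0 expR0 (_ : b - 1 - b = -1); last by ring.
  rewrite -subr_ge0.
  have -> : 1 * (1 / A - kappa * (0 ^+ 2 / A - 2 * 0 / A ^+ 2 + 2 / A ^+ 3)) -
     expR (A * -1) * (1 / A - kappa * ((-1) ^+ 2 / A - 2 * -1 / A ^+ 2 + 2 / A ^+ 3)) -
     (1 / A - 2 * kappa / A ^+ 3) =
     expR (A * -1) * ((kappa - 1) / A + kappa * (2 / A ^+ 2 + 2 / A ^+ 3)) by field.
  rewrite mulr_ge0 ?expR_ge0// addr_ge0//.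
    by rewrite divr_ge0 ?subr_ge0// ltW.
  by rewrite mulr_ge0 ?addr_ge0 ?divr_ge0 ?exprn_ge0 ?ler0n ?(ltW A0)//; lra.
- by rewrite ltrBlDr ltrDl.
- by apply: derivable_continuous => x; exact: ex_derive.
Qed.

End elementary_integrals.

(** * Integrals of continuous functions *)

Section continuous_integrals.
Context {R : realType}.
Local Notation mu := (@lebesgue_measure R).
Local Notation RT := (measurableTypeR R).

Lemma continuousZ (c : R) (f : R -> R) : continuous f ->
  continuous (fun v => c * f v).
Proof. by move=> cf v; apply: cvgM; [exact: cvg_cst|exact: cf]. Qed.

Lemma continuous_measurable_EFin (f : R -> R) (D : set RT) : continuous f ->
  measurable_fun D (fun x : RT => (f x)%:E).
Proof.
move=> cf; apply/measurable_EFinP/measurable_funTS.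
exact: continuous_measurable_fun.
Qed.

Lemma ge0_le_integral_continuous (f g : R -> R) (D : set RT) : measurable D ->
  continuous f -> continuous g -> (forall x, 0 <= f x) ->
  (forall x, D x -> f x <= g x) ->
  (\int[mu]_(x in D) (f x)%:E <= \int[mu]_(x in D) (g x)%:E)%E.
Proof.
move=> mD cf cg f0 fg; apply: ge0_le_integral => //.
- by move=> x _; rewrite lee_fin.
- exact: continuous_measurable_EFin.
- exact: continuous_measurable_EFin.
Qed.

Lemma ge0_integralZl_continuous (c : R) (f : R -> R) (D : set RT) : measurable D ->
  0 <= c -> continuous f -> (forall x, 0 <= f x) ->
  (\int[mu]_(x in D) (c * f x)%:E = c%:E * \int[mu]_(x in D) (f x)%:E)%E.
Proof.
move=> mD c0 cf f0; under eq_integral do rewrite EFinM.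
rewrite ge0_integralZl//.
- exact: continuous_measurable_EFin.
- by move=> x _; rewrite lee_fin.
Qed.

Lemma integrable_itvcc (f : R -> R) a b : continuous f ->
  mu.-integrable `[a, b] (fun x : RT => (f x)%:E).
Proof.
move=> cf; apply: (@continuous_compact_integrable _ f).
  exact: segment_compact.
exact: continuous_subspaceT.
Qed.

Lemma integral_mul_indic (f : R -> R) (A : set RT) : measurable A ->
  (\int[mu]_x (f x * \1_A x)%:E = \int[mu]_(x in A) (f x)%:E)%E.
Proof.
move=> mA; rewrite [RHS]integral_mkcond; apply: eq_integral => x _.
by rewrite patchE indicE; case: ifP; rewrite ?mulr1 ?mulr0.
Qed.

End continuous_integrals.

(** * Laplace bounds for a convex exponent *)

Section laplace_bounds.
Context {R : realType}.
Local Notation mu := (@lebesgue_measure R).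
Local Notation RT := (measurableTypeR R).
Variables (W W1 : R -> R).
Hypothesis dW : forall v : R, is_derive v 1 W (W1 v).
Hypothesis W1_incr : forall u v, u < v -> W1 u < W1 v.

Definition exp_density (n : nat) (J v : R) : R := expR (2 * J * v - n%:R * W v).

Lemma exp_density_gt0 n J v : 0 < exp_density n J v.
Proof. exact: expR_gt0. Qed.

Let cW : continuous W. Proof. exact: is_derive_continuous dW. Qed.

Lemma continuous_exp_density n J : continuous (exp_density n J).
Proof.
move=> v; apply: continuous_comp; last exact: continuous_expR.
apply: continuousB; first by apply: continuousM; [exact: cst_continuous|exact: cvg_id].
by apply: continuousM; [exact: cst_continuous|exact: cW].
Qed.

Lemma above_tangent u v : W u + W1 u * (v - u) <= W v.
Proof.
have [uv|vu|->] := ltgtP u v; last by rewrite subrr mulr0 addr0.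
- have [c + E] := MVT uv (fun x _ => dW x) (continuous_subspaceT cW).
  rewrite in_itv/= => /andP[uc _].
  rewrite -(subrK (W u) (W v)) E addrC lerD2r ler_wpM2r ?subr_ge0 ?ltW//.
  exact: W1_incr.
- have [c + E] := MVT vu (fun x _ => dW x) (continuous_subspaceT cW).
  rewrite in_itv/= => /andP[_ cu].
  rewrite -[W u](subrK (W v)) E addrAC gerDr.
  have -> : W1 c * (u - v) + W1 u * (v - u) = (W1 c - W1 u) * (u - v) by ring.
  by rewrite mulr_le0_ge0 ?subr_ge0 ?(ltW vu)// subr_le0 ltW// W1_incr.
Qed.

(** By convexity W lies above its tangent at b, so the density is at most a pure exponential of rate
    A = 2J - nW'(b) matching it at b. *)
Lemma exp_density_left_le n J b : 0 < 2 * J - n%:R * W1 b ->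
  (\int[mu]_(v in `]-oo, b]) (exp_density n J v)%:E <=
   (exp_density n J b / (2 * J - n%:R * W1 b))%:E)%E.
Proof.
set A := 2 * J - n%:R * W1 b => A0.
pose c := exp_density n J b * expR (- (A * b)).
have c0 : 0 <= c by rewrite mulr_ge0 ?expR_ge0.
apply: (@le_trans _ _ (\int[mu]_(v in `]-oo, b]) (c * expR (A * v))%:E)%E).
  apply: ge0_le_integral_continuous => //.
  - exact: continuous_exp_density.
  - by apply: continuousZ; exact: continuous_expRM.
  - by move=> v; exact: ltW (exp_density_gt0 _ _ _).
  - move=> v _; rewrite /c /exp_density -!expRD ler_expR.
    have := ler_wpM2l (ler0n R n) (above_tangent b v); rewrite /A; lra.
rewrite ge0_integralZl_continuous//; last exact: continuous_expRM.
rewrite integral_expR_left// -EFinM lee_fin /c mulrA.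
by rewrite -(mulrA (exp_density n J b)) -expRD addNr expR0 mulr1.
Qed.

(** On the unit interval left of b the quadratic upper bound on W, together with 1 - x <= e^(-x),
    turns the integrand into an exponential times 1 - nK(v-b)^2, which is integrated exactly. *)
Lemma exp_density_left_ge n J b K : 0 < 2 * J - n%:R * W1 b ->
  1 <= n%:R * K ->
  (forall v, b - 1 <= v <= b -> W v <= W b + W1 b * (v - b) + K * (v - b) ^+ 2) ->
  ((exp_density n J b * (1 / (2 * J - n%:R * W1 b) -
      2 * (n%:R * K) / (2 * J - n%:R * W1 b) ^+ 3))%:E <=
   \int[mu]_(v in `]-oo, b]) (exp_density n J v)%:E)%E.
Proof.
set A := 2 * J - n%:R * W1 b => A0 nK1 WK.
pose c := exp_density n J b.
have c0 : 0 <= c by exact: ltW (exp_density_gt0 _ _ _).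
pose f v := expR (A * (v - b)) * (1 - n%:R * K * (v - b) ^+ 2).
have cf : continuous f.
  by apply: derivable_continuous => x; exact: ex_derive.
apply: (@le_trans _ _ (\int[mu]_(v in `[(b - 1)%R, b]) (c * f v)%:E)%E).
  under eq_integral do rewrite EFinM.
  rewrite integralZl//; last exact: integrable_itvcc.
  by rewrite EFinM lee_wpmul2l ?lee_fin// integral_expR_quad_ge.
apply: (@le_trans _ _ (\int[mu]_(v in `[(b - 1)%R, b]) (exp_density n J v)%:E)%E).
  apply: le_integral => //.
  - by apply: integrable_itvcc; exact: continuousZ.
  - by apply: integrable_itvcc; exact: continuous_exp_density.
  - move=> v; rewrite inE/= in_itv/= => vb; rewrite lee_fin /f.
    have H := ler_wpM2l (ler0n R n) (WK _ vb).
    apply: (@le_trans _ _ (c * (expR (A * (v - b)) * expR (- (n%:R * K * (v - b) ^+ 2))))).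
      rewrite ler_wpM2l// ler_wpM2l ?expR_ge0//.
      exact: expR_ge1Dx.
    by rewrite /c /exp_density -!expRD ler_expR /A; lra.
apply: ge0_subset_integral => //.
- by apply: continuous_measurable_EFin; exact: continuous_exp_density.
- by move=> v _; rewrite lee_fin ltW// exp_density_gt0.
- by move=> v /=; rewrite !in_itv/= => /andP[].
Qed.

Variables (w0 k0 M : R).
Hypothesis k0_gt0 : 0 < k0.

Definition gaussian_fun (K v : R) := expR (- (K * (v - w0) ^+ 2 / 2)).

Lemma continuous_gaussian_fun K : continuous (gaussian_fun K).
Proof. by apply: derivable_continuous => x; exact: ex_derive. Qed.

Lemma gaussian_fun_ge0 K v : 0 <= gaussian_fun K v.
Proof. exact: expR_ge0. Qed.

(** Outside the window half of the exponent is at least K e^2 / 4, so the Gaussian is at most e^(-K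
    e^2/4) times the one with parameter K/2, whose mass is sqrt 2, hence at most 2, times larger. *)
Lemma gaussian_window_ge (K e : R) : 0 < K -> 0 < e ->
  ((Num.sqrt (2 * pi / K) * (1 - 2 * expR (- (K * e ^+ 2 / 4))))%:E <=
   \int[mu]_(v in `[(w0 - e)%R, (w0 + e)%R]) (gaussian_fun K v)%:E)%E.
Proof.
move=> K0 e0; have K20 : 0 < K / 2 by rewrite divr_gt0.
set I : set RT := `[w0 - e, w0 + e]%classic.
set t := expR _; have t0 : 0 <= t by exact: expR_ge0.
have mI : measurable I by exact: measurable_itv.
have cG := @continuous_gaussian_fun K; have cG2 := @continuous_gaussian_fun (K / 2).
pose f (v : RT) : R := gaussian_fun K v * \1_I v.
pose g (v : RT) : R := t * gaussian_fun (K / 2) v.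
have mf : measurable_fun setT (fun v : RT => (f v)%:E).
  apply/measurable_EFinP; apply: measurable_funM.
    by apply: continuous_measurable_fun; exact: cG.
  exact: measurable_indic.
have mg : measurable_fun setT (fun v : RT => (g v)%:E).
  by apply: continuous_measurable_EFin; exact: continuousZ.
have f0 (v : RT) : setT v -> (0 <= (f v)%:E)%E.
  by move=> _; rewrite lee_fin mulr_ge0 ?gaussian_fun_ge0// indicE.
have g0 (v : RT) : setT v -> (0 <= (g v)%:E)%E.
  by move=> _; rewrite lee_fin; apply: mulr_ge0 => //; exact: gaussian_fun_ge0.
have tot : (\int[mu]_v (gaussian_fun K v)%:E <=
    \int[mu]_v (f v)%:E + \int[mu]_v (g v)%:E)%E.
  rewrite -(ge0_integralD mu measurableT f0 mf g0 mg).
  apply: ge0_le_integral => //.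
  - by move=> v _; rewrite lee_fin gaussian_fun_ge0.
  - exact: continuous_measurable_EFin cG.
  - exact: emeasurable_funD.
  move=> v _; rewrite -EFinD lee_fin /f /g indicE.
  have [vI|vI] := boolP (v \in I).
    by rewrite mulr1 lerDl; apply: mulr_ge0 => //; exact: gaussian_fun_ge0.
  rewrite mulr0 add0r /t /gaussian_fun -expRD ler_expR.
  have ve : e ^+ 2 <= (v - w0) ^+ 2.
    rewrite -(real_normK (num_real (v - w0))) lerXn2r ?nnegrE ?(ltW e0)//.
    move: vI; rewrite notin_setE /I/= in_itv/= => /negP; rewrite negb_and -!ltNge.
    rewrite ler_normr => /orP[h|h]; apply/orP; [right|left]; lra.
  have : K * e ^+ 2 <= K * (v - w0) ^+ 2 by rewrite ler_wpM2l// ltW.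
  lra.
have gaussE (k : R) : 0 < k ->
    (\int[mu]_v (gaussian_fun k v)%:E = (Num.sqrt (2 * pi / k))%:E)%E.
  exact: integral_gaussian.
move: tot; rewrite /f /g integral_mul_indic// ge0_integralZl_continuous//; last first.
  exact: gaussian_fun_ge0.
rewrite !gaussE// -EFinM => tot.
have sq : Num.sqrt (2 * pi / (K / 2)) <= 2 * Num.sqrt (2 * pi / K).
  have -> : 2 * Num.sqrt (2 * pi / K) = Num.sqrt (2 ^+ 2 * (2 * pi / K)).
    by rewrite [RHS]sqrtrM ?sqr_ge0// sqrtr_sqr ger0_norm.
  apply: ler_wsqrtr; have p0 : 0 <= pi / K by rewrite divr_ge0 ?pi_ge0// ltW.
  have -> : 2 * pi / (K / 2) = 4 * (pi / K) by field; rewrite gt_eqF.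
  have -> : 2 ^+ 2 * (2 * pi / K) = 8 * (pi / K) by field; rewrite gt_eqF.
  lra.
have : (\int[mu]_(v in I) (gaussian_fun K v)%:E)%E \is a fin_num.
  have := integrable_fin_num mI (integrable_itvcc (w0 - e) (w0 + e) cG).
  exact.
move: tot; case: (\int[mu]_(v in I) _)%E => [r| |] //.
rewrite -EFinD !lee_fin => tot _.
have := ler_wpM2l t0 sq; lra.
Qed.

Hypothesis M_ge0 : 0 <= M.

(** On the window the cubic Taylor error costs a constant factor, and e^(2J(v-w0)) is bounded below
    by 1 + 2J(v-w0), whose linear part integrates to zero against the centred Gaussian. *)
Lemma exp_density_mass_ge n J e : (0 < n)%N -> 0 < e ->
  (forall v, `|v - w0| <= e ->
    `|W v - W w0 - k0 * (v - w0) ^+ 2 / 2| <= M * `|v - w0| ^+ 3) ->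
  ((exp_density n J w0 * expR (- (n%:R * M * e ^+ 3)) *
      (Num.sqrt (2 * pi / (n%:R * k0)) *
        (1 - 2 * expR (- (n%:R * k0 * e ^+ 2 / 4)))))%:E <=
   \int[mu]_v (exp_density n J v)%:E)%E.
Proof.
move=> n0 e0 taylor; set K := n%:R * k0.
have K0 : 0 < K by rewrite mulr_gt0// ltr0n.
set I : set RT := `[w0 - e, w0 + e]%classic.
have mI : measurable I by exact: measurable_itv.
set c := exp_density n J w0 * _.
have c0 : 0 <= c by rewrite mulr_ge0// ltW// ?expR_gt0.
have cG := @continuous_gaussian_fun K.
pose f1 v := c * gaussian_fun K v.
pose f2 v := (2 * J * c) * ((v - w0) * gaussian_fun K v).
have cf1 : continuous f1.
  exact: continuousZ.
have cf2' : continuous (fun v => (v - w0) * gaussian_fun K v).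
  by apply: derivable_continuous => x; exact: ex_derive.
have cf2 : continuous f2.
  exact: continuousZ.
apply: (@le_trans _ _ (\int[mu]_(v in I) (f1 v + f2 v)%:E)%E); last first.
  apply: (@le_trans _ _ (\int[mu]_(v in I) (exp_density n J v)%:E)%E); last first.
    apply: ge0_subset_integral => //.
    - by apply: continuous_measurable_EFin; exact: continuous_exp_density.
    - by move=> v _; rewrite lee_fin ltW// exp_density_gt0.
  apply: le_integral => //.
  - apply: (@integrable_itvcc _ (fun v => f1 v + f2 v)) => v.
    by apply: continuousD; [exact: cf1|exact: cf2].
  - by apply: integrable_itvcc; exact: continuous_exp_density.
  move=> v; rewrite inE /I/= in_itv/= => vI; rewrite lee_fin.
  have ve : `|v - w0| <= e by rewrite ler_norml; lra.
  have := taylor _ ve; rewrite ler_norml => /andP[_ tv].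
  have e3 : `|v - w0| ^+ 3 <= e ^+ 3 by rewrite lerXn2r ?nnegrE ?normr_ge0 ?(ltW e0).
  have tv2 : W v - W w0 - k0 * (v - w0) ^+ 2 / 2 <= M * e ^+ 3.
    by apply: le_trans tv _; rewrite ler_wpM2l.
  have := ler_wpM2l (ler0n R n) tv2 => {}tv2.
  have -> : f1 v + f2 v = c * gaussian_fun K v * (1 + 2 * J * (v - w0)).
    by rewrite /f1 /f2; ring.
  apply: (@le_trans _ _ (c * gaussian_fun K v * expR (2 * J * (v - w0)))).
    rewrite ler_wpM2l ?expR_ge1Dx// mulr_ge0// gaussian_fun_ge0//.
  rewrite /c /gaussian_fun /exp_density -!expRD ler_expR /K; nra.
have -> : (\int[mu]_(v in I) (f1 v + f2 v)%:E =
    \int[mu]_(v in I) (f1 v)%:E + \int[mu]_(v in I) (f2 v)%:E)%E.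
  have if1 := integrable_itvcc (w0 - e) (w0 + e) cf1.
  have if2 := integrable_itvcc (w0 - e) (w0 + e) cf2.
  exact: (integralD_EFin mI if1 if2).
have -> : (\int[mu]_(v in I) (f2 v)%:E = 0)%E.
  rewrite /f2; under eq_integral do rewrite EFinM.
  rewrite integralZl//; last exact: (integrable_itvcc _ _ cf2').
  by rewrite integral_gaussian_odd// mule0.
rewrite adde0 ge0_integralZl_continuous//; last by move=> v; exact: gaussian_fun_ge0.
by rewrite EFinM lee_wpmul2l ?lee_fin// gaussian_window_ge.
Qed.

(** At distance e the Taylor bound already gives height k0 e^2 / 4, and convexity propagates this as
    linear growth of slope k0 e / 4, which controls the mass far from the minimum. *)
Lemma far_from_min e v : 0 < e -> M * e <= k0 / 4 ->
  (forall v, `|v - w0| <= e ->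
    `|W v - W w0 - k0 * (v - w0) ^+ 2 / 2| <= M * `|v - w0| ^+ 3) ->
  e <= `|v - w0| -> k0 * e / 4 * `|v - w0| <= W v - W w0.
Proof.
move=> e0 Me taylor ev.
have edge s : `|s| = e -> k0 * e ^+ 2 / 4 <= W (w0 + s) - W w0.
  move=> se; have := taylor (w0 + s).
  rewrite (_ : w0 + s - w0 = s); last by ring.
  rewrite se lexx => /(_ isT); rewrite ler_norml => /andP[+ _].
  have -> : s ^+ 2 = e ^+ 2 by rewrite -se real_normK// num_real.
  have : M * e * e ^+ 2 <= k0 / 4 * e ^+ 2 by rewrite ler_wpM2r// sqr_ge0.
  rewrite -mulrA -exprS; lra.
(* Convexity: beyond the edge the graph stays above the chord. *)
have chord s : `|s| = e -> s * (v - w0) = e * `|v - w0| ->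
    (W (w0 + s) - W w0) * `|v - w0| <= (W v - W w0) * e.
  move=> se sv.
  have s2 : s * s = e * e by rewrite -!expr2 -se real_normK// num_real.
  have T1 := above_tangent (w0 + s) w0.
  have T2 := above_tangent (w0 + s) v.
  set a := W1 (w0 + s) in T1 T2 *.
  have T1' : W (w0 + s) - W w0 <= a * s.
    by move: T1; rewrite (_ : w0 - (w0 + s) = - s); [lra|ring].
  have T2' : a * (v - w0 - s) <= W v - W (w0 + s).
    by move: T2; rewrite (_ : v - (w0 + s) = v - w0 - s); [lra|ring].
  have key : a * (v - w0 - s) * e = a * s * (`|v - w0| - e).
    have h : (v - w0) * e = s * `|v - w0|.
      have e00 : e != 0 by rewrite gt_eqF.
      apply: (mulfI e00); transitivity (s * (s * (v - w0))).
        by rewrite mulrA s2; ring.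
      by rewrite sv; ring.
    by rewrite -mulrA mulrBl h; ring.
  have h1 := ler_wpM2r (ltW e0) T2'; rewrite key in h1.
  have h2 : 0 <= `|v - w0| - e by rewrite subr_ge0.
  have h3 := ler_wpM2r h2 T1'.
  nra.
have main s : `|s| = e -> s * (v - w0) = e * `|v - w0| ->
    k0 * e / 4 * `|v - w0| <= W v - W w0.
  move=> se sv; have := chord s se sv; have := edge s se => h1 h2.
  rewrite -(ler_pM2r e0); apply: le_trans h2.
  have -> : k0 * e / 4 * `|v - w0| * e = k0 * e ^+ 2 / 4 * `|v - w0| by ring.
  by rewrite ler_wpM2r.
have [vw|vw] := leP 0 (v - w0).
  by apply: (main e); rewrite ger0_norm// ltW.
apply: (main (- e)); first by rewrite normrN ger0_norm// ltW.
by rewrite ltr0_norm// mulrN mulNr.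
Qed.

(** Inside the window the Taylor bound gives a Gaussian after completing the square in 2J(v-w0).
    Outside, the linear growth beats the drift 2J on either side, leaving two exponential tails of
    mass 1/a each. *)
Lemma exp_density_mass_le n J e : (0 < n)%N -> 0 <= J -> 0 < e ->
  M * e <= k0 / 4 ->
  (forall v, `|v - w0| <= e ->
    `|W v - W w0 - k0 * (v - w0) ^+ 2 / 2| <= M * `|v - w0| ^+ 3) ->
  0 < n%:R * k0 * e / 4 - 2 * J ->
  (\int[mu]_v (exp_density n J v)%:E <=
   (exp_density n J w0 * (expR (n%:R * M * e ^+ 3) *
      expR (2 * J ^+ 2 / (n%:R * k0)) * Num.sqrt (2 * pi / (n%:R * k0)) +
      2 / (n%:R * k0 * e / 4 - 2 * J)))%:E)%E.
Proof.
move=> n0 J0 e0 Me taylor; set a := n%:R * k0 * e / 4 - 2 * J => a0.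
set K := n%:R * k0; have K0 : 0 < K by rewrite mulr_gt0// ltr0n.
have a00 : a != 0 by rewrite gt_eqF.
have K00 : K != 0 by rewrite gt_eqF.
pose c := exp_density n J w0.
have c0 : 0 <= c by exact: ltW (exp_density_gt0 _ _ _).
pose c1 := c * (expR (n%:R * M * e ^+ 3) * expR (2 * J ^+ 2 / K)).
have c10 : 0 <= c1 by rewrite !mulr_ge0 ?expR_ge0.
(* Centre of the Gaussian after completing the square; the leftover constant 2J^2/K is the second
   factor in [c1]. *)
pose m := w0 + 2 * J / K.
pose g v := expR (- (K * (v - m) ^+ 2 / 2)).
have cg : continuous g by apply: derivable_continuous => x; exact: ex_derive.
have g0 v : 0 <= g v by exact: expR_ge0.
pose cR := c * expR (a * w0); pose cL := c * expR (- (a * w0)).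
have cR0 : 0 <= cR by rewrite mulr_ge0 ?expR_ge0.
have cL0 : 0 <= cL by rewrite mulr_ge0 ?expR_ge0.
pose eR v := expR (- a * v); pose eL v := expR (a * v).
have ceR : continuous eR by exact: continuous_expRM.
have ceL : continuous eL by exact: continuous_expRM.
have eR0 v : 0 <= eR v by exact: expR_ge0.
have eL0 v : 0 <= eL v by exact: expR_ge0.
pose DR : set RT := `[w0, +oo[%classic; pose DL : set RT := `]-oo, w0]%classic.
have mDR : measurable DR by exact: measurable_itv.
have mDL : measurable DL by exact: measurable_itv.
pose h v := c1 * g v; pose hR v := (cR * eR v) * \1_DR v; pose hL v := (cL * eL v) * \1_DL v.
have mh : measurable_fun setT (fun v : RT => (h v)%:E).
  by apply: continuous_measurable_EFin; exact: continuousZ.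
have mhR : measurable_fun setT (fun v : RT => (hR v)%:E).
  apply/measurable_EFinP; apply: measurable_funM; last exact: measurable_indic.
  by apply: continuous_measurable_fun; exact: continuousZ.
have mhL : measurable_fun setT (fun v : RT => (hL v)%:E).
  apply/measurable_EFinP; apply: measurable_funM; last exact: measurable_indic.
  by apply: continuous_measurable_fun; exact: continuousZ.
have h0 v : 0 <= h v by rewrite mulr_ge0.
have hR0 v : 0 <= hR v by rewrite !mulr_ge0// indicE.
have hL0 v : 0 <= hL v by rewrite !mulr_ge0// indicE.
apply: (@le_trans _ _ (\int[mu]_v ((h v)%:E + ((hR v)%:E + (hL v)%:E)))%E).
  apply: ge0_le_integral => //.
  - by move=> v _; rewrite lee_fin ltW// exp_density_gt0.
  - by apply: continuous_measurable_EFin; exact: continuous_exp_density.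
  - by apply: emeasurable_funD => //; exact: emeasurable_funD.
  move=> v _; rewrite -!EFinD lee_fin.
  have [ve|ev] := leP `|v - w0| e.
    rewrite -[leLHS]addr0; apply: lerD; last by rewrite addr_ge0.
    have := taylor _ ve; rewrite ler_norml => /andP[tv _].
    have e3 : `|v - w0| ^+ 3 <= e ^+ 3.
      by rewrite lerXn2r ?nnegrE ?normr_ge0 ?(ltW e0).
    have tv2 : - (M * e ^+ 3) <= W v - W w0 - k0 * (v - w0) ^+ 2 / 2.
      by apply: le_trans tv; rewrite lerN2 ler_wpM2l.
    have := ler_wpM2l (ler0n R n) tv2 => {}tv2.
    rewrite /h /c1 /g /c /exp_density -!expRD ler_expR.
    have -> : K * (v - m) ^+ 2 / 2 = K * (v - w0) ^+ 2 / 2 - 2 * J * (v - w0)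
        + 2 * J ^+ 2 / K by rewrite /m; field.
    rewrite /K in tv2 *; nra.
  have far := far_from_min e0 Me taylor (ltW ev).
  have far2 := ler_wpM2l (ler0n R n) far.
  rewrite -[leLHS]add0r; apply: lerD => //.
  have [vw|vw] := leP 0 (v - w0).
    rewrite -[leLHS]addr0; apply: lerD => //.
    rewrite /hR indicE mem_set ?mulr1; last by rewrite /DR/= in_itv/=; lra.
    move: far2; rewrite ger0_norm// => far2.
    by rewrite /cR /eR /c /exp_density -!expRD ler_expR /a; nra.
  rewrite -[leLHS]add0r; apply: lerD => //.
  rewrite /hL indicE mem_set ?mulr1; last by rewrite /DL/= in_itv/=; lra.
  move: far2; rewrite ltr0_norm// => far2.
  have := mulr_ge0 J0 (ltW (_ : 0 < w0 - v)) => Jv.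
  rewrite /cL /eL /c /exp_density -!expRD ler_expR /a.
  have {}Jv : 0 <= J * (w0 - v) by apply: Jv; lra.
  nra.
have h0e (v : RT) : setT v -> (0 <= (h v)%:E)%E by rewrite lee_fin.
have hR0e (v : RT) : setT v -> (0 <= (hR v)%:E)%E by rewrite lee_fin.
have hL0e (v : RT) : setT v -> (0 <= (hL v)%:E)%E by rewrite lee_fin.
have hRL0e (v : RT) : setT v -> (0 <= (hR v)%:E + (hL v)%:E)%E.
  by move=> vT; rewrite adde_ge0 ?hR0e ?hL0e.
have mhRL := emeasurable_funD mhR mhL.
rewrite (ge0_integralD mu measurableT h0e mh hRL0e mhRL).
rewrite (ge0_integralD mu measurableT hR0e mhR hL0e mhL).
rewrite /h ge0_integralZl_continuous// [X in (_ * X + _)%E]integral_gaussian//.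
rewrite /hR integral_mul_indic// ge0_integralZl_continuous//.
rewrite [X in (_ + (_ * X + _))%E]integral_expR_right//.
rewrite /hL integral_mul_indic// ge0_integralZl_continuous//.
rewrite [X in (_ + (_ + _ * X))%E]integral_expR_left//.
rewrite -!EFinM -!EFinD lee_fin /cR /cL /c1.
have -> : c * expR (a * w0) * (expR (- a * w0) / a) = c / a.
  by rewrite mulrA -(mulrA c) -expRD mulNr addrN expR0 mulr1.
have -> : c * expR (- (a * w0)) * (expR (a * w0) / a) = c / a.
  by rewrite mulrA -(mulrA c) -expRD addNr expR0 mulr1.
by rewrite -/c le_eqVlt; apply/orP; left; apply/eqP; ring.
Qed.

End laplace_bounds.

(** * Geometric sums and products of factors close to one *)

Section geometric_sums.
Context {R : realType}.
Implicit Types q p : R.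

Lemma geometric_sum_bounds q n : 0 < q -> q < 1 ->
  [/\ (\sum_(j < n) q ^+ j.+1) * (1 - q) = q * (1 - q ^+ n),
      (\sum_(j < n) j.+1%:R * q ^+ j.+1) * (1 - q) ^+ 2 <= q &
      (\sum_(j < n) j.+1%:R ^+ 2 * q ^+ j.+1) * (1 - q) ^+ 3 <= 2 * q].
Proof.
move=> q0 q1; have q10 : 0 < 1 - q by rewrite subr_gt0.
have E1 : (\sum_(j < n) q ^+ j.+1) * (1 - q) = q * (1 - q ^+ n).
  elim: n => [|n IH]; first by rewrite big_ord0 expr0 subrr mulr0 mul0r.
  by rewrite big_ord_recr/= mulrDl IH !exprS; ring.
have E2 : (\sum_(j < n) j.+1%:R * q ^+ j.+1) * (1 - q) ^+ 2 =
    q - q ^+ n * (q + n%:R * q * (1 - q)).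
  elim: n {E1} => [|n IH]; first by rewrite big_ord0 expr0; ring.
  by rewrite big_ord_recr/= mulrDl IH -natr1 !exprS; ring.
have E3 : (\sum_(j < n) j.+1%:R ^+ 2 * q ^+ j.+1) * (1 - q) ^+ 3 =
    q * (1 + q) - q ^+ n * (q * (1 + q) + 2 * n%:R * q * (1 - q) +
                            n%:R ^+ 2 * q * (1 - q) ^+ 2).
  elim: n {E1 E2} => [|n IH]; first by rewrite big_ord0 expr0; ring.
  by rewrite big_ord_recr/= mulrDl IH -natr1 !exprS; ring.
have qn : 0 <= q ^+ n by rewrite exprn_ge0// ltW.
have n0 : 0 <= n%:R :> R by exact: ler0n.
have q0' := ltW q0; have q10' := ltW q10.
split=> //.
- rewrite E2 lerBlDr lerDl mulr_ge0// addr_ge0// !mulr_ge0//.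
- rewrite E3; apply: (@le_trans _ _ (q * (1 + q))); last by nra.
  rewrite lerBlDr lerDl mulr_ge0//.
  have h1 : 0 <= n%:R * q * (1 - q) by rewrite !mulr_ge0.
  have h2 : 0 <= n%:R ^+ 2 * q * (1 - q) ^+ 2 by rewrite !mulr_ge0 ?sqr_ge0.
  have h3 : 0 <= q * (1 + q) by rewrite mulr_ge0// addr_ge0.
  lra.
Qed.

Lemma expr_le_inv q n : 0 < q -> q < 1 -> (0 < n)%N ->
  q ^+ n <= 1 / (n%:R * (1 - q)).
Proof.
move=> q0 q1 n0; have q10 : 0 < 1 - q by rewrite subr_gt0.
have nq0 : 0 < n%:R * (1 - q) by rewrite mulr_gt0// ltr0n.
rewrite ler_pdivlMr//.
(* This product starts at 1 and does not increase with n, which is what the induction shows. *)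
suff : q ^+ n * (1 + n%:R * (1 - q)) <= 1.
  have qn : 0 <= q ^+ n by rewrite exprn_ge0// ltW.
  by lra.
elim: n {n0 nq0} => [|n IH]; first by rewrite expr0 mul0r addr0 mulr1.
apply: le_trans IH; rewrite exprSr -natr1.
have qn : 0 <= q ^+ n by rewrite exprn_ge0// ltW.
rewrite -mulrA ler_wpM2l//.
have n0 : 0 <= n%:R :> R by exact: ler0n.
have n1 : 0 <= n%:R + 1 :> R by rewrite addr_ge0.
have : 0 <= (n%:R + 1) * ((1 - q) * (1 - q)).
  by rewrite mulr_ge0// mulr_ge0// ltW.
lra.
Qed.

Lemma geometric_sum_le q X n (p : 'I_n -> R) : 0 < q -> q < 1 -> 0 <= X ->
  (forall j : 'I_n, p j <= X * q ^+ j.+1) ->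
  \sum_(j < n) p j <= X * (q / (1 - q)).
Proof.
move=> q0 q1 X0 pX; have q10 : 0 < 1 - q by rewrite subr_gt0.
apply: (@le_trans _ _ (\sum_(j < n) X * q ^+ j.+1)); first exact: ler_sum.
rewrite -mulr_sumr ler_wpM2l// ler_pdivlMr//.
have [-> _ _] := geometric_sum_bounds n q0 q1.
by rewrite ler_piMr ?(ltW q0)// gerBl exprn_ge0// ltW.
Qed.

(** The three losses come from stopping the series at n and from the first and second moments of the
    geometric weights. *)
Lemma geometric_sum_ge q X A K n (p : 'I_n -> R) : (0 < n)%N ->
  0 < q -> q < 1 -> 0 <= X -> 0 < A -> 0 < K ->
  (forall j : 'I_n, X * (q ^+ j.+1 *
     (1 - 2 / A * j.+1%:R - 2 / K * j.+1%:R ^+ 2)) <= p j) ->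
  X * (q / (1 - q)) * (1 - 1 / (n%:R * (1 - q)) - 2 / (A * (1 - q)) -
     4 / (K * (1 - q) ^+ 2)) <= \sum_(j < n) p j.
Proof.
move=> n0 q0 q1 X0 A0 K0 pX; have q10 : 0 < 1 - q by rewrite subr_gt0.
have nR0 : 0 < n%:R :> R by rewrite ltr0n.
apply: (@le_trans _ _ (\sum_(j < n) X * (q ^+ j.+1 *
     (1 - 2 / A * j.+1%:R - 2 / K * j.+1%:R ^+ 2)))); last exact: ler_sum.
rewrite -mulr_sumr -mulrA ler_wpM2l//.
have -> : \sum_(j < n) q ^+ j.+1 * (1 - 2 / A * j.+1%:R - 2 / K * j.+1%:R ^+ 2) =
    \sum_(j < n) q ^+ j.+1 - 2 / A * (\sum_(j < n) j.+1%:R * q ^+ j.+1) -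
    2 / K * (\sum_(j < n) j.+1%:R ^+ 2 * q ^+ j.+1).
  rewrite !mulr_sumr -!sumrN -!big_split/=; apply: eq_bigr => j _; ring.
have [E1 E2 E3] := geometric_sum_bounds n q0 q1.
have qn := expr_le_inv q0 q1 n0.
set s1 := \sum_(j < n) q ^+ j.+1 in E1 *.
set s2 := \sum_(j < n) j.+1%:R * q ^+ j.+1 in E2 *.
set s3 := \sum_(j < n) j.+1%:R ^+ 2 * q ^+ j.+1 in E3 *.
have F1 : q / (1 - q) * (1 - 1 / (n%:R * (1 - q))) <= s1.
  rewrite mulrAC ler_pdivrMr// E1 ler_wpM2l ?(ltW q0)//; lra.
have F2 : 2 / A * s2 <= q / (1 - q) * (2 / (A * (1 - q))).
  have -> : q / (1 - q) * (2 / (A * (1 - q))) = 2 / A * (q / (1 - q) ^+ 2).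
    by field; rewrite !gt_eqF.
  by rewrite ler_wpM2l ?divr_ge0 ?(ltW A0)// ler_pdivlMr// exprn_gt0.
have F3 : 2 / K * s3 <= q / (1 - q) * (4 / (K * (1 - q) ^+ 2)).
  have -> : q / (1 - q) * (4 / (K * (1 - q) ^+ 2)) = 2 / K * (2 * q / (1 - q) ^+ 3).
    by field; rewrite !gt_eqF.
  by rewrite ler_wpM2l ?divr_ge0 ?(ltW K0)// ler_pdivlMr// exprn_gt0.
move: F1 F2 F3; move: (2 / A * s2) (2 / K * s3) (q / (1 - q)).
move: (1 / (n%:R * (1 - q))) (2 / (A * (1 - q))) (4 / (K * (1 - q) ^+ 2)).
by move=> *; lra.
Qed.

Lemma prod_one_sub_ge n (p : 'I_n -> R) : (forall j, 0 <= p j <= 1) ->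
  0 <= \prod_(j < n) (1 - p j) <= 1 /\
  1 - \sum_(j < n) p j <= \prod_(j < n) (1 - p j) <= expR (- \sum_(j < n) p j).
Proof.
elim: n p => [|n IH] p p01.
  by rewrite !big_ord0 subr0 oppr0 expR0 !lexx ler01.
rewrite !big_ord_recr/=.
have [|/andP[a0 a1] /andP[l u]] := IH (fun i => p (widen_ord (leqnSn n) i)).
  by move=> j; exact: p01.
have /andP[b0 b1] := p01 ord_max.
set a := \prod_(i < n) _ in a0 a1 l u *; set s := \sum_(i < n) _ in l u *.
set b := p ord_max in b0 b1 *.
split; first by apply/andP; split; nra.
apply/andP; split; first by nra.
rewrite opprD expRD ler_pM ?subr_ge0//.
exact: expR_ge1Dx.
Qed.

(** For 0 <= p <= m <= 1/2 one has 1/(1-p) <= 1 + (1+2m)p, which is at most e^((1+2m)p). *)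
Lemma prod_one_sub_expR n (p : 'I_n -> R) m : (forall j, 0 <= p j <= m) ->
  m <= 1 / 2 ->
  expR (- ((1 + 2 * m) * \sum_(j < n) p j)) <= \prod_(j < n) (1 - p j).
Proof.
move=> pm m2; rewrite mulr_sumr -sumrN expR_sum.
apply: ler_prod => j _; rewrite expR_ge0/=.
have /andP[p0 pjm] := pm j; have p1 : 0 < 1 - p j by lra.
rewrite expRN -[leRHS]invrK lef_pV2 ?posrE ?expR_gt0 ?invr_gt0//.
apply: (@le_trans _ _ (1 + (1 + 2 * m) * p j)); last exact: expR_ge1Dx.
rewrite -[leLHS]mul1r ler_pdivrMr//; nra.
Qed.

Lemma expRN_le (x : R) : 0 <= x -> expR (- x) <= 1 - x + x ^+ 2.
Proof.
move=> x0; have x1 : 0 < 1 + x by lra.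
rewrite expRN; apply: (@le_trans _ _ (1 + x)^-1).
  by rewrite lef_pV2 ?posrE ?expR_gt0// expR_ge1Dx.
have x3 : 0 <= x ^+ 3 by rewrite exprn_ge0.
by rewrite -[leLHS]mul1r ler_pdivrMr//; lra.
Qed.

End geometric_sums.

(** * The sum of the left tails, with explicit errors *)

Section tail_sum_estimate.
Context {R : realType}.
Local Notation mu := (@lebesgue_measure R).
Variables (W W1 : R -> R).
Hypothesis dW : forall v : R, is_derive v 1 W (W1 v).
Hypothesis W1_incr : forall u v, u < v -> W1 u < W1 v.
Variables (w0 k0 M : R).
Hypothesis k0_gt0 : 0 < k0.
Hypothesis M_ge0 : 0 <= M.

Definition tail (n j : nat) (b : R) : R :=
  fine (\int[mu]_(v in `]-oo, b]) (exp_density W n j.+1%:R v)%:E)%E /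
  fine (\int[mu]_v (exp_density W n j.+1%:R v)%:E)%E.

Definition tail_sum n b : R := \sum_(j < n) tail n j b.

(** The common factor X of the tails: with q = e^(-2(w0-b)), the tail of index j is close to X
    q^(j+1). The exponential and the square root come from Laplace's method at w0, the last factor
    from the tangent at b. [lead] sums the full geometric series. *)
Definition first_tail n b : R :=
  expR (- (n%:R * (W b - W w0))) /
  (Num.sqrt (2 * pi / (n%:R * k0)) * - (n%:R * W1 b)).

Definition lead n b : R :=
  first_tail n b * (expR (- (2 * (w0 - b))) / (1 - expR (- (2 * (w0 - b))))).

Lemma inv_le_expR (x : R) : 0 < x -> expR (- x) <= 1 / x.
Proof.
move=> x0; rewrite expRN -[leLHS]mul1r ler_pdivrMr ?expR_gt0// mulrC mulrA mulr1.
rewrite ler_pdivlMr// mul1r; apply: le_trans (expR_ge1Dx x); lra.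
Qed.

Lemma expR_le_affine (x : R) : 0 <= x -> x <= 1 / 2 -> expR x <= 1 + 2 * x.
Proof.
move=> x0 x2; have x1 : 0 < 1 - x by lra.
rewrite -[x]opprK expRN; apply: (@le_trans _ _ (1 - x)^-1).
  by rewrite lef_pV2 ?posrE ?expR_gt0//; apply: expR_ge1Dx.
rewrite opprK -[leLHS]mul1r ler_pdivrMr//; nra.
Qed.

Lemma one_sub_expRN_ge (x : R) : 0 <= x -> x / (1 + x) <= 1 - expR (- x).
Proof.
move=> x0; have x1 : 0 < 1 + x by lra.
have : expR (- x) <= (1 + x)^-1.
  by rewrite expRN lef_pV2 ?posrE ?expR_gt0// expR_ge1Dx.
have -> : x / (1 + x) = 1 - (1 + x)^-1 by field; rewrite gt_eqF.
lra.
Qed.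

Lemma three_factors (x y z : R) : 0 <= x <= 1 -> 0 <= y <= 1 -> 0 <= z ->
  1 - x - y - z <= (1 - x) * (1 - y) * (1 - z).
Proof.
move=> /andP[x0 x1] /andP[y0 y1] z0.
have xy : 0 <= x * y by rewrite mulr_ge0.
have a1 : (1 - x) * (1 - y) <= 1 by nra.
have := ler_wpM2r z0 a1; lra.
Qed.

Variables (c1 K2 u0 del : R).
Hypothesis c1_gt0 : 0 < c1.
Hypothesis K2_gt0 : 0 < K2.
Hypothesis u0_gt0 : 0 < u0.
Hypothesis taylor : forall v, `|v - w0| <= del ->
  `|W v - W w0 - k0 * (v - w0) ^+ 2 / 2| <= M * `|v - w0| ^+ 3.
Hypothesis W1_le : forall u, 0 < u -> u <= u0 -> W1 (w0 - u) <= - (c1 * u).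
Hypothesis W_quad : forall u v, 0 < u -> u <= u0 -> w0 - u - 1 <= v <= w0 - u ->
  W v <= W (w0 - u) + W1 (w0 - u) * (v - (w0 - u)) + K2 * (v - (w0 - u)) ^+ 2.

(** [e1] and [e2] are the relative errors in the lower and upper bounds for the total mass, in units
    of r^2 and r; [c2] is the constant in 1 - q >= c2 u. *)
Let e1 : R := M + 8 / k0.
Let c3 : R := 16 / (k0 * Num.sqrt (2 * pi / k0)).
Let e2 : R := 2 * M + c3.
Let c2 : R := 2 / (1 + 2 * u0).

Definition tail_const : R :=
  2 * K2 / c1 ^+ 2 + (u0 / c2 + 2 / (c1 * c2) + 4 / (k0 * c2 ^+ 2)) + e2 + 2 * e1.

Section fixed_n.
Variables (n : nat) (r : R).
Hypothesis n_gt0 : (0 < n)%N.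
Hypothesis r_gt0 : 0 < r.
Hypothesis nr : n%:R * r ^+ 10 = 1.
Hypothesis r_le1 : r <= 1.
Hypothesis r_del : r ^+ 4 <= del.
Hypothesis r_M : M * r ^+ 4 <= k0 / 4.
Hypothesis r_e1 : e1 * r ^+ 2 <= 1 / 2.
Hypothesis r_e2 : e2 * r <= 1.
Hypothesis r_k0 : 128 * r ^+ 2 <= k0.
Hypothesis n_K2 : 1 <= n%:R * K2.
Hypothesis mass_finite : forall j : 'I_n,
  (0 < \int[mu]_v (exp_density W n j.+1%:R v)%:E < +oo)%E.

Let nE : n%:R = r ^- 10.
Proof. by apply: (mulIf (lt0r_neq0 (exprn_gt0 10 r_gt0))); rewrite nr mulVf// expf_neq0// gt_eqF. Qed.

Let taylor_r v : `|v - w0| <= r ^+ 4 ->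
  `|W v - W w0 - k0 * (v - w0) ^+ 2 / 2| <= M * `|v - w0| ^+ 3.
Proof. by move=> h; apply: taylor; exact: le_trans r_del. Qed.

Let S : R := Num.sqrt (2 * pi / (n%:R * k0)).

Let S_gt0 : 0 < S.
Proof. by rewrite sqrtr_gt0 divr_gt0 ?mulr_gt0 ?pi_gt0// ltr0n. Qed.

Let S_r : S = Num.sqrt (2 * pi / k0) * r ^+ 5.
Proof.
rewrite /S; have -> : 2 * pi / (n%:R * k0) = 2 * pi / k0 * (r ^+ 5) ^+ 2.
  by rewrite nE; field; rewrite !gt_eqF.
rewrite sqrtrM ?sqrtr_sqr ?ger0_norm ?exprn_ge0 ?(ltW r_gt0)//.
by rewrite divr_ge0 ?mulr_ge0 ?pi_ge0// ltW.
Qed.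

(** The window half-width is r^4 = n^(-2/5). Then n r^12 = r^2 makes the cubic Taylor error small,
    while n r^8 = r^(-2) makes the Gaussian mass outside the window negligible. *)
Lemma mass_ge (J : R) :
  ((exp_density W n J w0 * (S * (1 - e1 * r ^+ 2)))%:E <=
   \int[mu]_v (exp_density W n J v)%:E)%E.
Proof.
have r4 : 0 < r ^+ 4 by rewrite exprn_gt0.
apply: le_trans (exp_density_mass_ge dW k0_gt0 M_ge0 J n_gt0 r4 taylor_r).
rewrite lee_fin -[leRHS]mulrA -/S.
apply: ler_wpM2l; first exact: ltW (exp_density_gt0 _ _ _ _).
rewrite [leRHS]mulrCA; apply: ler_wpM2l; first exact: ltW.
have -> : n%:R * M * (r ^+ 4) ^+ 3 = M * r ^+ 2.
  by rewrite nE; field; rewrite gt_eqF.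
have -> : n%:R * k0 * (r ^+ 4) ^+ 2 / 4 = k0 / (4 * r ^+ 2).
  by rewrite nE; field; rewrite gt_eqF.
have h1 : 1 - M * r ^+ 2 <= expR (- (M * r ^+ 2)) by exact: expR_ge1Dx.
have h2 : expR (- (k0 / (4 * r ^+ 2))) <= 4 / k0 * r ^+ 2.
  have -> : 4 / k0 * r ^+ 2 = 1 / (k0 / (4 * r ^+ 2)) by field; rewrite !gt_eqF.
  by apply: inv_le_expR; rewrite divr_gt0// mulr_gt0// exprn_gt0.
have h3 : e1 * r ^+ 2 = M * r ^+ 2 + 8 / k0 * r ^+ 2 by rewrite /e1 mulrDl.
have h4 : 8 / k0 * r ^+ 2 = 2 * (4 / k0 * r ^+ 2) by field; rewrite gt_eqF.
have h5 : 0 <= M * r ^+ 2 by rewrite mulr_ge0// sqr_ge0.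
have h6 : 0 <= 4 / k0 * r ^+ 2 by rewrite mulr_ge0 ?sqr_ge0// divr_ge0// ltW.
apply: (@le_trans _ _ ((1 - M * r ^+ 2) * (1 - 2 * (4 / k0 * r ^+ 2)))).
  move: r_e1; rewrite h3 h4; move: h5 h6.
  by move: (M * r ^+ 2) (4 / k0 * r ^+ 2) => x y *; nra.
have h7 := r_e1; rewrite h3 h4 in h7.
by apply: ler_pM => //; move: h1 h2 h5 h6 h7;
  move: (M * r ^+ 2) (4 / k0 * r ^+ 2) => x y *; lra.
Qed.

(** The same window serves here, but the factor e^(2J^2/(nk0)) from the shifted peak stays and is
    dealt with in [tail_ge]. *)
Lemma mass_le (J : R) : 0 <= J -> 2 * J ^+ 2 <= n%:R * k0 ->
  (\int[mu]_v (exp_density W n J v)%:E <=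
   (exp_density W n J w0 * (S * (expR (2 * J ^+ 2 / (n%:R * k0)) * (1 + e2 * r))))%:E)%E.
Proof.
move=> J0 JK.
have r4 : 0 < r ^+ 4 by rewrite exprn_gt0.
have Ke : n%:R * k0 * r ^+ 4 = k0 * r ^- 6 by rewrite nE; field; rewrite gt_eqF.
have r6 : 0 < r ^- 6 by rewrite invr_gt0 exprn_gt0.
(* The drift uses at most half of the exponential decay rate k0 r^(-6) / 4 available outside the
   window; J is of order at most sqrt n = r^(-5). *)
have J8 : 2 * J <= k0 * r ^- 6 / 8.
  rewrite -ler_sqr ?nnegrE ?mulr_ge0 ?divr_ge0 ?(ltW k0_gt0) ?(ltW r6)//.
  apply: (@le_trans _ _ (2 * (n%:R * k0))); first by lra.
  have -> : (k0 * r ^- 6 / 8) ^+ 2 = k0 * (k0 * r ^- 12 / 64) by field; rewrite gt_eqF.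
  have -> : 2 * (n%:R * k0) = k0 * (128 * r ^+ 2 * r ^- 12 / 64).
    by rewrite nE; field; rewrite gt_eqF.
  rewrite ler_wpM2l ?(ltW k0_gt0)// ler_wpM2r// ler_wpM2r//.
  by rewrite invr_ge0 exprn_ge0// ltW.
have a0 : 0 < n%:R * k0 * r ^+ 4 / 4 - 2 * J.
  rewrite Ke; have : 0 < k0 * r ^- 6 by rewrite mulr_gt0.
  lra.
apply: le_trans (exp_density_mass_le dW W1_incr k0_gt0 M_ge0 n_gt0 J0 r4
  r_M taylor_r a0) _.
rewrite lee_fin ler_wpM2l ?(ltW (exp_density_gt0 _ _ _ _))// -/S.
have -> : n%:R * M * (r ^+ 4) ^+ 3 = M * r ^+ 2.
  by rewrite nE; field; rewrite gt_eqF.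
have h1 : expR (M * r ^+ 2) <= 1 + 2 * (M * r ^+ 2).
  apply: expR_le_affine; first by rewrite mulr_ge0// sqr_ge0.
  apply: le_trans r_e1; apply: ler_wpM2r; first exact: sqr_ge0.
  by rewrite lerDl divr_ge0// ltW.
have h2 : 2 / (n%:R * k0 * r ^+ 4 / 4 - 2 * J) <= S * (c3 * r).
  have -> : S * (c3 * r) = 2 / (k0 * r ^- 6 / 8).
    rewrite S_r /c3; field; rewrite !gt_eqF// sqrtr_gt0.
    by rewrite divr_gt0 ?mulr_gt0 ?pi_gt0.
  rewrite ler_wpM2l// lef_pV2 ?posrE ?divr_gt0 ?mulr_gt0//.
  have k6 : 0 < k0 * r ^- 6 by rewrite mulr_gt0.
  by rewrite Ke; lra.
pose E := expR (2 * J ^+ 2 / (n%:R * k0)); rewrite -/E.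
have E1 : 1 <= E.
  rewrite -expR0 ler_expR; apply: divr_ge0; first by rewrite mulr_ge0 ?sqr_ge0.
  by apply: mulr_ge0; [exact: ler0n|exact: ltW].
have h3 : 2 * (M * r ^+ 2) <= 2 * M * r.
  rewrite mulrA; apply: ler_wpM2l; first by rewrite mulr_ge0.
  by rewrite expr2 ler_piMl// ltW.
have c30 : 0 <= c3.
  by apply: divr_ge0 => //; apply: mulr_ge0; [exact: ltW|exact: sqrtr_ge0].
have h4 : 0 <= c3 * r by rewrite mulr_ge0// ltW.
apply: (@le_trans _ _ (S * (E * (1 + 2 * M * r)) + S * (E * (c3 * r)))); last first.
  by rewrite -mulrDr -mulrDr ler_wpM2l ?(ltW S_gt0)// ler_wpM2l ?(le_trans ler01 E1)// /e2; lra.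
apply: lerD.
  rewrite mulrC ler_wpM2l ?(ltW S_gt0)// mulrC ler_wpM2l ?(le_trans ler01 E1)//; lra.
by apply: (le_trans h2); rewrite ler_wpM2l ?(ltW S_gt0)// ler_peMl.
Qed.

Variable u : R.
Hypothesis u_gt0 : 0 < u.
Hypothesis u_le : u <= u0.

Let b : R := w0 - u.
Let q : R := expR (- (2 * u)).
Let A0 : R := - (n%:R * W1 b).
Let X : R := first_tail n b.

Let n_R : 0 < n%:R :> R. Proof. by rewrite ltr0n. Qed.

Let A0_ge : n%:R * (c1 * u) <= A0.
Proof. by rewrite /A0 -mulrN ler_wpM2l ?(ltW n_R)// lerNr W1_le. Qed.

Let A0_gt0 : 0 < A0.
Proof. by apply: lt_le_trans A0_ge; rewrite !mulr_gt0. Qed.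

Let q_gt0 : 0 < q. Proof. exact: expR_gt0. Qed.

Let q_lt1 : q < 1.
Proof. by rewrite -expR0 ltr_expR oppr_lt0 mulr_gt0. Qed.

Let X_gt0 : 0 < X.
Proof. by rewrite divr_gt0 ?expR_gt0// mulr_gt0. Qed.

Let leadE : lead n b = X * (q / (1 - q)).
Proof.
by rewrite /lead (_ : w0 - b = u)// /b; ring.
Qed.

(** The index dependence of this ratio is exactly geometric: moving from w0 to b changes the linear
    term 2(j+1)v by -2(j+1)u. All approximation is in the masses and in replacing the rate by A0. *)
Lemma exp_density_ratio j :
  exp_density W n j.+1%:R b / (exp_density W n j.+1%:R w0 * S) = X * A0 * q ^+ j.+1.
Proof.
have -> : X * A0 = expR (- (n%:R * (W b - W w0))) / S.
  by rewrite /X /first_tail -/S -/A0; field; rewrite !gt_eqF.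
have -> : exp_density W n j.+1%:R b = exp_density W n j.+1%:R w0 *
    (expR (- (n%:R * (W b - W w0))) * q ^+ j.+1).
  rewrite /exp_density /q -expRM_natl -!expRD; congr expR.
  by rewrite /b; ring.
by field; rewrite !gt_eqF// exp_density_gt0.
Qed.

Lemma tail_le (j : 'I_n) : tail n j b <= X * (1 + 2 * (e1 * r ^+ 2)) * q ^+ j.+1.
Proof.
have J0 : 0 <= j.+1%:R :> R by exact: ler0n.
have AJ : 0 < 2 * j.+1%:R - n%:R * W1 b by move: A0_gt0; rewrite /A0; lra.
have Nle := exp_density_left_le dW W1_incr AJ.
have Dge := mass_ge j.+1%:R.
have /andP[D0 Dfin] := mass_finite j.
set N := (\int[mu]_(v in _) _)%E in Nle; set D := (\int[mu]_v _)%E in Dge D0 Dfin.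
have N0 : (0 <= N)%E by apply: integral_ge0 => v _; rewrite lee_fin ltW// exp_density_gt0.
rewrite /tail -/N -/D; move: N0 Nle D0 Dfin Dge.
case: N => [N| |]//; case: D => [D| |]//; rewrite !lee_fin lte_fin/= => N0 Nle D0 _ Dge.
set Eb := exp_density W n j.+1%:R b in Nle.
set E0 := exp_density W n j.+1%:R w0 in Dge.
have Eb0 : 0 < Eb by exact: exp_density_gt0.
have E00 : 0 < E0 by exact: exp_density_gt0.
have e10 : 0 <= e1 * r ^+ 2.
  by rewrite mulr_ge0 ?sqr_ge0// addr_ge0// divr_ge0// ltW.
have e1' : 0 < 1 - e1 * r ^+ 2 by move: r_e1; lra.
have Nle2 : N <= Eb / A0.
  apply: le_trans Nle _; rewrite ler_wpM2l ?(ltW Eb0)// lef_pV2 ?posrE// /A0; lra.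
have -> : X * (1 + 2 * (e1 * r ^+ 2)) * q ^+ j.+1 =
    Eb / A0 * ((1 + 2 * (e1 * r ^+ 2)) / (E0 * S)).
  transitivity ((X * A0 * q ^+ j.+1) * (1 + 2 * (e1 * r ^+ 2)) / A0).
    by field; rewrite gt_eqF.
  by rewrite -exp_density_ratio -/Eb -/E0; field; rewrite !gt_eqF.
apply: ler_pM => //; first by rewrite invr_ge0 ltW.
apply: (@le_trans _ _ (E0 * (S * (1 - e1 * r ^+ 2)))^-1).
  by rewrite lef_pV2 ?posrE// !mulr_gt0.
rewrite mulrA invfM mulrC ler_wpM2r ?invr_ge0 ?mulr_ge0 ?(ltW E00) ?(ltW S_gt0)//.
rewrite -[leLHS]mul1r ler_pdivrMr//.
by move: r_e1 e10; move: (e1 * r ^+ 2) => x *; nra.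
Qed.

Let nK : 0 < n%:R * k0. Proof. by rewrite mulr_gt0. Qed.

Let e2_ge0 : 0 <= e2.
Proof.
apply: addr_ge0; first by rewrite mulr_ge0.
by apply: divr_ge0 => //; apply: mulr_ge0; [exact: ltW|exact: sqrtr_ge0].
Qed.

Let beta : R := (1 - 2 * (n%:R * K2) / A0 ^+ 2) * (1 - e2 * r).

Lemma tail_ge0 j : 0 <= tail n j b.
Proof.
by rewrite divr_ge0// fine_ge0//; apply: integral_ge0 => v _;
  rewrite lee_fin ltW// exp_density_gt0.
Qed.

(** The term in j+1 comes from replacing the rate A0 + 2(j+1) by A0, the one in (j+1)^2 from the
    peak shift e^y in the mass. The factors e^y and 1 + e2 r are absorbed by (1-y) e^y <= 1 and
    (1-x)(1+x) <= 1. *)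
Lemma tail_ge (j : 'I_n) : 0 <= 1 - 2 * (n%:R * K2) / A0 ^+ 2 ->
  X * beta * (q ^+ j.+1 *
    (1 - 2 / A0 * j.+1%:R - 2 / (n%:R * k0) * j.+1%:R ^+ 2)) <= tail n j b.
Proof.
move=> b10; have b20 : 0 <= 1 - e2 * r by rewrite subr_ge0.
have beta0 : 0 <= beta by rewrite mulr_ge0.
set J : R := j.+1%:R; have J0 : 0 < J by rewrite /J ltr0n.
have qJ : 0 < q ^+ j.+1 by rewrite exprn_gt0.
set y := 2 / (n%:R * k0) * J ^+ 2; set a := 2 / A0 * J.
have y0 : 0 <= y by rewrite mulr_ge0 ?sqr_ge0// divr_ge0// ltW.
have a0 : 0 <= a by apply: mulr_ge0; [rewrite divr_ge0// ltW|exact: ltW].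
(* A nonpositive left-hand side needs no argument; otherwise y < 1, which is the bound on J^2
   required by [mass_le]. *)
have [ay|ay] := leP (1 - a - y) 0.
  apply: le_trans (tail_ge0 j).
  apply: mulr_ge0_le0; first exact: mulr_ge0 (ltW X_gt0) beta0.
  by apply: mulr_ge0_le0 => //; exact: ltW.
have AJ : 0 < 2 * J - n%:R * W1 b by move: A0_gt0; rewrite /A0; lra.
have Nge := exp_density_left_ge dW AJ n_K2 (fun v => W_quad u_gt0 u_le (v := v)).
have JK : 2 * J ^+ 2 <= n%:R * k0.
  have yE : y * (n%:R * k0) = 2 * J ^+ 2 by rewrite /y; field; rewrite !gt_eqF.
  by rewrite -yE ler_piMl ?(ltW nK)//; lra.
have Dle := mass_le (ltW J0) JK.
have /andP[D0 Dfin] := mass_finite j.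
have Nfin : (\int[mu]_(v in `]-oo, b]) (exp_density W n J v)%:E < +oo)%E.
  apply: le_lt_trans Dfin; apply: ge0_subset_integral => //.
  - apply: continuous_measurable_EFin; exact: continuous_exp_density.
  - by move=> v _; rewrite lee_fin ltW// exp_density_gt0.
have N0 : (0 <= \int[mu]_(v in `]-oo, b]) (exp_density W n J v)%:E)%E.
  by apply: integral_ge0 => v _; rewrite lee_fin ltW// exp_density_gt0.
rewrite /tail -/J; move: D0 Dfin Dle N0 Nfin Nge.
set NN := (\int[mu]_(v in `]-oo, b]) (exp_density W n J v)%:E)%E.
set DD := (\int[mu]_v (exp_density W n J v)%:E)%E.
move=> D0 Dfin Dle N0 Nfin Nge.
have NE : NN = (fine NN)%:E by rewrite fineK// ge0_fin_numE.
have DE : DD = (fine DD)%:E by rewrite fineK// ge0_fin_numE// ltW.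
move: D0 Dle N0 Nge; rewrite NE DE !lee_fin lte_fin /=.
move: (fine NN) (fine DD) => N D D0 Dle N0 Nge.
set Eb := exp_density W n J b in Nge.
set E0 := exp_density W n J w0 in Dle.
have Eb0 : 0 < Eb by exact: exp_density_gt0.
have E00 : 0 < E0 by exact: exp_density_gt0.
set AJ' := 2 * J - n%:R * W1 b in AJ Nge.
have A0J : A0 <= AJ' by rewrite /A0 /AJ'; lra.
have Nge2 : Eb / A0 * ((1 - a) * (1 - 2 * (n%:R * K2) / A0 ^+ 2)) <= N.
  apply: le_trans Nge; rewrite -mulrA ler_wpM2l ?(ltW Eb0)//.
  have -> : 1 / AJ' - 2 * (n%:R * K2) / AJ' ^+ 3 =
      AJ'^-1 * (1 - 2 * (n%:R * K2) / AJ' ^+ 2) by field; rewrite gt_eqF.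
  rewrite [leLHS]mulrA; apply: ler_pM => //.
  - by rewrite mulr_ge0 ?invr_ge0 ?(ltW A0_gt0)//; lra.
  - rewrite mulrC ler_pdivrMr// mulrC ler_pdivlMr//.
    have A0a : A0 * a = 2 * J by rewrite /a; field; rewrite gt_eqF.
    have -> : AJ' = A0 * (1 + a) by rewrite mulrDr mulr1 A0a /AJ' /A0; ring.
    by have := mulr_ge0 (ltW A0_gt0) (sqr_ge0 a); lra.
  - rewrite lerD2l lerN2 ler_wpM2l ?mulr_ge0 ?(ltW K2_gt0)//.
    rewrite lef_pV2 ?posrE ?exprn_gt0//.
    by rewrite lerXn2r ?nnegrE ?(ltW A0_gt0) ?(ltW AJ).
have ey : expR (2 * J ^+ 2 / (n%:R * k0)) = expR y.
  by congr expR; rewrite /y; field; rewrite !gt_eqF.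
rewrite ey in Dle.
have -> : X * beta * (q ^+ j.+1 * (1 - a - y)) =
    (Eb / A0) * ((1 - 2 * (n%:R * K2) / A0 ^+ 2) * ((1 - a - y) * (1 - e2 * r))) / (E0 * S).
  transitivity ((X * A0 * q ^+ j.+1) / A0 * (beta * (1 - a - y))).
    by field; rewrite gt_eqF.
  rewrite -exp_density_ratio -/J -/Eb -/E0 /beta; field.
  by rewrite !gt_eqF.
rewrite ler_pdivrMr ?mulr_gt0// [leRHS]mulrAC ler_pdivlMr//.
apply: (@le_trans _ _ (Eb / A0 * ((1 - 2 * (n%:R * K2) / A0 ^+ 2) *
    ((1 - a - y) * (1 - e2 * r))) * (E0 * (S * (expR y * (1 + e2 * r)))))).
  apply: ler_wpM2l Dle; apply: mulr_ge0; first by rewrite divr_ge0// ltW.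
  by apply: mulr_ge0 => //; apply: mulr_ge0 => //; exact: ltW.
have e2r : 0 <= e2 * r by rewrite mulr_ge0// ltW.
have ineq : (1 - a - y) * (1 - e2 * r) * (expR y * (1 + e2 * r)) <= 1 - a.
  have ey1 : (1 - y) * expR y <= 1.
    have : 1 - y <= expR (- y) by exact: expR_ge1Dx.
    move=> /(ler_wpM2r (expR_ge0 y)); rewrite -expRD addNr expR0; exact.
  have h1 : (1 - e2 * r) * (1 + e2 * r) <= 1 by have := sqr_ge0 (e2 * r); lra.
  have h2 : 0 <= (1 - e2 * r) * (1 + e2 * r) by rewrite mulr_ge0//; lra.
  have h3 : (1 - a - y) * expR y <= 1 - a.
    have h4 : 1 - a - y <= (1 - a) * (1 - y) by have := mulr_ge0 a0 y0; lra.
    apply: le_trans (ler_wpM2r (expR_ge0 y) h4) _.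
    by rewrite -mulrA ler_piMr//; lra.
  have -> : (1 - a - y) * (1 - e2 * r) * (expR y * (1 + e2 * r)) =
    (1 - a - y) * expR y * ((1 - e2 * r) * (1 + e2 * r)) by ring.
  by rewrite -[leRHS]mulr1; apply: ler_pM => //; rewrite mulr_ge0 ?expR_ge0// ltW.
have -> : Eb / A0 * ((1 - 2 * (n%:R * K2) / A0 ^+ 2) *
    ((1 - a - y) * (1 - e2 * r))) * (E0 * (S * (expR y * (1 + e2 * r)))) =
    (E0 * S) * (Eb / A0 * (((1 - a - y) * (1 - e2 * r) * (expR y * (1 + e2 * r))) *
      (1 - 2 * (n%:R * K2) / A0 ^+ 2))) by ring.
rewrite mulrC; apply: ler_wpM2r; first by rewrite mulr_ge0// ltW.
apply: le_trans Nge2; rewrite ler_wpM2l ?divr_ge0 ?(ltW Eb0) ?(ltW A0_gt0)//.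
by rewrite ler_wpM2r.
Qed.

Let q1_ge : c2 * u <= 1 - q.
Proof.
have u20 : 0 <= 2 * u by rewrite mulr_ge0// ltW.
apply: le_trans (one_sub_expRN_ge u20).
have -> : c2 * u = 2 * u / (1 + 2 * u0) by rewrite /c2 mulrAC.
rewrite ler_wpM2l// lef_pV2 ?posrE; first by move: u_le; lra.
  by move: u0_gt0; lra.
by move: u_gt0; lra.
Qed.

(** Summing the nearly geometric tails. The first and second moments of the weights cost factors
    1/(A0 u) and 1/(n u^2), and A0 is at least of order n u, so all moment losses are of order 1/(n
    u^2). The last bound shows that each single tail is a fraction of order u of the sum. *)
Lemma tail_sum_bounds :
  [/\ 0 < lead n b,
      lead n b * (1 - tail_const * ((n%:R * u ^+ 2)^-1 + r)) <= tail_sum n b,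
      tail_sum n b <= lead n b * (1 + tail_const * ((n%:R * u ^+ 2)^-1 + r)) &
      forall j : 'I_n, tail n j b <= 4 * u * lead n b].
Proof.
have q10 : 0 < 1 - q by rewrite subr_gt0.
have lead0 : 0 < lead n b by rewrite leadE mulr_gt0// divr_gt0.
have c20 : 0 < c2 by rewrite divr_gt0//; move: u0_gt0; lra.
have e10 : 0 <= e1 by rewrite addr_ge0// divr_ge0// ltW.
set nu := (n%:R * u ^+ 2)^-1.
have nu0 : 0 < nu by rewrite invr_gt0 mulr_gt0// exprn_gt0.
have er : e1 * r ^+ 2 <= e1 * r.
  by rewrite ler_wpM2l// expr2 ler_piMl// ltW.
set k1 := 2 * K2 / c1 ^+ 2; set k2 := u0 / c2 + 2 / (c1 * c2) + 4 / (k0 * c2 ^+ 2).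
have k10 : 0 <= k1 by apply: ltW; rewrite divr_gt0 ?mulr_gt0 ?exprn_gt0.
have k20 : 0 <= k2.
  have h1 : 0 < u0 / c2 by exact: divr_gt0.
  have h2 : 0 < 2 / (c1 * c2) by rewrite divr_gt0// mulr_gt0.
  have h3 : 0 < 4 / (k0 * c2 ^+ 2) by rewrite divr_gt0// mulr_gt0// exprn_gt0.
  by rewrite /k2; lra.
have CE : tail_const * (nu + r) = k1 * nu + k2 * nu + e2 * nu + 2 * e1 * nu +
    (k1 * r + k2 * r + e2 * r + 2 * (e1 * r)).
  by rewrite /tail_const -/k1 -/k2; ring.
have p1 := mulr_ge0 k10 (ltW nu0); have p2 := mulr_ge0 k20 (ltW nu0).
have p3 := mulr_ge0 e2_ge0 (ltW nu0); have p4 := mulr_ge0 e10 (ltW nu0).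
have p5 := mulr_ge0 k10 (ltW r_gt0); have p6 := mulr_ge0 k20 (ltW r_gt0).
have p7 := mulr_ge0 e2_ge0 (ltW r_gt0); have p8 := mulr_ge0 e10 (ltW r_gt0).
have p9 : 0 <= e1 * r ^+ 2 by rewrite mulr_ge0 ?sqr_ge0.
split=> //.
(* If this factor is negative, the stated error exceeds 1 and the lower bound is negative. *)
- have [small|big] := leP 0 (1 - 2 * (n%:R * K2) / A0 ^+ 2); last first.
    apply: (@le_trans _ _ 0); last by apply: sumr_ge0 => j _; exact: tail_ge0.
    rewrite pmulr_rle0//.
    have : 2 * (n%:R * K2) / A0 ^+ 2 <= k1 * nu.
      have -> : k1 * nu = 2 * (n%:R * K2) / (n%:R * (c1 * u)) ^+ 2.
        by rewrite /k1 /nu; field; rewrite !gt_eqF.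
      rewrite ler_wpM2l ?mulr_ge0 ?(ltW K2_gt0)// lef_pV2 ?posrE ?exprn_gt0 ?mulr_gt0//.
      by rewrite lerXn2r ?nnegrE ?(ltW A0_gt0)// !mulr_ge0// ltW.
    by rewrite CE; lra.
  have beta0 : 0 <= beta by rewrite mulr_ge0// subr_ge0.
  have := geometric_sum_ge n_gt0 q_gt0 q_lt1 (mulr_ge0 (ltW X_gt0) beta0) A0_gt0 nK
    (fun j => tail_ge j small).
  apply: le_trans.
  have -> : X * beta * (q / (1 - q)) = lead n b * beta by rewrite leadE; ring.
  rewrite -[leRHS]mulrA ler_wpM2l ?(ltW lead0)//.
  have c2u : 0 < c2 * u by rewrite mulr_gt0.
  have c1u : 0 < c1 * u by rewrite mulr_gt0.
  have nc1u : 0 < n%:R * (c1 * u) by rewrite mulr_gt0.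
  have x1 : 2 * (n%:R * K2) / A0 ^+ 2 <= k1 * nu.
    have -> : k1 * nu = 2 * (n%:R * K2) / (n%:R * (c1 * u)) ^+ 2.
      by rewrite /k1 /nu; field; rewrite !gt_eqF.
    rewrite ler_wpM2l ?mulr_ge0 ?(ltW K2_gt0)// lef_pV2 ?posrE ?exprn_gt0 ?mulr_gt0//.
    by rewrite lerXn2r ?nnegrE ?(ltW A0_gt0)// !mulr_ge0// ltW.
  have x10 : 0 <= 2 * (n%:R * K2) / A0 ^+ 2.
    by rewrite divr_ge0 ?exprn_ge0 ?mulr_ge0 ?(ltW K2_gt0) ?(ltW A0_gt0).
  have z1 : 1 / (n%:R * (1 - q)) <= u0 / c2 * nu.
    apply: (@le_trans _ _ (1 / (n%:R * (c2 * u)))).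
      have h : n%:R * (c2 * u) <= n%:R * (1 - q) by rewrite ler_wpM2l// ltW.
      by rewrite !mul1r lef_pV2 ?posrE ?(mulr_gt0 n_R).
    have -> : 1 / (n%:R * (c2 * u)) = u / c2 * nu by rewrite /nu; field; rewrite !gt_eqF.
    by rewrite ler_wpM2r ?(ltW nu0)// ler_wpM2r// invr_ge0 ltW.
  have z2 : 2 / (A0 * (1 - q)) <= 2 / (c1 * c2) * nu.
    have -> : 2 / (c1 * c2) * nu = 2 / (n%:R * (c1 * u) * (c2 * u)).
      by rewrite /nu; field; rewrite !gt_eqF.
    have h : n%:R * (c1 * u) * (c2 * u) <= A0 * (1 - q).
      by apply: ler_pM => //; rewrite ltW// !mulr_gt0.
    by rewrite ler_wpM2l// lef_pV2 ?posrE ?(mulr_gt0 nc1u) ?(mulr_gt0 A0_gt0).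
  have z3 : 4 / (n%:R * k0 * (1 - q) ^+ 2) <= 4 / (k0 * c2 ^+ 2) * nu.
    have -> : 4 / (k0 * c2 ^+ 2) * nu = 4 / (n%:R * k0 * (c2 * u) ^+ 2).
      by rewrite /nu; field; rewrite !gt_eqF.
    have h : n%:R * k0 * (c2 * u) ^+ 2 <= n%:R * k0 * (1 - q) ^+ 2.
      rewrite ler_wpM2l ?(ltW nK)// lerXn2r ?nnegrE ?(ltW q10)//.
      by rewrite mulr_ge0// ltW.
    by rewrite ler_wpM2l// lef_pV2 ?posrE ?(mulr_gt0 nK) ?exprn_gt0.
  have z0 : 0 <= 1 / (n%:R * (1 - q)) + 2 / (A0 * (1 - q)) + 4 / (n%:R * k0 * (1 - q) ^+ 2).
    by rewrite !addr_ge0// divr_ge0// ?mulr_ge0 ?sqr_ge0// ltW.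
  have k2E : k2 * nu = u0 / c2 * nu + 2 / (c1 * c2) * nu + 4 / (k0 * c2 ^+ 2) * nu.
    by rewrite /k2 !mulrDl.
  have -> : 1 - 1 / (n%:R * (1 - q)) - 2 / (A0 * (1 - q)) -
      4 / (n%:R * k0 * (1 - q) ^+ 2) =
      1 - (1 / (n%:R * (1 - q)) + 2 / (A0 * (1 - q)) + 4 / (n%:R * k0 * (1 - q) ^+ 2)).
    by ring.
  have e2r : 0 <= e2 * r <= 1 by rewrite r_e2 mulr_ge0// ltW.
  have xx : 0 <= 2 * (n%:R * K2) / A0 ^+ 2 <= 1 by rewrite x10/=; lra.
  apply: le_trans (three_factors xx e2r z0).
  by rewrite CE k2E; lra.
- have e1X : 0 <= X * (1 + 2 * (e1 * r ^+ 2)).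
    by rewrite mulr_ge0 ?(ltW X_gt0)// addr_ge0// mulr_ge0.
  apply: le_trans (geometric_sum_le q_gt0 q_lt1 e1X tail_le) _.
  rewrite mulrAC -leadE ler_wpM2l ?(ltW lead0)// CE; lra.
(* Every tail is at most 2Xq = 2 (1-q) [lead], and 1 - q <= 2u. *)
- move=> j; apply: (le_trans (tail_le j)).
  have qj : q ^+ j.+1 <= q.
    by rewrite exprS ler_piMr ?(ltW q_gt0)// exprn_ile1 ?(ltW q_gt0) ?(ltW q_lt1).
  have q2u : 1 - q <= 2 * u.
    have := expR_ge1Dx (- (2 * u)); rewrite -/q; lra.
  apply: (@le_trans _ _ (X * 2 * q)).
    apply: ler_pM => //; first by rewrite mulr_ge0 ?(ltW X_gt0)// addr_ge0// mulr_ge0.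
      by rewrite exprn_ge0// ltW.
    by rewrite ler_wpM2l ?(ltW X_gt0)//; move: r_e1; lra.
  have -> : X * 2 * q = 2 * (lead n b * (1 - q)).
    by rewrite leadE; field; rewrite gt_eqF.
  have := ler_wpM2l (ltW lead0) q2u; lra.
Qed.

End fixed_n.

End tail_sum_estimate.

(** * Taylor bounds at a critical point *)

Section taylor.
Context {R : realType}.
Implicit Types f g : R -> R.

Lemma mean_value_bound f f' (c x K : R) :
  (forall y, `|y - c| <= `|x - c| -> is_derive y 1 f (f' y)) ->
  (forall y, `|y - c| <= `|x - c| -> `|f' y| <= K) ->
  `|f x - f c| <= K * `|x - c|.
Proof.
move=> df fK.
have cont a b : (forall y, a <= y <= b -> `|y - c| <= `|x - c|) ->
    {within `[a, b], continuous f}.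
  move=> ab; apply: continuous_in_subspaceT => y.
  rewrite inE/= in_itv/= => /ab yc.
  by apply/differentiable_continuous/derivable1_diffP; have [] := df _ yc.
have [cx|xc|->] := ltgtP c x; last by rewrite !subrr !normr0 mulr0.
- have near y : c <= y <= x -> `|y - c| <= `|x - c|.
    by move=> /andP[cy yx]; rewrite !ger0_norm ?subr_ge0 ?(ltW cx)// lerD2r.
  have [|z zcx ->] := MVT cx (df := f') _ (cont _ _ near).
    by move=> y; rewrite in_itv/= => /andP[cy yx]; apply: df; apply: near; rewrite !ltW.
  rewrite normrM ler_wpM2r// fK// near//.
  by move: zcx; rewrite in_itv/= => /andP[? ?]; rewrite !ltW.
- have near y : x <= y <= c -> `|y - c| <= `|x - c|.
    by move=> /andP[xy yc]; rewrite !ler0_norm ?subr_le0 ?(ltW xc)// !opprB lerD2l lerN2.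
  have [|z zcx E] := MVT xc (df := f') _ (cont _ _ near).
    by move=> y; rewrite in_itv/= => /andP[cy yx]; apply: df; apply: near; rewrite !ltW.
  rewrite distrC E normrM [`|c - x|]distrC ler_wpM2r// fK// near//.
  by move: zcx; rewrite in_itv/= => /andP[? ?]; rewrite !ltW.
Qed.

(** The mean value bound is applied twice, first to the remainder of the derivative and then to the
    remainder of the function, each time gaining one power of the distance. *)
Lemma taylor2 f0 f1 f2 (c e M : R) : 0 <= M -> f1 c = 0 ->
  (forall y, `|y - c| <= e -> is_derive y 1 f0 (f1 y)) ->
  (forall y, `|y - c| <= e -> is_derive y 1 f1 (f2 y)) ->
  (forall y, `|y - c| <= e -> `|f2 y - f2 c| <= M * `|y - c|) ->
  forall x, `|x - c| <= e ->
    `|f1 x - f2 c * (x - c)| <= M * `|x - c| ^+ 2 /\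
    `|f0 x - f0 c - f2 c * (x - c) ^+ 2 / 2| <= M * `|x - c| ^+ 3.
Proof.
move=> M0 f1c df0 df1 lip.
have first x : `|x - c| <= e -> `|f1 x - f2 c * (x - c)| <= M * `|x - c| ^+ 2.
  move=> xe; pose g y := f1 y - f2 c * (y - c).
  have dg y : `|y - c| <= `|x - c| -> is_derive y 1 g (f2 y - f2 c).
    move=> yx; have d1 := df1 y (le_trans yx xe).
    by rewrite /g; apply: is_derive_eq; rewrite /GRing.scale/=; ring.
  have := mean_value_bound (f := g) (K := M * `|x - c|) dg.
  rewrite {2}/g f1c subrr mulr0 !subr0 -mulrA -expr2; apply=> y yx.
  by apply: le_trans (lip _ (le_trans yx xe)) _; rewrite ler_wpM2l.
move=> x xe; split; first exact: first.
pose g y := f0 y - f0 c - f2 c * (y - c) ^+ 2 / 2.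
have dg y : `|y - c| <= `|x - c| -> is_derive y 1 g (f1 y - f2 c * (y - c)).
  move=> yx; have d0 := df0 y (le_trans yx xe).
  by rewrite /g; apply: is_derive_eq; rewrite /GRing.scale/=; field.
have := mean_value_bound (f := g) (K := M * `|x - c| ^+ 2) dg.
rewrite {2}/g !subrr expr0n/= mulr0 mul0r !subr0 -mulrA -exprSr; apply=> y yx.
apply: le_trans (first _ (le_trans yx xe)) _.
by rewrite ler_wpM2l// lerXn2r ?nnegrE.
Qed.

Lemma continuous_bounded_near f (c : R) : {for c, continuous f} ->
  exists2 e : R, 0 < e & forall y, `|y - c| <= e -> `|f y| <= `|f c| + 1.
Proof.
move=> /cvgrPdist_le /(_ 1 ltr01) /nbhs_ballP[e/= e0 fe].
exists (e / 2) => [|y ye]; first by rewrite divr_gt0.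
have /fe /= : ball c e y.
  by rewrite /ball/= distrC (le_lt_trans ye)// gtr_pMr// invf_lt1// ltr1n.
rewrite distrC => h; rewrite -[f y](subrK (f c)) addrC.
by apply: (le_trans (ler_normD _ _)); rewrite lerD2l.
Qed.

(* Three derivatives, the last one continuous at a critical point c *)
Lemma taylor_critical f0 f1 f2 f3 (c e : R) : 0 < e -> f1 c = 0 ->
  (forall y, `|y - c| <= e -> is_derive y 1 f0 (f1 y)) ->
  (forall y, `|y - c| <= e -> is_derive y 1 f1 (f2 y)) ->
  (forall y, `|y - c| <= e -> is_derive y 1 f2 (f3 y)) ->
  {for c, continuous f3} ->
  exists2 del : R, 0 < del & exists2 M : R, 0 <= M &
  forall x, `|x - c| <= del ->
    `|f1 x - f2 c * (x - c)| <= M * `|x - c| ^+ 2 /\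
    `|f0 x - f0 c - f2 c * (x - c) ^+ 2 / 2| <= M * `|x - c| ^+ 3.
Proof.
move=> e0 f1c df0 df1 df2 /continuous_bounded_near[e' e'0 f3b].
have sube y : `|y - c| <= Num.min e e' -> `|y - c| <= e /\ `|y - c| <= e'.
  by rewrite le_min => /andP[].
exists (Num.min e e'); first by rewrite lt_min e0.
have M0 : 0 <= `|f3 c| + 1 by rewrite addr_ge0.
exists (`|f3 c| + 1) => //; apply: taylor2 => //.
- by move=> y /sube[ye _]; exact: df0.
- by move=> y /sube[ye _]; exact: df1.
move=> y /sube[ye ye']; apply: (@mean_value_bound _ f3) => z zy.
  exact: df2 (le_trans zy ye).
exact: f3b (le_trans zy ye').
Qed.

End taylor.

(** * The potential in the logarithmic variable *)

Section log_variable.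
Context {R : realType}.
Variables (V : R -> R) (t1 : R).
Hypothesis V_C3 : C3_on_pos V.
Hypothesis t1_gt0 : 0 < t1.
Hypothesis V1_t1 : derive1 V t1 = 0.
Hypothesis V2_gt0 : 0 < derive1n 2 V t1.
Hypothesis rV'_incr : forall r s : R, 0 < r -> r < s -> r * derive1 V r < s * derive1 V s.

Let V1 : R -> R := derive1 V.
Let V2 : R -> R := derive1n 2 V.
Let V3 : R -> R := derive1n 3 V.

Lemma is_derive_V (r : R) : 0 < r -> is_derive r 1 V (V1 r).
Proof. by move=> /V_C3[d0 _ _ _]; rewrite /V1 derive1E; exact: DeriveDef. Qed.

Lemma is_derive_V1 (r : R) : 0 < r -> is_derive r 1 V1 (V2 r).
Proof.
by move=> /V_C3[_ d1 _ _]; rewrite /V2 derive1nS/= derive1E; exact: DeriveDef.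
Qed.

Lemma is_derive_V2 (r : R) : 0 < r -> is_derive r 1 V2 (V3 r).
Proof.
by move=> /V_C3[_ _ d2 _]; rewrite /V3 derive1nS/= derive1E; exact: DeriveDef.
Qed.

(** With r = e^v the monotonicity of rV'(r) becomes convexity on the whole line, the form required
    by the Laplace bounds. *)
Definition log_V (v : R) : R := V (expR v).
Definition log_V1 (v : R) : R := expR v * V1 (expR v).
Let W2 (v : R) : R := expR v * V1 (expR v) + expR v ^+ 2 * V2 (expR v).
Let W3 (v : R) : R := expR v * V1 (expR v) + 3 * expR v ^+ 2 * V2 (expR v) +
  expR v ^+ 3 * V3 (expR v).

Lemma is_derive_log_V (v : R) : is_derive v 1 log_V (log_V1 v).
Proof.
have d := is_derive_V (expR_gt0 v).
by rewrite /log_V; apply: is_derive_eq; rewrite /log_V1 /GRing.scale/= mulrC ?mulr1.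
Qed.

Lemma is_derive_log_V1 (v : R) : is_derive v 1 log_V1 (W2 v).
Proof.
have d := is_derive_V1 (expR_gt0 v).
have d2 : is_derive v 1 (fun v => V1 (expR v)) (expR v * V2 (expR v)).
  by apply: is_derive_eq; rewrite /GRing.scale/= mulrC.
by rewrite /log_V1; apply: is_derive_eq; rewrite /W2 /GRing.scale/=; ring.
Qed.

Lemma is_derive_W2 (v : R) : is_derive v 1 W2 (W3 v).
Proof.
have d := is_derive_V1 (expR_gt0 v).
have d2 : is_derive v 1 (fun v => V1 (expR v)) (expR v * V2 (expR v)).
  by apply: is_derive_eq; rewrite /GRing.scale/= mulrC.
have d' := is_derive_V2 (expR_gt0 v).
have d3 : is_derive v 1 (fun v => V2 (expR v)) (expR v * V3 (expR v)).
  by apply: is_derive_eq; rewrite /GRing.scale/= mulrC.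
by rewrite /W2; apply: is_derive_eq; rewrite /W3 /GRing.scale/=; ring.
Qed.

Lemma log_V1_incr u v : u < v -> log_V1 u < log_V1 v.
Proof. by move=> uv; apply: rV'_incr; rewrite ?expR_gt0// ltr_expR. Qed.

Let w0 : R := ln t1.
Let ew0 : expR w0 = t1. Proof. by rewrite lnK. Qed.
Let k0 : R := t1 ^+ 2 * V2 t1.

Lemma continuous_W3_w0 : {for w0, continuous W3}.
Proof.
have cexp := @continuous_expR R w0.
have c1 : {for w0, continuous (fun v => V1 (expR v))}.
  apply: continuous_comp; first exact: cexp.
  by rewrite ew0; apply/differentiable_continuous/derivable1_diffP;
    have [] := is_derive_V1 t1_gt0.
have c2 : {for w0, continuous (fun v => V2 (expR v))}.
  apply: continuous_comp; first exact: cexp.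
  by rewrite ew0; apply/differentiable_continuous/derivable1_diffP;
    have [] := is_derive_V2 t1_gt0.
have c3 : {for w0, continuous (fun v => V3 (expR v))}.
  apply: continuous_comp; first exact: cexp.
  by rewrite ew0; have [_ _ _] := V_C3 t1_gt0.
have ceX k : {for w0, continuous ((fun x : R => x ^+ k) \o expR)}.
  by apply: continuous_comp; [exact: cexp|exact: exprn_continuous].
have e2 := ceX 2%N; have e3 := ceX 3%N.
rewrite /W3; apply: cvgD; first apply: cvgD.
- by apply: cvgM; [exact: cexp|exact: c1].
- apply: cvgM; last exact: c2.
  by apply: cvgM; [exact: cvg_cst|exact: e2].
- by apply: cvgM; [exact: e3|exact: c3].
Qed.

Lemma log_V_taylor : exists2 del : R, 0 < del & exists2 M : R, 0 <= M &
  forall v, `|v - w0| <= del ->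
    `|log_V1 v - k0 * (v - w0)| <= M * `|v - w0| ^+ 2 /\
    `|log_V v - log_V w0 - k0 * (v - w0) ^+ 2 / 2| <= M * `|v - w0| ^+ 3.
Proof.
(* The first-order term of the second derivative vanishes because t1 is critical, leaving t1^2
   V''(t1). *)
have -> : k0 = W2 w0 by rewrite /W2 ew0 /V1 V1_t1 mulr0 add0r.
apply: (taylor_critical ltr01 _ _ _ _ continuous_W3_w0).
- by rewrite /log_V1 ew0 /V1 V1_t1 mulr0.
- by move=> y _; exact: is_derive_log_V.
- by move=> y _; exact: is_derive_log_V1.
- by move=> y _; exact: is_derive_W2.
Qed.

Lemma V_taylor : exists2 del : R, 0 < del & exists2 M : R, 0 <= M &
  forall d, 0 <= d -> d <= del ->
    `|V1 (t1 - d) + V2 t1 * d| <= M * d ^+ 2 /\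
    `|V (t1 - d) - V t1 - V2 t1 * d ^+ 2 / 2| <= M * d ^+ 3.
Proof.
(* A neighbourhood of radius t1/2 stays inside the positive radii, where V is differentiable. *)
have t20 : 0 < t1 / 2 by rewrite divr_gt0.
have pos y : `|y - t1| <= t1 / 2 -> 0 < y by rewrite ler_norml; lra.
have [||||del del0 [M M0 H]] := @taylor_critical _ V V1 V2 V3 t1 (t1 / 2) t20 V1_t1.
- by move=> y /pos; exact: is_derive_V.
- by move=> y /pos; exact: is_derive_V1.
- by move=> y /pos; exact: is_derive_V2.
- by have [_ _ _] := V_C3 t1_gt0.
exists del => //; exists M => // d d0 ddel.
have := H (t1 - d); have -> : t1 - d - t1 = - d by ring.
rewrite normrN ger0_norm// sqrrN mulrN opprK; exact.
Qed.

(** Taylor's formula gives slope k0/2 near w0; farther away monotonicity of the derivative preserves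
    the value reached at distance e, which is still linear in u since u <= u0. *)
Lemma log_V1_le u0 : 0 < u0 -> exists2 c1 : R, 0 < c1 &
  forall u, 0 < u -> u <= u0 -> log_V1 (w0 - u) <= - (c1 * u).
Proof.
move=> u00; have [del del0 [M M0 H]] := log_V_taylor.
have k00 : 0 < k0 by rewrite mulr_gt0// exprn_gt0.
pose e := Num.min u0 (Num.min del (k0 / (2 * (M + 1)))).
have e0 : 0 < e by rewrite !lt_min u00 del0 divr_gt0// mulr_gt0// ltr_wpDl.
have /andP[eu0 /andP[edel ek]] : [&& e <= u0, e <= del & e <= k0 / (2 * (M + 1))].
  by rewrite /e !ge_min !lexx ?orbT/=.
have loc u : 0 < u -> u <= e -> log_V1 (w0 - u) <= - (k0 / 2 * u).
  move=> u_gt0 ue; have := H (w0 - u); have -> : w0 - u - w0 = - u by ring.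
  rewrite normrN ger0_norm ?(ltW u_gt0)// => /(_ (le_trans ue edel))[+ _].
  rewrite mulrN opprK ler_norml => /andP[_ h].
  have M1 : 0 < M + 1 by rewrite ltr_wpDl.
  have : M * u <= k0 / 2.
    apply: (@le_trans _ _ ((M + 1) * e)); first by apply: ler_pM => //; lra.
    apply: le_trans (ler_wpM2l (ltW M1) ek) _.
    by rewrite le_eqVlt; apply/orP; left; apply/eqP; field; rewrite gt_eqF.
  move=> /(ler_wpM2r (ltW u_gt0)); lra.
(* Chosen so that the value k0 e / 2 at distance e is matched at u = u0. *)
exists (k0 * e / (2 * u0)); first by rewrite divr_gt0 ?mulr_gt0.
move=> u u_gt0 uu0.
have ce : k0 * e / (2 * u0) <= k0 / 2.
  have -> : k0 * e / (2 * u0) = k0 / 2 * (e / u0) by field; rewrite gt_eqF.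
  apply: ler_piMr; first by rewrite divr_ge0// ltW.
  by rewrite ler_pdivrMr// mul1r.
have [ue|eu] := leP u e.
  by apply: le_trans (loc _ u_gt0 ue) _; rewrite lerN2 ler_wpM2r// ltW.
apply: (@le_trans _ _ (log_V1 (w0 - e))).
  by apply: ltW; apply: log_V1_incr; lra.
apply: le_trans (loc _ e0 (lexx _)) _; rewrite lerN2.
have -> : k0 * e / (2 * u0) * u = k0 / 2 * e * (u / u0) by field; rewrite gt_eqF.
apply: ler_piMr; first by rewrite mulr_ge0 ?(ltW e0)// divr_ge0// ltW.
by rewrite ler_pdivrMr// mul1r.
Qed.

(** The second derivative is bounded on a compact interval containing all the unit windows, so one
    constant works for every u. *)
Lemma log_V_quad u0 : 0 < u0 -> exists2 K2 : R, 0 < K2 &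
  forall u v, 0 < u -> u <= u0 -> w0 - u - 1 <= v <= w0 - u ->
  log_V v <= log_V (w0 - u) + log_V1 (w0 - u) * (v - (w0 - u)) +
    K2 * (v - (w0 - u)) ^+ 2.
Proof.
move=> u00.
have cW2 : continuous W2 by exact: is_derive_continuous is_derive_W2.
have cN : continuous (fun v => `|W2 v|).
  by move=> v; apply: continuous_comp; [exact: cW2|exact: norm_continuous].
have [|c _ cmax] := @EVT_max R (fun v => `|W2 v|) (w0 - u0 - 1) (w0 + 1) _
  (continuous_subspaceT cN); first by lra.
exists (`|W2 c| + 1); first by rewrite ltr_wpDl.
move=> u v u_gt0 uu0 /andP[v1 v2]; set b := w0 - u in v1 v2 *.
have vb : `|v - b| = b - v by rewrite ler0_norm ?subr_le0// opprB.
have W2K y : `|y - b| <= `|v - b| -> `|W2 y| <= `|W2 c| + 1.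
  rewrite vb ler_norml => /andP[y1 y2].
  have /cmax : y \in `[w0 - u0 - 1, w0 + 1].
    by rewrite in_itv/=; move: y1 y2 v1; rewrite /b => *; apply/andP; split; lra.
  by move=> /le_trans; apply; rewrite lerDl.
pose g z := log_V z - log_V b - log_V1 b * (z - b).
have dg z : `|z - b| <= `|v - b| -> is_derive z 1 g (log_V1 z - log_V1 b).
  move=> _; have d := is_derive_log_V z.
  by rewrite /g; apply: is_derive_eq; rewrite /GRing.scale/=; ring.
have bound := mean_value_bound (f := g) (K := (`|W2 c| + 1) * `|v - b|) dg.
have {bound} : `|g v - g b| <= (`|W2 c| + 1) * `|v - b| * `|v - b|.
  apply: bound => z zv.
  apply: (@le_trans _ _ ((`|W2 c| + 1) * `|z - b|)); last first.
    by rewrite ler_wpM2l// addr_ge0.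
  apply: (@mean_value_bound _ _ W2) => y yz; first exact: is_derive_log_V1.
  exact: W2K (le_trans yz zv).
have -> : g b = 0 by rewrite /g !subrr mulr0 subrr.
rewrite subr0 ler_norml => /andP[_]; rewrite /g vb => h.
have -> : (`|W2 c| + 1) * (v - b) ^+ 2 = (`|W2 c| + 1) * (b - v) * (b - v) by ring.
by rewrite -lerBlDl opprD addrA.
Qed.

End log_variable.

(** * Limits of sequences and asymptotic equivalence *)

Section sequences_facts.
Context {R : realType}.
Implicit Types a b : nat -> R.

Lemma natr_ge_near (A : R) : \forall n \near \oo, A <= n%:R :> R.
Proof. exact: nbhs_infty_ger. Qed.

Lemma ln_ge_near (A : R) : \forall n \near \oo, A <= ln n%:R :> R.
Proof.
near=> n; have h : expR A <= n%:R by near: n; exact: natr_ge_near.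
by rewrite -[A]expRK ler_ln ?posrE ?expR_gt0// (lt_le_trans (expR_gt0 A)).
Unshelve. all: by end_near. Qed.

(** The number r with n r^10 = 1; the tenth root makes the window n^(-2/5) and every error term an
    integral power of r. *)
Definition rate n : R := n%:R `^ (- (1 / 10)).

Lemma rate_gt0 n : (0 < n)%N -> 0 < rate n.
Proof. by move=> n0; rewrite powR_gt0// ltr0n. Qed.

Lemma rateX n : (0 < n)%N -> n%:R * rate n ^+ 10 = 1.
Proof.
move=> n0; have nR : 0 < n%:R :> R by rewrite ltr0n.
rewrite -powR_mulrn ?powR_ge0// -powRrM (_ : - (1 / 10) * 10 = - 1); last by field.
by rewrite powRN powRr1 ?(ltW nR)// divff// gt_eqF.
Qed.

Lemma rate_le_near (e : R) : 0 < e -> \forall n \near \oo, rate n <= e.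
Proof.
move=> e0; near=> n.
have n0 : (0 < n)%N by near: n; exact: nbhs_infty_gt.
have h : (e ^+ 10)^-1 <= n%:R by near: n; exact: natr_ge_near.
have r0 := rate_gt0 n0.
rewrite -(@ler_pXn2r _ 10)// ?nnegrE ?(ltW r0) ?(ltW e0)//.
have nR : 0 < n%:R :> R by rewrite ltr0n.
rewrite -(ler_pM2l nR) rateX//.
have e10 : 0 < e ^+ 10 by rewrite exprn_gt0.
by rewrite -ler_pdivrMr// div1r.
Unshelve. all: by end_near. Qed.

Lemma cvg0P a : (forall e, 0 < e -> \forall n \near \oo, `|a n| <= e) ->
  a n @[n --> \oo] --> (0 : R).
Proof.
move=> h; apply/cvgrPdist_le => e e0; near=> n.
by rewrite sub0r normrN; near: n; exact: h.
Unshelve. all: by end_near. Qed.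

Lemma cvg0_le_near a (e : R) : a n @[n --> \oo] --> (0 : R) -> 0 < e ->
  \forall n \near \oo, `|a n| <= e.
Proof.
move=> /cvgrPdist_le h e0; near=> n; rewrite -normrN -[- _]sub0r.
by near: n; exact: h.
Unshelve. all: by end_near. Qed.

Lemma cvg0_rate : rate n @[n --> \oo] --> (0 : R).
Proof.
apply: cvg0P => e e0; near=> n.
rewrite ger0_norm; last exact: powR_ge0.
by near: n; exact: rate_le_near.
Unshelve. all: by end_near. Qed.

Lemma near_cvg a b (l : R) : (\forall n \near \oo, a n = b n) ->
  a n @[n --> \oo] --> l -> b n @[n --> \oo] --> l.
Proof.
move=> ab; apply: cvg_trans; apply: near_eq_cvg; near=> n; rewrite /=.
by near: n.
Unshelve. all: by end_near. Qed.

Lemma asym_equiv_trans a f b : (\forall n \near \oo, f n != 0) ->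
  asym_equiv a f -> asym_equiv f b -> asym_equiv a b.
Proof.
move=> f0 af fb; rewrite /asym_equiv -[X in _ --> X]mulr1.
apply: (near_cvg (a := fun n => a n / f n * (f n / b n))); last exact: cvgM.
by near=> n; rewrite mulrA divfK//; near: n.
Unshelve. all: by end_near. Qed.

Lemma cvg0_squeeze a b : (\forall n \near \oo, `|a n| <= b n) ->
  b n @[n --> \oo] --> (0 : R) -> a n @[n --> \oo] --> (0 : R).
Proof.
move=> ab b0; apply: cvg0P => e e0; near=> n.
apply: (@le_trans _ _ (b n)); first by near: n.
apply: le_trans (ler_norm _) _; near: n; exact: cvg0_le_near.
Unshelve. all: by end_near. Qed.

Lemma cvg1_sub a : a n - 1 @[n --> \oo] --> (0 : R) -> a n @[n --> \oo] --> (1 : R).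
Proof.
move=> h; have : a n - 1 + 1 @[n --> \oo] --> (0 + 1 : R).
  by apply: cvgD => //; exact: cvg_cst.
by rewrite add0r; apply: near_cvg; apply: nearW => n; rewrite subrK.
Qed.

Lemma cvg1_expR a : a n @[n --> \oo] --> (0 : R) ->
  expR (a n) @[n --> \oo] --> (1 : R).
Proof.
by move=> h; rewrite -expR0; apply: (cvg_comp _ _ h); exact: continuous_expR.
Qed.

Lemma ln_sub_bounds (s t : R) : 0 < s -> s < t ->
  (t - s) / t <= ln t - ln s <= (t - s) / s.
Proof.
move=> s0 st; have t0 : 0 < t by exact: lt_trans st.
have ln_le (x : R) : 0 < x -> ln x <= x - 1.
  by move=> x0; have := expR_ge1Dx (ln x); rewrite lnK ?posrE//; lra.
have h1 := ln_le _ (divr_gt0 s0 t0); have h2 := ln_le _ (divr_gt0 t0 s0).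
rewrite !ln_div ?posrE// in h1 h2.
have -> : (t - s) / t = 1 - s / t by field; rewrite gt_eqF.
have -> : (t - s) / s = t / s - 1 by field; rewrite gt_eqF.
by apply/andP; split; lra.
Qed.

(** Since x / 0 = 0, a quotient with vanishing denominator stays at distance 1 from the limit. *)
Lemma asym_equiv_neq0 a b : asym_equiv a b -> \forall n \near \oo, b n != 0.
Proof.
move=> /cvgrPdist_lt /(_ 1 ltr01); apply: filterS => n /=.
by apply: contraTneq => ->; rewrite invr0 mulr0 subr0 normr1 ltxx.
Qed.

Lemma asym_equiv_cvg0 a b : asym_equiv a b -> b n @[n --> \oo] --> (0 : R) ->
  a n @[n --> \oo] --> (0 : R).
Proof.
move=> ab b0; have : a n / b n * b n @[n --> \oo] --> (1 * 0 : R) by exact: cvgM.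
rewrite mulr0; apply: near_cvg; apply: filterS (asym_equiv_neq0 ab) => n bn.
by rewrite divfK.
Qed.

End sequences_facts.

(** * Growth of logarithms, powers and exponentials *)

Section growth.
Context {R : realType}.
Implicit Types a b : nat -> R.

(** From (1 + (ln y)/2)^2 <= y: the square of the logarithm beats any multiple of it. *)
Lemma mul_ln_le (A : R) : exists2 B : R, 0 < B & forall y, B <= y -> A * ln y <= y.
Proof.
pose A' : R := Num.max A 0; have A'0 : 0 <= A' by rewrite le_max lexx orbT.
exists (expR (8 * A')) => [|y By]; first exact: expR_gt0.
have y0 : 0 < y := lt_le_trans (expR_gt0 _) By.
have lny : 8 * A' <= ln y by rewrite -[leLHS]expRK ler_ln ?posrE// expR_gt0.
have lny0 : 0 <= ln y by apply: le_trans lny; rewrite mulr_ge0.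
apply: (@le_trans _ _ (A' * ln y)); first by rewrite ler_wpM2r// le_max lexx.
have : (1 + ln y / 2) ^+ 2 <= y.
  have yE : expR (ln y / 2) ^+ 2 = y by rewrite expr2 -expRD -splitr lnK// posrE.
  rewrite -[leRHS]yE; have h : 0 <= 1 + ln y / 2 by rewrite addr_ge0// divr_ge0.
  by apply: lerXn2r; rewrite ?nnegrE ?expR_ge0//; exact: expR_ge1Dx.
apply: le_trans; nra.
Qed.

Lemma powR_ge_near (e A : R) : 0 < e -> \forall n \near \oo, A <= n%:R `^ e :> R.
Proof.
move=> e0; near=> n.
have n0 : (0 < n)%N by near: n; exact: nbhs_infty_gt.
have h : A / e <= ln n%:R by near: n; exact: ln_ge_near.
rewrite /powR pnatr_eq0 eqn0Ngt n0/=.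
apply: (@le_trans _ _ (1 + e * ln n%:R)); last exact: expR_ge1Dx.
by move: h; rewrite ler_pdivrMr//; lra.
Unshelve. all: by end_near. Qed.

Lemma ln_le_powR_near (e A : R) : 0 < e ->
  \forall n \near \oo, A * ln n%:R <= n%:R `^ e :> R.
Proof.
move=> e0; have [B B0 lnB] := mul_ln_le (A / e); near=> n.
have n0 : (0 < n)%N by near: n; exact: nbhs_infty_gt.
have : B <= n%:R `^ e by near: n; exact: powR_ge_near.
move=> /lnB; apply: le_trans; rewrite ln_powR mulrA.
by rewrite le_eqVlt; apply/orP; left; apply/eqP; field; rewrite gt_eqF.
Unshelve. all: by end_near. Qed.

Lemma cvg0_inv a : (forall A : R, \forall n \near \oo, A <= a n) ->
  (a n)^-1 @[n --> \oo] --> (0 : R).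
Proof.
move=> a_ge; apply: cvg0P => e e0; near=> n.
have h : e^-1 <= a n by near: n; exact: a_ge.
have an : 0 < a n by apply: lt_le_trans h; rewrite invr_gt0.
by rewrite gtr0_norm ?invr_gt0// -[leRHS]invrK lef_pV2 ?posrE ?invr_gt0.
Unshelve. all: by end_near. Qed.

Lemma cvg0_inv_ge a (A : R) : (\forall n \near \oo, 0 < a n) ->
  (a n)^-1 @[n --> \oo] --> (0 : R) -> \forall n \near \oo, A <= a n.
Proof.
move=> a_gt0 a0; pose B : R := Num.max A 1.
have B0 : 0 < B by rewrite lt_max ltr01 orbT.
near=> n; have an : 0 < a n by near: n.
have h : `|(a n)^-1| <= B^-1 by near: n; apply: cvg0_le_near => //; rewrite invr_gt0.
apply: (@le_trans _ _ B); first by rewrite le_max lexx.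
by move: h; rewrite gtr0_norm ?invr_gt0// lef_pV2 ?posrE.
Unshelve. all: by end_near. Qed.

Lemma ln_ln_ge_near (A : R) : \forall n \near \oo, A <= ln (ln n%:R) :> R.
Proof.
near=> n; have h : expR A <= ln n%:R by near: n; exact: ln_ge_near.
by rewrite -[A]expRK ler_ln ?posrE ?expR_gt0// (lt_le_trans (expR_gt0 A)).
Unshelve. all: by end_near. Qed.

Lemma ln_ln_le_near (A : R) : \forall n \near \oo, A * ln (ln n%:R) <= ln n%:R :> R.
Proof.
have [B B0 lnB] := mul_ln_le A; near=> n.
by apply: lnB; near: n; exact: ln_ge_near.
Unshelve. all: by end_near. Qed.

Lemma sqrt_ge_near (k A : R) : 0 < k -> \forall n \near \oo, A <= Num.sqrt (k * n%:R).
Proof.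
move=> k0; near=> n.
have h : A ^+ 2 / k <= n%:R by near: n; exact: natr_ge_near.
apply: (le_trans (ler_norm A)); rewrite -sqrtr_sqr ler_wsqrtr//.
by rewrite mulrC -ler_pdivrMr.
Unshelve. all: by end_near. Qed.

Lemma cvg0_expRN a : (forall A : R, \forall n \near \oo, A <= a n) ->
  expR (- a n) @[n --> \oo] --> (0 : R).
Proof.
move=> a_ge; apply: (@cvg0_squeeze _ _ (fun n => (a n)^-1)); last exact: cvg0_inv.
near=> n; have an : 0 < a n by apply: (lt_le_trans ltr01); near: n.
rewrite gtr0_norm ?expR_gt0// expRN lef_pV2 ?posrE ?expR_gt0//.
by apply: le_trans (expR_ge1Dx _); rewrite lerDr.
Unshelve. all: by end_near. Qed.

Lemma near_asym_equiv a a' b b' : (\forall n \near \oo, a n = a' n) ->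
  (\forall n \near \oo, b n = b' n) -> asym_equiv a b -> asym_equiv a' b'.
Proof.
move=> aa' bb'; apply: near_cvg; near=> n; congr (_ / _); by near: n.
Unshelve. all: by end_near. Qed.

End growth.

(** * Perturbations of the Gumbel law *)

Section perturbed_gumbel.
Context {R : realType}.
Implicit Types (l L k t y a x : R).

Lemma expR_quarter_sqr x : 0 <= x -> x ^+ 2 <= 4 * expR x.
Proof.
move=> x0; have h : 0 <= 1 + x / 2 by rewrite addr_ge0// divr_ge0.
have : (1 + x / 2) ^+ 2 <= expR x.
  rewrite [x in expR x]splitr expRD -expr2.
  by apply: lerXn2r; rewrite ?nnegrE ?expR_ge0//; exact: expR_ge1Dx.
nra.
Qed.

Lemma mul_expRN_le x : x * expR (- x) <= (expR 1)^-1.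
Proof.
rewrite expRN ler_pdivrMr ?expR_gt0// -expRN -expRD; apply: le_trans (expR_ge1Dx _); lra.
Qed.

(** Uniform control of the error term of size 1 + t^2. For negative t the factor e^t absorbs t^2;
    for positive t, where t^2 <= 4e^t, the double exponential does. Only half of e^t is kept in the
    exponent, the other half being given up to the perturbation. *)
Lemma gumbel_weight_le t :
  (1 + t ^+ 2) * (expR t * expR (- (expR t / 2))) <= 66.
Proof.
have [t0|t0] := leP t 0.
  have h1 : t ^+ 2 <= 4 * expR (- t) by rewrite -sqrrN expR_quarter_sqr ?oppr_ge0.
  have h2 : t ^+ 2 * expR t <= 4.
    have := ler_wpM2r (expR_ge0 t) h1.
    by rewrite -[leRHS]mulrA -expRD addNr expR0 mulr1.
  have h3 : expR t <= 1 by rewrite -expR0 ler_expR.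
  rewrite mulrA; apply: (@le_trans _ _ ((1 + t ^+ 2) * expR t)).
    apply: ler_piMr; first by rewrite mulr_ge0 ?expR_ge0// addr_ge0// sqr_ge0.
    by rewrite -expR0 ler_expR oppr_le0 divr_ge0 ?expR_ge0.
  by rewrite mulrDl mul1r; lra.
set a := expR t; have a0 : 0 < a by exact: expR_gt0.
have h1 : t ^+ 2 <= 4 * a by apply: expR_quarter_sqr; exact: ltW.
have a20 : 0 <= a / 2 by rewrite divr_ge0// ltW.
have h2 := expR_quarter_sqr a20.
have h3 : a / 2 <= expR (a / 2) by apply: le_trans (expR_ge1Dx _); rewrite lerDr.
rewrite expRN mulrA ler_pdivrMr ?expR_gt0//.
apply: (@le_trans _ _ ((1 + 4 * a) * a)).
  by rewrite ler_wpM2r ?(ltW a0)// lerD2l.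
have -> : (1 + 4 * a) * a = 2 * (a / 2) + 16 * (a / 2) ^+ 2 by field.
lra.
Qed.

(** With a = e^t, the shift [lam] costs at most lam a e^(-a) <= lam / e, the sharp constant. The
    remaining perturbation is at most 1/2 and contributes only O(1/l) through [gumbel_weight_le]. *)
Lemma gumbel_gap_le (F lam K l t : R) : 0 < l -> 0 <= lam -> 0 <= K ->
  K * (1 + t ^+ 2) / l <= 1 / 2 ->
  expR (- (expR t * (1 + lam + K * (1 + t ^+ 2) / l))) <= F ->
  F <= expR (- (expR t * (1 + lam - K * (1 + t ^+ 2) / l))) ->
  `|F - expR (- expR t)| <= lam / expR 1 + 66 * K / l.
Proof.
move=> l0 lam0 K0; set kap := K * _ / l => kap2 lo hi.
have t20 : 0 <= 1 + t ^+ 2 by rewrite addr_ge0// sqr_ge0.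
have kap0 : 0 <= kap by rewrite divr_ge0 ?mulr_ge0// ltW.
have weight := gumbel_weight_le t.
move: lo hi weight (expR_gt0 t); move: (expR t) => a lo hi weight a0.
have one_sub x : 1 - x <= expR (- x) by exact: expR_ge1Dx.
have kapw : kap * (a * expR (- (a / 2))) <= 66 * K / l.
  have -> : kap * (a * expR (- (a / 2))) = K / l * ((1 + t ^+ 2) * (a * expR (- (a / 2)))).
    by rewrite /kap; ring.
  have -> : 66 * K / l = K / l * 66 by ring.
  by rewrite ler_wpM2l// divr_ge0// ltW.
have ea : expR (- a) <= expR (- (a / 2)).
  by rewrite ler_expR lerN2; lra.
have e1 : 0 < expR 1 :> R by exact: expR_gt0.
have lame : lam * (a * expR (- a)) <= lam / expR 1.
  by rewrite ler_wpM2l// mul_expRN_le.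
rewrite ler_norml; apply/andP; split.
  have -> : - (lam / expR 1 + 66 * K / l) = - (lam / expR 1) - 66 * K / l by ring.
  have : expR (- a) * (1 - a * (lam + kap)) <= F.
    apply: le_trans lo.
    have -> : - (a * (1 + lam + kap)) = - a + - (a * (lam + kap)) by ring.
    by rewrite expRD ler_wpM2l ?expR_ge0.
  have : kap * (a * expR (- a)) <= kap * (a * expR (- (a / 2))).
    by rewrite ler_wpM2l// ler_wpM2l// ltW.
  have -> : expR (- a) * (1 - a * (lam + kap)) =
     expR (- a) - lam * (a * expR (- a)) - kap * (a * expR (- a)) by ring.
  by move: lame kapw; lra.
apply: (@le_trans _ _ (66 * K / l)); last by rewrite lerDr divr_ge0// expR_ge0.
apply: le_trans kapw; rewrite lerBlDr; apply: (le_trans hi).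
apply: (@le_trans _ _ (expR (- (a * (1 - kap))))).
  by rewrite ler_expR lerN2 ler_wpM2l ?(ltW a0)//; lra.
have e2 : expR (- (a * (1 - kap))) <= expR (- (a / 2)).
  rewrite ler_expR lerN2 ler_wpM2l ?(ltW a0)//; lra.
have : expR (- (a * (1 - kap))) * (1 - a * kap) <= expR (- a).
  have -> : - a = - (a * (1 - kap)) + - (a * kap) by ring.
  by rewrite expRD ler_wpM2l ?expR_ge0.
have : a * kap * expR (- (a * (1 - kap))) <= a * kap * expR (- (a / 2)).
  by rewrite ler_wpM2l// mulr_ge0// ltW.
lra.
Qed.

(** The case t = 0, where a e^(-a) attains its maximum 1/e, gives the matching lower bound. *)
Lemma gumbel_gap_ge (F lam K l : R) : 0 < l -> 0 <= K -> K / l <= lam ->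
  F <= expR (- (1 + lam - K / l)) ->
  (lam - K / l - lam ^+ 2) / expR 1 <= `|F - expR (- 1)|.
Proof.
move=> l0 K0 Kl hi; rewrite distrC; apply: le_trans (ler_norm _).
have kl0 : 0 <= K / l by rewrite divr_ge0// ltW.
set x := lam - K / l; have x0 : 0 <= x by rewrite subr_ge0.
have := one_sub_expRN_ge x0 => h.
have x2 : x - lam ^+ 2 <= 1 - expR (- x).
  apply: le_trans h; rewrite ler_pdivlMr; last by rewrite ltr_pwDl.
  have xl : x <= lam by rewrite gerBl.
  have : x ^+ 2 <= lam ^+ 2 by rewrite lerXn2r ?nnegrE// (le_trans x0).
  have := mulr_ge0 x0 (sqr_ge0 lam); nra.
have := ler_wpM2l (expR_ge0 (- 1)) x2.
have -> : expR (- 1) * (1 - expR (- x)) = expR (- 1) - expR (- (1 + x)).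
  by rewrite (_ : - (1 + x) = - 1 + - x) ?expRD ?mulrBr ?mulr1// opprD.
rewrite -addrA -/x in hi; rewrite -[(expR 1)^-1]expRN; move: hi.
move: (expR (- (1 + x))) (expR (- 1)) (x - _) => b c p; rewrite mulrC; lra.
Qed.

(* l stands for log n, L for log log n, and l - 2 L + k for tau. *)
Lemma tau_shift_bounds l L k t : 1 <= L -> `|t| <= L -> `|k| <= L ->
  100 * L ^+ 2 <= l ->
  let u := l - 2 * L + k in let y := u - 2 * t + t ^+ 2 / u in
  [/\ l / 2 <= u, t < u, l / 2 <= y /\ y <= 2 * l &
    `|l / y - (1 + 2 * L / l)| <= (2 * `|k| + 5 + 2 * t ^+ 2) / l].
Proof.
move=> L1 tL kL Ll u y.
have L2 : L <= L ^+ 2 by rewrite expr2 ler_peMl// (le_trans ler01).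
have [t_ge t_le] : - L <= t /\ t <= L by move: tL; rewrite ler_norml => /andP[].
have [k_ge k_le] : - `|k| <= k /\ k <= `|k| by rewrite ler_norm lerNl -normrN ler_norm.
have u2 : l / 2 <= u by rewrite /u; lra.
have l0 : 0 < l by lra.
have u0 : 0 < u by lra.
have t2 : t ^+ 2 <= L ^+ 2.
  by rewrite -(real_normK (num_real t)) lerXn2r ?nnegrE//; lra.
have tu0 : 0 <= t ^+ 2 / u by rewrite divr_ge0 ?sqr_ge0// ltW.
have tu1 : t ^+ 2 / u <= 1 by rewrite ler_pdivrMr// mul1r; lra.
have yl : l / 2 <= y by rewrite /y /u; lra.
have y0 : 0 < y by lra.
have y2 : y <= 2 * l by rewrite /y /u; lra.
split=> //; first by lra.
have tabs : 2 * `|t| <= 1 + t ^+ 2.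
  have := sqr_ge0 (`|t| - 1); rewrite sqrrB1 real_normK ?num_real// -mulr_natl; lra.
have [ta tb] : - `|t| <= t /\ t <= `|t| by rewrite ler_norm lerNl -normrN ler_norm.
have ly : `|l - y| <= 6 * L by rewrite ler_norml /y /u; apply/andP; split; lra.
(* The numerator l - y - 2L = -k + 2t - t^2/u is free of L, so the first term is O((1+t^2)/l); the
   second is O(L^2/l^2). *)
have -> : l / y - (1 + 2 * L / l) =
   (l - y - 2 * L) / y + 2 * L / l * ((l - y) / y).
  by field; rewrite !lt0r_neq0.
apply: (le_trans (ler_normD _ _)).
have iy : y^-1 <= 2 / l by rewrite -[2 / l]invf_div lef_pV2 ?posrE// divr_gt0.
have iy0 : 0 <= y^-1 by rewrite invr_ge0 ltW.
have h1 : `|(l - y - 2 * L) / y| <= (`|k| + 2 + t ^+ 2) * (2 / l).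
  rewrite normrM (ger0_norm iy0); apply: ler_pM => //.
  by rewrite ler_norml /y /u; apply/andP; split; lra.
have h2 : `|2 * L / l * ((l - y) / y)| <= 1 / l.
  have p0 : 0 <= 2 * L / l by rewrite divr_ge0 ?mulr_ge0 ?(ltW l0)//; lra.
  rewrite normrM (ger0_norm p0) normrM (ger0_norm iy0).
  have : `|l - y| * y^-1 <= 6 * L * (2 / l) by apply: ler_pM.
  move=> /(ler_wpM2l p0) /le_trans; apply.
  have -> : 2 * L / l * (6 * L * (2 / l)) = 24 * L ^+ 2 / l / l.
    by field; rewrite lt0r_neq0.
  by rewrite ler_wpM2r ?invr_ge0 ?(ltW l0)// ler_pdivrMr// mul1r; lra.
apply: (le_trans (lerD h1 h2)).
by rewrite le_eqVlt; apply/orP; left; apply/eqP; field; rewrite lt0r_neq0.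
Qed.

(** Converts relative errors into one additive error. In use U = l/y, p0 = e^(-t^2/(2 tau)), p1 and
    p2 are the Taylor and prefactor corrections, e is the error of the tail sum, m that of the
    product bound. *)
Lemma near_one_factors (a b U p0 p1 p2 e m : R) : 0 <= a <= 1 / 10 -> 0 <= b <= 1 ->
  0 <= U <= 2 -> 1 - b <= p0 <= 1 -> 1 - a <= p1 <= 1 + a -> 1 - a <= p2 <= 1 + a ->
  0 <= e <= a -> 0 <= m <= a ->
  U * p0 * p1 * p2 * (1 + e) * (1 + m) <= U + 10 * a /\
  U - 2 * (b + 3 * a) <= U * p0 * p1 * p2 * (1 - e).
Proof.
move=> /andP[a0 a1] /andP[b0 b1] /andP[U0 U2] /andP[p00 p01] /andP[p10 p11]
  /andP[p20 p21] /andP[e0 e1] /andP[m0 m1].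
have p0_ge0 : 0 <= p0 by lra.
have p1_ge0 : 0 <= p1 by lra.
have p2_ge0 : 0 <= p2 by lra.
have Up : 0 <= U * p0 by rewrite mulr_ge0.
have Up1 : 0 <= U * p0 * p1 by rewrite mulr_ge0.
have Up2 : 0 <= U * p0 * p1 * p2 by rewrite mulr_ge0.
split.
  have h : U * p0 * p1 * p2 * (1 + e) * (1 + m) <= U * 1 * (1 + a) * (1 + a) * (1 + a) * (1 + a).
    have e2 : 0 <= 1 + e by lra.
    have m2 : 0 <= 1 + m by lra.
    apply: ler_pM; rewrite ?lerD2l// ?mulr_ge0//.
    apply: ler_pM; rewrite ?lerD2l//.
    apply: ler_pM; rewrite //.
    apply: ler_pM; rewrite //.
    exact: ler_pM.
  apply: (le_trans h).
  have h2 : (1 + a) * (1 + a) * (1 + a) * (1 + a) <= 1 + 5 * a by nra.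
  have := ler_wpM2l U0 h2; have := ler_wpM2r a0 U2; lra.
have h : U * (1 - b) * (1 - a) * (1 - a) * (1 - a) <= U * p0 * p1 * p2 * (1 - e).
  have b2 : 0 <= 1 - b by lra.
  have a2 : 0 <= 1 - a by lra.
  apply: ler_pM; rewrite ?mulr_ge0 ?lerD2l ?lerN2//.
  apply: ler_pM; rewrite ?mulr_ge0//.
  apply: ler_pM; rewrite ?mulr_ge0//.
  by apply: ler_pM.
apply: le_trans h.
have h1 : 1 - 3 * a <= (1 - a) * (1 - a) * (1 - a) by nra.
have h2 : (1 - b) * (1 - 3 * a) <= (1 - b) * ((1 - a) * (1 - a) * (1 - a)).
  by rewrite ler_wpM2l//; lra.
have h3 : 1 - (b + 3 * a) <= (1 - b) * (1 - 3 * a) by nra.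
have h4 := ler_wpM2l U0 (le_trans h3 h2).
have ba : 0 <= b + 3 * a by lra.
have := ler_wpM2r ba U2; lra.
Qed.

Lemma sqr_le_exp (L : R) : 160 <= L -> 100 * L ^+ 2 <= expR L.
Proof.
move=> L160; have L0 : 0 <= L / 2 by lra.
have h := expR_quarter_sqr L0.
have : (L ^+ 2 / 16) ^+ 2 <= expR L.
  rewrite [in leRHS](splitr L) expRD -expr2.
  apply: lerXn2r; rewrite ?nnegrE ?expR_ge0 ?divr_ge0 ?sqr_ge0//.
  by move: h; rewrite expr_div_n; lra.
apply: le_trans.
have L2 : 160 * 160 <= L ^+ 2 by rewrite expr2 ler_pM.
have -> : (L ^+ 2 / 16) ^+ 2 = L ^+ 2 / 256 * L ^+ 2 by field.
by rewrite ler_wpM2r ?sqr_ge0//; lra.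
Qed.

End perturbed_gumbel.

(** * The tail sum in the original variable and the resulting probability bounds *)

Section smallest_modulus.
Context {R : realType}.
Variables (V : R -> R) (t1 : R).
Variables (d : nat -> measure_display) (Omega : forall n, measurableType (d n))
    (P : forall n, probability (Omega n) R)
    (sigma : forall n, {RV (P n) >-> n.-tuple R[i]}).
Hypothesis V_C3 : C3_on_pos V.
Hypothesis t1_gt0 : 0 < t1.
Hypothesis V1_t1 : derive1 V t1 = 0.
Hypothesis V2_gt0 : 0 < derive1n 2 V t1.
Hypothesis rV'_incr : forall r s : R, 0 < r -> r < s -> r * derive1 V r < s * derive1 V s.
Hypothesis sigma_density : forall n, (0 < n)%N ->
      density_proportional_to (sigma n) (joint_weight V (n := n)).

Let V2 : R := derive1n 2 V t1.

Lemma continuous_V r : 0 < r -> {for r, continuous V}.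
Proof.
move=> r0; apply/differentiable_continuous/derivable1_diffP.
by have [] := V_C3 r0.
Qed.

Definition approx (n : nat) (s : R) : R :=
  Num.sqrt V2 * t1 * s / (Num.sqrt (2 * pi * n%:R) * (t1 ^+ 2 - s ^+ 2)
     * (- derive1 V s)) * expR (- (n%:R * V s) + n%:R * V t1).

Definition tsum n s : R := \sum_(j < n) left_tail V n j (ln s).

Lemma V1_neg (s : R) : 0 < s -> s < t1 -> derive1 V s < 0.
Proof.
move=> s0 st; have := rV'_incr s0 st; rewrite V1_t1 mulr0.
by rewrite pmulr_rlt0.
Qed.

(** An exact identity: q = (s/t1)^2, so q/(1-q) = s^2/(t1^2 - s^2), and the remaining factors come
    from W' = sV'(s) and W''(w0) = t1^2 V''(t1). *)
Lemma lead_approx n (s : R) : (0 < n)%N -> 0 < s -> s < t1 ->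
  lead (log_V V) (log_V1 V) (ln t1) (t1 ^+ 2 * V2) n (ln s) = approx n s.
Proof.
move=> n0 s0 st; have nR : 0 < n%:R :> R by rewrite ltr0n.
have V1s := V1_neg s0 st.
rewrite /lead /first_tail /log_V /log_V1 !lnK//.
have -> : expR (- (2 * (ln t1 - ln s))) = (s / t1) ^+ 2.
  rewrite (_ : - (2 * _) = 2 * (ln s - ln t1)); last by ring.
  by rewrite expRM_natl -ln_div ?posrE// lnK// posrE divr_gt0.
have sq : Num.sqrt (2 * pi / (n%:R * (t1 ^+ 2 * V2))) =
    Num.sqrt (2 * pi * n%:R) / (n%:R * t1 * Num.sqrt V2).
  have p0 : 0 < 2 * pi * n%:R :> R by rewrite !mulr_gt0// pi_gt0.
  apply/eqP; rewrite -(@eqrXn2 _ 2)// ?sqrtr_ge0//; last first.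
    by rewrite divr_ge0 ?mulr_ge0 ?sqrtr_ge0// ltW.
  rewrite exprMn exprVn !exprMn !sqr_sqrtr ?(ltW V2_gt0) ?(ltW p0)//; last first.
    by rewrite divr_ge0 ?mulr_ge0 ?pi_ge0 ?sqr_ge0// ltW.
  by apply/eqP; field; rewrite !gt_eqF.
rewrite sq /approx.
have -> : - (n%:R * (V s - V t1)) = - (n%:R * V s) + n%:R * V t1 by ring.
have sqV : 0 < Num.sqrt V2 by rewrite sqrtr_gt0.
have sqp : 0 < Num.sqrt (2 * pi * n%:R) :> R by rewrite sqrtr_gt0 !mulr_gt0// pi_gt0.
have ts : 0 < t1 ^+ 2 - s ^+ 2 by rewrite subr_gt0 ltrXn2r ?nnegrE ?(ltW s0) ?(ltW t1_gt0).
field.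
by rewrite lt_eqF//= !gt_eqF.
Qed.

(** Uniformity in s on [a, t1) matters, because the threshold moves with n in all but one of the
    regimes. *)
Lemma tsum_bounds (a : R) : 0 < a -> a < t1 -> exists2 C : R, 0 < C &
  \forall n \near \oo, (0 < n)%N /\ forall s, a <= s -> s < t1 ->
   [/\ 0 < approx n s,
      approx n s * (1 - C * ((n%:R * (t1 - s) ^+ 2)^-1 + rate n)) <= tsum n s,
      tsum n s <= approx n s * (1 + C * ((n%:R * (t1 - s) ^+ 2)^-1 + rate n)) &
      forall j : 'I_n, left_tail V n j (ln s) <= C * (t1 - s) * approx n s].
Proof.
move=> a0 at1.
have dW := is_derive_log_V V_C3.
have W1_incr := log_V1_incr rV'_incr.
have [del del0 [M M0 tay]] := log_V_taylor V_C3 t1_gt0 V1_t1.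
set w0 : R := ln t1 in tay *.
have u00 : 0 < ln t1 - ln a by rewrite subr_gt0 ltr_ln ?posrE.
set u0 := ln t1 - ln a in u00.
have [c1 c10 c1P] := log_V1_le V_C3 t1_gt0 V1_t1 V2_gt0 rV'_incr u00.
have [K2 K20 K2P] := log_V_quad t1 V_C3 u00.
set k0 : R := t1 ^+ 2 * V2.
have k00 : 0 < k0 by rewrite mulr_gt0// exprn_gt0.
pose TC := tail_const k0 M c1 K2 u0.
have TC0 : 0 <= TC.
  have sq0 : 0 <= Num.sqrt (2 * pi / k0) by exact: sqrtr_ge0.
  rewrite /TC /tail_const; have := ltW u00; have := ltW k00; have := ltW c10.
  move=> h1 h2 h3; have h4 : 0 <= 1 + 2 * u0 by lra.
  by repeat first [exact: ltW | done | apply: addr_ge0 | apply: mulr_ge0 |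
    rewrite invr_ge0 | apply: exprn_ge0].
pose e1 := M + 8 / k0; pose e2 := 2 * M + 16 / (k0 * Num.sqrt (2 * pi / k0)).
have e10 : 0 <= e1 by rewrite addr_ge0// divr_ge0// ltW.
have e20 : 0 <= e2.
  apply: addr_ge0; first exact: mulr_ge0.
  by apply: divr_ge0 => //; apply: mulr_ge0; [exact: ltW|exact: sqrtr_ge0].
(* The factor t1^2 is the price of u >= (t1-s)/t1 in 1/(n u^2); the term 4/a comes from 4u <=
   4(t1-s)/a in the bound on single tails. *)
exists (TC * (t1 ^+ 2 + 1) + 4 / a).
  by rewrite ltr_wpDl ?divr_gt0// mulr_ge0// addr_ge0// sqr_ge0.
have near_small (c k : R) : 0 <= c -> 0 < k -> \forall n \near \oo, rate n <= k / (c + 1) :> R.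
  by move=> c_ge0 k_gt0; apply: rate_le_near; rewrite divr_gt0// ltr_wpDl.
near=> n.
have n0 : (0 < n)%N by near: n; exact: nbhs_infty_gt.
have nR : 0 < n%:R :> R by rewrite ltr0n.
split=> // s as_ st.
have s0 : 0 < s by exact: lt_le_trans as_.
set r := rate n; have r0 : 0 < r by exact: rate_gt0.
have r1 : r <= 1 by rewrite /r; near: n; exact: rate_le_near.
have rX k : r ^+ k.+1 <= r by rewrite exprS ler_piMr ?(ltW r0)// exprn_ile1// ltW.
have small (c k : R) : 0 <= c -> 0 < k -> r <= k / (c + 1) -> forall i, c * r ^+ i.+1 <= k.
  move=> c_ge0 k_gt0 rk i; have c1p : 0 < c + 1 by rewrite ltr_wpDl.
  apply: (@le_trans _ _ ((c + 1) * r)).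
    by apply: ler_pM => //; [rewrite exprn_ge0// ltW|rewrite lerDl].
  by rewrite mulrC -ler_pdivlMr.
have q_del : r ^+ 4 <= del.
  by apply: le_trans (rX 3) _; rewrite /r; near: n; exact: rate_le_near.
have q_M : M * r ^+ 4 <= k0 / 4.
  apply: small => //; first by rewrite divr_gt0.
  by rewrite /r; near: n; apply: near_small => //; rewrite divr_gt0.
have q_e1 : e1 * r ^+ 2 <= 1 / 2.
  by apply: small => //; rewrite /r; near: n; apply: near_small.
have q_e2 : e2 * r <= 1.
  by rewrite -[r]expr1; apply: small => //; rewrite /r; near: n; apply: near_small.
have q_k0 : 128 * r ^+ 2 <= k0.
  by apply: small => //; rewrite /r; near: n; apply: near_small.
have q_K2 : 1 <= n%:R * K2.
  by rewrite -ler_pdivrMr//; near: n; exact: natr_ge_near.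
have fin (j : 'I_n) : (0 < \int[lebesgue_measure]_v
    (exp_density (log_V V) n j.+1%:R v)%:E < +oo)%E.
  exact: (radial_mass_finite n0 continuous_V (sigma_density n0) j).
pose u := ln t1 - ln s.
have u_gt0 : 0 < u by rewrite subr_gt0 ltr_ln ?posrE.
have u_le : u <= u0 by rewrite lerD2l lerN2 ler_ln ?posrE.
have [lead0 lo hi pj] := tail_sum_bounds dW W1_incr k00 M0 c10 K20 u00
  (fun v h => (tay v h).2) c1P K2P n0 r0 (rateX n0) r1 q_del q_M q_e1 q_e2 q_k0 q_K2
  fin u_gt0 u_le.
have ws : w0 - u = ln s by rewrite /w0 /u opprB addrC subrK.
rewrite ws lead_approx// in lead0 lo hi pj.
have ts : 0 < t1 - s by rewrite subr_gt0.
have [u_ge u_le1] := andP (ln_sub_bounds s0 st).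
have u_le2 : u <= (t1 - s) / a.
  apply: (le_trans u_le1).
  by rewrite ler_wpM2l ?(ltW ts)// lef_pV2 ?posrE.
set nu := (n%:R * (t1 - s) ^+ 2)^-1.
have nu0 : 0 < nu by rewrite invr_gt0 mulr_gt0// exprn_gt0.
have nuP : (n%:R * u ^+ 2)^-1 <= t1 ^+ 2 * nu.
  have -> : t1 ^+ 2 * nu = (n%:R * ((t1 - s) / t1) ^+ 2)^-1.
    by rewrite /nu; field; rewrite !gt_eqF.
  have w0' : 0 < (t1 - s) / t1 by rewrite divr_gt0.
  have p0 : 0 < n%:R * u ^+ 2 by rewrite mulr_gt0// exprn_gt0.
  have p1 : 0 < n%:R * ((t1 - s) / t1) ^+ 2 by rewrite (mulr_gt0 nR)// exprn_gt0.
  rewrite lef_pV2 ?posrE//.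
  by rewrite ler_wpM2l ?(ltW nR)// lerXn2r ?nnegrE ?(ltW w0') ?(ltW u_gt0).
have a4 : 0 < 4 / a by rewrite divr_gt0.
have CE : TC * ((n%:R * u ^+ 2)^-1 + r) <= (TC * (t1 ^+ 2 + 1) + 4 / a) * (nu + r).
  apply: (@le_trans _ _ (TC * (t1 ^+ 2 + 1) * (nu + r))); last first.
    by rewrite ler_wpM2r ?lerDl ?(ltW a4)// addr_ge0// ltW.
  rewrite -mulrA ler_wpM2l// mulrDl mul1r mulrDr -addrA.
  apply: (lerD nuP); rewrite addrA lerDr; apply: addr_ge0 (ltW nu0).
  exact: mulr_ge0 (sqr_ge0 _) (ltW r0).
split=> //.
- by apply: le_trans lo; rewrite ler_wpM2l ?(ltW lead0)// lerD2l lerN2.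
- by apply: le_trans hi _; rewrite ler_wpM2l ?(ltW lead0)// lerD2l.
move=> j; apply: le_trans (pj j) _; rewrite ler_wpM2r ?(ltW lead0)//.
apply: (@le_trans _ _ (4 / a * (t1 - s))).
  have -> : 4 / a * (t1 - s) = 4 * ((t1 - s) / a) by ring.
  by rewrite ler_wpM2l.
by rewrite ler_wpM2r ?(ltW ts)// lerDr mulr_ge0// addr_ge0// sqr_ge0.
Unshelve. all: by end_near. Qed.

Let fin_left n (n0 : (0 < n)%N) s (j : 'I_n) : 0 <= left_tail V n j (ln s) <= 1.
Proof. by rewrite left_tail_ge0 (left_tail_le1 n0 continuous_V (sigma_density n0)). Qed.

(** With S the tail sum, the product lies between 1 - S and e^(-S) <= 1 - S + S^2, so the
    probability is S up to a quadratic error. *)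
Lemma prob_min_le_bounds (a : R) : 0 < a -> a < t1 -> exists2 C : R, 0 < C &
  \forall n \near \oo, (0 < n)%N /\ forall s, a <= s -> s < t1 ->
  let e : R := C * ((n%:R * (t1 - s) ^+ 2)^-1 + rate n) in
  [/\ 0 < approx n s,
    prob_min_le (P n) (sigma n) s <= approx n s * (1 + e) &
    approx n s * (1 - e) - (approx n s * (1 + e)) ^+ 2 <=
      prob_min_le (P n) (sigma n) s].
Proof.
move=> a0 at1; have [C C0 near_bounds] := tsum_bounds a0 at1.
exists C => //; apply: filterS near_bounds => n [n0 bounds].
split=> [//|s as_ st]; set e : R := C * (_ + rate n); have [A0 lo hi _] := bounds s as_ st.
rewrite (prob_min_leE n0 continuous_V (sigma_density n0) (lt_le_trans a0 as_)).
have [_ /andP[p2 p3]] := prod_one_sub_ge (fin_left n0 s).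
have S0 : 0 <= tsum n s by apply: sumr_ge0 => j _; exact: left_tail_ge0.
split=> //; first by apply: le_trans hi; rewrite lerBlDr -lerBlDl.
have := le_trans p3 (expRN_le S0); rewrite -/(tsum n s) => p4.
have : tsum n s ^+ 2 <= (approx n s * (1 + e)) ^+ 2.
  by rewrite lerXn2r ?nnegrE// (le_trans S0).
by move: lo p4; rewrite -/e; lra.
Qed.

(** On the Gumbel scale S does not tend to 0, so the product is compared with e^(-S); for the lower
    bound the single tails must be small, which they are because each is O(t1-s) times the sum. *)
Lemma prob_min_ge_bounds (a : R) : 0 < a -> a < t1 -> exists2 C : R, 0 < C &
  \forall n \near \oo, (0 < n)%N /\ forall s, a <= s -> s < t1 ->
  let e : R := C * ((n%:R * (t1 - s) ^+ 2)^-1 + rate n) in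
  [/\ 0 < approx n s,
    prob_min_ge (P n) (sigma n) s <= expR (- (approx n s * (1 - e))) &
    C * (t1 - s) * approx n s <= 1 / 2 ->
    expR (- ((1 + 2 * (C * (t1 - s) * approx n s)) * (approx n s * (1 + e)))) <=
      prob_min_ge (P n) (sigma n) s].
Proof.
move=> a0 at1; have [C C0 near_bounds] := tsum_bounds a0 at1.
exists C => //; apply: filterS near_bounds => n [n0 bounds].
split=> [//|s as_ st]; set e : R := C * (_ + rate n); have [A0 lo hi pj] := bounds s as_ st.
rewrite (prob_min_geE n0 continuous_V (sigma_density n0) (lt_le_trans a0 as_)).
have [_ /andP[_ p3]] := prod_one_sub_ge (fin_left n0 s).
split=> //; first by apply: le_trans p3 _; rewrite ler_expR lerN2.
move=> m2.
have := @prod_one_sub_expR _ _ (fun j : 'I_n => left_tail V n j (ln s)) _ _ m2.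
move=> /(_ _) h; apply: le_trans (h _); last first.
  by move=> j; rewrite left_tail_ge0 pj.
rewrite ler_expR lerN2 ler_wpM2l// addr_ge0// mulr_ge0//.
by rewrite mulr_ge0 ?(ltW A0)// mulr_ge0 ?(ltW C0)// subr_ge0 ltW.
Qed.

(** * Thresholds approaching the critical radius *)

Definition approx2 (n : nat) (x : R) : R :=
  t1 * expR (- (n%:R * V (t1 - x)) + n%:R * V t1)
    / (2 * Num.sqrt (2 * pi * V2 * n%:R) * x ^+ 2).

(** [approx2] has the prefactor linearised at t1 but keeps V in the exponent; here V is also
    replaced by its quadratic Taylor polynomial. *)
Definition approx3 (n : nat) (x : R) : R :=
  t1 / (2 * Num.sqrt (2 * pi * V2 * n%:R) * x ^+ 2)
    * expR (- (1 / 2 * V2 * n%:R * x ^+ 2)).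

Lemma approx3_gt0 n (x : R) : (0 < n)%N -> 0 < x -> 0 < approx3 n x.
Proof.
move=> n0 x0; have nR : 0 < n%:R :> R by rewrite ltr0n.
have p0 : 0 < 2 * pi * V2 * n%:R :> R by rewrite !mulr_gt0// pi_gt0.
rewrite mulr_gt0 ?expR_gt0// divr_gt0//.
by apply: mulr_gt0; [apply: mulr_gt0 => //; rewrite sqrtr_gt0|rewrite exprn_gt0].
Qed.

(** The two replacements are separated: [rho] collects the relative errors of the prefactor, of
    order x, and E is the cubic Taylor remainder of V, which n multiplies in the exponent. *)
Lemma approx_gap : exists2 del : R, 0 < del < t1 & exists2 C : R, 0 < C &
  forall n x, (0 < n)%N -> 0 < x -> x <= del -> exists rho E : R,
   [/\ `|rho - 1| <= C * x, `|E| <= C * x ^+ 3,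
     approx n (t1 - x) = approx2 n x * rho &
     approx2 n x = approx3 n x * expR (- (n%:R * E))].
Proof.
have [del del0 [M M0 taylor]] := V_taylor V_C3 t1_gt0 V1_t1.
(* The last two bounds keep x below t1 and ensure M x <= V2/2, hence -V'(t1-x) >= V2 x / 2. *)
pose D : R := Num.min del (Num.min (t1 / 2) (V2 / (2 * (M + 1)))).
have M1 : 0 < M + 1 by rewrite ltr_wpDl.
exists D.
  rewrite !lt_min del0/= divr_gt0// divr_gt0 ?mulr_gt0//=.
  by rewrite !gt_min ltr_pdivrMr// ltr_pMr// ltr1n orbT.
pose C : R := 2 / t1 + 2 * M / V2 + M.
have C0 : 0 < C.
  by rewrite /C !ltr_pwDl ?divr_ge0 ?mulr_ge0 ?divr_gt0 ?(ltW V2_gt0).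
exists C => // n x n0 x0; rewrite !le_min => /and3P[xdel xt1 xM].
have nR : 0 < n%:R :> R by rewrite ltr0n.
have [tay1 tay0] := taylor x (ltW x0) xdel.
rewrite -/V2 in tay1 tay0.
have xt : x < t1 by apply: le_lt_trans xt1 _; rewrite ltr_pdivrMr// ltr_pMr// ltr1n.
have Mx : M * x <= V2 / 2.
  move: xM; rewrite ler_pdivlMr ?mulr_gt0// => xM.
  by have := ltW x0; lra.
set D1 := - derive1 V (t1 - x).
have D1g : V2 * x / 2 <= D1 /\ `|D1 - V2 * x| <= M * x ^+ 2.
  have e : D1 - V2 * x = - (derive1 V (t1 - x) + V2 * x) by rewrite /D1; ring.
  rewrite e normrN; split=> //; move: tay1; rewrite -normrN -e ler_norml => /andP[h _].
  have h2 : M * x ^+ 2 <= V2 * x / 2.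
    by rewrite expr2 mulrA (le_trans (ler_wpM2r (ltW x0) Mx))// mulrAC.
  by move: h h2; lra.
have [D1_ge D1_near] := D1g.
have V2x : 0 < V2 * x by rewrite mulr_gt0.
have D1_gt0 : 0 < D1 by apply: lt_le_trans D1_ge; rewrite divr_gt0.
(* With s = t1 - x, f corrects s/(t1^2 - s^2) against 1/(2x), and g corrects -V'(s) against V2 x. *)
pose f := (2 * t1 - 2 * x) / (2 * t1 - x); pose g := V2 * x / D1.
have tx : 0 < 2 * t1 - x by move: xt t1_gt0; lra.
have f1 : `|f - 1| <= x / t1.
  have -> : f - 1 = - (x / (2 * t1 - x)) by rewrite /f; field; rewrite gt_eqF.
  rewrite normrN ger0_norm ?divr_ge0 ?(ltW x0) ?(ltW tx)// ler_wpM2l ?(ltW x0)//.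
  by rewrite lef_pV2 ?posrE//; move: xt; lra.
have g1 : `|g - 1| <= 2 * M / V2 * x.
  have -> : g - 1 = - ((D1 - V2 * x) / D1) by rewrite /g; field; rewrite gt_eqF.
  rewrite normrN normrM normfV (gtr0_norm D1_gt0) ler_pdivrMr//.
  apply: (le_trans D1_near); apply: (@le_trans _ _ (2 * M / V2 * x * (V2 * x / 2))).
    by rewrite le_eqVlt; apply/orP; left; apply/eqP; field; rewrite gt_eqF.
  by rewrite ler_wpM2l// mulr_ge0 ?(ltW x0)// divr_ge0 ?mulr_ge0// ltW.
have g2 : `|g| <= 2.
  rewrite /g normrM normfV (gtr0_norm D1_gt0) (gtr0_norm V2x) ler_pdivrMr//.
  by move: D1_ge; lra.
exists (f * g), (V (t1 - x) - V t1 - V2 * x ^+ 2 / 2); split.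
- have -> : f * g - 1 = (f - 1) * g + (g - 1) by ring.
  apply: (le_trans (ler_normD _ _)); rewrite normrM.
  have h : `|f - 1| * `|g| <= x / t1 * 2 by apply: ler_pM.
  apply: (le_trans (lerD h g1)); rewrite /C.
  have : 0 <= M * x by rewrite mulr_ge0// ltW.
  have -> : x / t1 * 2 = 2 / t1 * x by ring.
  by lra.
- apply: (le_trans tay0); rewrite ler_wpM2r ?exprn_ge0 ?(ltW x0)// lerDr.
  by rewrite addr_ge0 ?divr_ge0 ?mulr_ge0// ltW.
- rewrite /approx /approx2 /f /g /D1 -/V2.
  have -> : Num.sqrt (2 * pi * V2 * n%:R) = Num.sqrt V2 * Num.sqrt (2 * pi * n%:R) :> R.
    by rewrite -sqrtrM ?(ltW V2_gt0)//; congr Num.sqrt; ring.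
  have V2E : V2 = Num.sqrt V2 ^+ 2 by rewrite sqr_sqrtr// ltW.
  rewrite [in RHS](_ : V2 * x = Num.sqrt V2 ^+ 2 * x); last by rewrite -V2E.
  have sV : 0 < Num.sqrt V2 by rewrite sqrtr_gt0.
  have sn : 0 < Num.sqrt (2 * pi * n%:R) :> R by rewrite sqrtr_gt0 !mulr_gt0// pi_gt0.
  move: sV sn D1_gt0; rewrite /D1.
  move: (Num.sqrt V2) (Num.sqrt _) (derive1 V _) (expR _) => a b c e a0 b0 c0.
  have tx2 : t1 ^+ 2 - (t1 - x) ^+ 2 = x * (2 * t1 - x) by ring.
  rewrite tx2; field; rewrite oppr_gt0 in c0.
  by rewrite ?(gt_eqF tx) ?(lt_eqF c0) ?(gt_eqF a0) ?(gt_eqF b0) ?(gt_eqF x0) ?(gt_eqF t1_gt0).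
- rewrite /approx2 /approx3; set B := _ * x ^+ 2.
  have -> : - (n%:R * V (t1 - x)) + n%:R * V t1 = - (1 / 2 * V2 * n%:R * x ^+ 2) -
      n%:R * (V (t1 - x) - V t1 - V2 * x ^+ 2 / 2) by field.
  by rewrite expRD mulrA -!mulrA [_ / B]mulrC !mulrA; ring.
Qed.

(** The linear error vanishes because n(t1-s)^2 tends to infinity, the quadratic one because the
    approximation tends to 0. *)
Lemma prob_min_le_equiv (a : R) (s : nat -> R) : 0 < a -> a < t1 ->
  (\forall n \near \oo, a <= s n /\ s n < t1) ->
  (n%:R * (t1 - s n) ^+ 2)^-1 @[n --> \oo] --> (0 : R) ->
  approx n (s n) @[n --> \oo] --> (0 : R) ->
  asym_equiv (fun n => prob_min_le (P n) (sigma n) (s n)) (fun n => approx n (s n)).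
Proof.
move=> a0 at1 s_near gap0 approx0.
have [C C0 bounds] := prob_min_le_bounds a0 at1.
pose e n : R := C * ((n%:R * (t1 - s n) ^+ 2)^-1 + rate n).
have e_cvg0 : e n @[n --> \oo] --> (0 : R).
  rewrite -(mulr0 C) -[X in _ * X](addr0 0); apply: cvgM; first exact: cvg_cst.
  by apply: cvgD => //; exact: cvg0_rate.
have e1_cvg : 1 + e n @[n --> \oo] --> (1 : R).
  by rewrite -[X in _ --> X]addr0; apply: cvgD => //; exact: cvg_cst.
apply: cvg1_sub; apply: (@cvg0_squeeze _ _
  (fun n => e n + approx n (s n) * ((1 + e n) * (1 + e n)))); last first.
  rewrite -[X in _ --> X](addr0 0); apply: cvgD => //.
  by rewrite -(mul0r (1 * 1)); apply: cvgM => //; exact: cvgM.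
near=> n.
have [as_ st] : a <= s n /\ s n < t1 by near: n.
have [n0 /(_ _ as_ st)[A0]] : (0 < n)%N /\ forall s, a <= s -> s < t1 ->
  let e : R := C * ((n%:R * (t1 - s) ^+ 2)^-1 + rate n) in
  [/\ 0 < approx n s,
    prob_min_le (P n) (sigma n) s <= approx n s * (1 + e) &
    approx n s * (1 - e) - (approx n s * (1 + e)) ^+ 2 <=
      prob_min_le (P n) (sigma n) s] by near: n.
rewrite -/(e n); move: (prob_min_le _ _ _) (approx _ _) A0 => p A A0 hi lo.
have -> : p / A - 1 = (p - A) / A by field; rewrite gt_eqF.
rewrite normrM normfV (gtr0_norm A0) ler_pdivrMr//.
have h : 0 <= A * ((1 + e n) * (1 + e n)) * A.
  by rewrite mulr_ge0 ?(ltW A0)// mulr_ge0 ?(ltW A0)// -expr2 sqr_ge0.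
by rewrite ler_norml; apply/andP; split; lra.
Unshelve. all: by end_near. Qed.

Lemma prob_min_le_equiv2 (g b : nat -> R) :
  (\forall n \near \oo, 0 < g n) -> g n @[n --> \oo] --> (0 : R) ->
  (n%:R * g n ^+ 2)^-1 @[n --> \oo] --> (0 : R) ->
  asym_equiv (fun n => approx2 n (g n)) b -> b n @[n --> \oo] --> (0 : R) ->
  asym_equiv (fun n => prob_min_le (P n) (sigma n) (t1 - g n)) b.
Proof.
move=> g_gt0 g_cvg gap0 a2b b0.
have [del /andP[del0 delt1] [C C0 gapP]] := approx_gap.
have g_small : \forall n \near \oo, g n <= del.
  by apply: filterS (cvg0_le_near g_cvg del0) => n; apply: le_trans; exact: ler_norm.
have a2_neq0 : \forall n \near \oo, approx2 n (g n) != 0.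
  near=> n; have n0 : (0 < n)%N by near: n; exact: nbhs_infty_gt.
  have gn : 0 < g n by near: n.
  have [|rho [E [_ _ _ ->]]] := gapP n (g n) n0 gn; first by near: n.
  by rewrite mulf_neq0// gt_eqF ?expR_gt0 ?approx3_gt0.
have aa2 : asym_equiv (fun n => approx n (t1 - g n)) (fun n => approx2 n (g n)).
  apply: cvg1_sub; apply: (@cvg0_squeeze _ _ (fun n => C * g n)); last first.
    by rewrite -(mulr0 C); apply: cvgM => //; exact: cvg_cst.
  near=> n; have n0 : (0 < n)%N by near: n; exact: nbhs_infty_gt.
  have gn : 0 < g n by near: n.
  have [|rho [E [rho1 _ -> _]]] := gapP n (g n) n0 gn; first by near: n.
  have a20 : approx2 n (g n) != 0 by near: n.
  by rewrite mulrAC divff// mul1r.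
have ab : asym_equiv (fun n => approx n (t1 - g n)) b.
  exact: asym_equiv_trans a2_neq0 aa2 a2b.
apply: (asym_equiv_trans _ _ ab).
  near=> n; have n0 : (0 < n)%N by near: n; exact: nbhs_infty_gt.
  have gn : 0 < g n by near: n.
  have [|rho [E [rho1 _ _ _]]] := gapP n (g n) n0 gn; first by near: n.
  have bn : b n != 0 by near: n; exact: asym_equiv_neq0 ab.
  have : `|approx n (t1 - g n) / b n - 1| <= 1 / 2.
    near: n; apply: cvg0_le_near => //.
    rewrite -(subrr 1); apply: cvgB; [exact: ab|exact: cvg_cst].
  apply: contraTneq => ->; rewrite mul0r sub0r normrN normr1.
  by rewrite -ltNge ltr_pdivrMr// mul1r ltr1n.
apply: (@prob_min_le_equiv (t1 - del)); rewrite ?subr_gt0// ?gtrBl//.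
- near=> n; split; first by rewrite lerD2l lerN2; near: n.
  by rewrite gtrBl; near: n.
- apply: near_cvg gap0; apply: nearW => n; congr ((_ * _ ^+ 2)^-1); ring.
- exact: asym_equiv_cvg0 ab b0.
Unshelve. all: by end_near. Qed.

(** The cubic remainder in the exponent is O(n g^3), which tends to 0, so the quadratic exponent may
    be used. *)
Lemma prob_min_le_equiv3 (g b : nat -> R) :
  (\forall n \near \oo, 0 < g n) -> n%:R * g n ^+ 3 @[n --> \oo] --> (0 : R) ->
  (n%:R * g n ^+ 2)^-1 @[n --> \oo] --> (0 : R) ->
  asym_equiv (fun n => approx3 n (g n)) b -> b n @[n --> \oo] --> (0 : R) ->
  asym_equiv (fun n => prob_min_le (P n) (sigma n) (t1 - g n)) b.
Proof.
move=> g_gt0 ng3 gap0 a3b b0.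
(* The gap itself tends to 0, being n g^3 divided by n g^2. *)
have g_cvg : g n @[n --> \oo] --> (0 : R).
  have : (n%:R * g n ^+ 2)^-1 * (n%:R * g n ^+ 3) @[n --> \oo] --> (0 * 0 : R) by exact: cvgM.
  rewrite mulr0; apply: near_cvg; near=> n.
  have n0 : (0 < n)%N by near: n; exact: nbhs_infty_gt.
  have gn : 0 < g n by near: n.
  have nR : 0 < n%:R :> R by rewrite ltr0n.
  by field; rewrite !lt0r_neq0.
apply: prob_min_le_equiv2 => //.
have [del /andP[del0 delt1] [C C0 gapP]] := approx_gap.
have g_small : \forall n \near \oo, g n <= del.
  by apply: filterS (cvg0_le_near g_cvg del0) => n; apply: le_trans; exact: ler_norm.
have a3_gt0 : \forall n \near \oo, approx3 n (g n) != 0.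
  near=> n; have n0 : (0 < n)%N by near: n; exact: nbhs_infty_gt.
  have gn : 0 < g n by near: n.
  by rewrite gt_eqF// approx3_gt0.
apply: asym_equiv_trans a3_gt0 _ a3b.
pose f n := ln (approx2 n (g n) / approx3 n (g n)).
have f0 : f n @[n --> \oo] --> (0 : R).
  apply: (@cvg0_squeeze _ _ (fun n => C * (n%:R * g n ^+ 3))); last first.
    by rewrite -(mulr0 C); apply: cvgM => //; exact: cvg_cst.
  near=> n; have n0 : (0 < n)%N by near: n; exact: nbhs_infty_gt.
  have gn : 0 < g n by near: n.
  have [|rho [E [_ EC _ a2]]] := gapP n (g n) n0 gn; first by near: n.
  have a30 : approx3 n (g n) != 0 by rewrite gt_eqF// approx3_gt0.
  rewrite /f a2 mulrAC divff// mul1r expRK normrN normrM normr_nat mulrCA.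
  by rewrite ler_wpM2l.
apply: near_cvg (cvg1_expR f0); near=> n.
have n0 : (0 < n)%N by near: n; exact: nbhs_infty_gt.
have gn : 0 < g n by near: n.
have [|rho [E [_ EC _ a2]]] := gapP n (g n) n0 gn; first by near: n.
have a30 : approx3 n (g n) != 0 by rewrite gt_eqF// approx3_gt0.
by rewrite /f a2 mulrAC divff// mul1r expRK.
Unshelve. all: by end_near. Qed.

(** * The logarithmic scale: fixed multiples of the edge gap and moderate deviations *)

Local Notation tau := (tau V t1).

Lemma tauE n : 0 < ln n%:R :> R ->
  tau n = ln n%:R - 2 * ln (ln n%:R) + ln (V2 * t1 ^+ 2 / (8 * pi)).
Proof.
move=> l0; have nR : 0 < n%:R :> R.
  by rewrite ltr0n lt0n; apply: contraTneq l0 => ->; rewrite ln0// ltxx.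
have p0 := pi_gt0 R.
rewrite /Defs.tau -/V2 (_ : _ / _ = n%:R / ln n%:R ^+ 2 * (V2 * t1 ^+ 2 / (8 * pi))); last first.
  by move: (@pi R) p0 => p p0; field; rewrite !lt0r_neq0.
have h1 : 0 < n%:R / ln n%:R ^+ 2 :> R by rewrite divr_gt0// exprn_gt0.
have h2 : 0 < V2 * t1 ^+ 2 / (8 * pi) by rewrite divr_gt0 ?mulr_gt0// exprn_gt0.
rewrite (lnM (h1 : _ \is Num.pos) (h2 : _ \is Num.pos)); congr (_ + _).
have l2 : 0 < ln n%:R ^+ 2 :> R by rewrite exprn_gt0.
by rewrite (ln_div (nR : _ \is Num.pos) (l2 : _ \is Num.pos)) lnXn// mulr_natl.
Qed.

Lemma expR_tau n : 0 < ln n%:R :> R ->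
  expR (tau n / 2) = Num.sqrt (V2 * n%:R) * t1 / (2 * Num.sqrt (2 * pi) * ln n%:R).
Proof.
move=> l0; have nR : 0 < n%:R :> R.
  by rewrite ltr0n lt0n; apply: contraTneq l0 => ->; rewrite ln0// ltxx.
have p0 := pi_gt0 R.
have sp : 0 < Num.sqrt (2 * pi) :> R by rewrite sqrtr_gt0 mulr_gt0.
apply/eqP; rewrite -(@eqrXn2 _ 2)// ?expR_ge0//; last first.
  by rewrite divr_ge0 ?mulr_ge0 ?sqrtr_ge0// ltW.
rewrite expr2 -expRD -splitr lnK; last first.
  by rewrite posrE divr_gt0// ?mulr_gt0 ?exprn_gt0.
rewrite exprMn exprVn !exprMn !sqr_sqrtr ?mulr_ge0 ?(ltW V2_gt0) ?(ltW p0)//.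
rewrite -/V2; move: (@pi R) p0 => p p0; by apply/eqP; field; rewrite !lt0r_neq0.
Qed.

Lemma cvg_tau_ln : tau n / ln n%:R @[n --> \oo] --> (1 : R).
Proof.
apply: cvg1_sub; apply: cvg0P => e e0.
pose k := ln (V2 * t1 ^+ 2 / (8 * pi)).
near=> n.
have l0 : 0 < ln n%:R :> R.
  by apply: (@lt_le_trans _ _ 1) => //; near: n; exact: ln_ge_near.
have L0 : 0 <= ln (ln n%:R) :> R by near: n; exact: ln_ln_ge_near.
have h1 : 4 / e * ln (ln n%:R) <= ln n%:R :> R by near: n; exact: ln_ln_le_near.
have h2 : 2 / e * `|k| <= ln n%:R :> R by near: n; exact: ln_ge_near.
have -> : tau n / ln n%:R - 1 = (k - 2 * ln (ln n%:R)) / ln n%:R.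
  by rewrite tauE// -/k; field; rewrite lt0r_neq0.
rewrite normrM normfV (gtr0_norm l0) ler_pdivrMr//.
apply: (le_trans (ler_normB _ _)); rewrite (ger0_norm (mulr_ge0 _ L0))//.
move: h1 h2; rewrite mulrAC ler_pdivrMr// mulrAC ler_pdivrMr//.
rewrite [ln n%:R * e]mulrC; lra.
Unshelve. all: by end_near. Qed.

Lemma tau_ge_near (A : R) : \forall n \near \oo, A <= tau n.
Proof.
near=> n.
have l0 : 0 < ln n%:R :> R.
  by apply: (@lt_le_trans _ _ 1) => //; near: n; exact: ln_ge_near.
have lA : 2 * A <= ln n%:R by near: n; exact: ln_ge_near.
have : `|tau n / ln n%:R - 1| <= 1 / 2.
  near: n; apply: cvg0_le_near => //.
  by rewrite -(subrr 1); apply: cvgB; [exact: cvg_tau_ln|exact: cvg_cst].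
rewrite ler_norml => /andP[+ _]; rewrite lerBrDr (_ : - (1 / 2) + 1 = 1 / 2); last by field.
by rewrite ler_pdivlMr//; lra.
Unshelve. all: by end_near. Qed.

(** This explains the choice of tau: e^(tau/2) is the Gaussian prefactor at y = ln n, so only the
    correction (ln n)/y and the exponent difference survive. *)
Lemma approx3E n (y : R) : 0 < ln n%:R :> R -> 0 < y ->
  approx3 n (Num.sqrt y / Num.sqrt (V2 * n%:R)) =
    ln n%:R / y * expR ((tau n - y) / 2).
Proof.
move=> l0 y0; have nR : 0 < n%:R :> R.
  by rewrite ltr0n lt0n; apply: contraTneq l0 => ->; rewrite ln0// ltxx.
have sp : 0 < Num.sqrt (2 * pi) :> R by rewrite sqrtr_gt0 mulr_gt0// pi_gt0.
have Vn : 0 < V2 * n%:R by rewrite mulr_gt0.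
have sVn : 0 < Num.sqrt (V2 * n%:R) by rewrite sqrtr_gt0.
rewrite /approx3 -/V2 exprMn exprVn !sqr_sqrtr ?(ltW y0) ?(ltW Vn)//.
have -> : Num.sqrt (2 * pi * V2 * n%:R) = Num.sqrt (2 * pi) * Num.sqrt (V2 * n%:R) :> R.
  by rewrite -sqrtrM ?mulr_ge0 ?pi_ge0//; congr Num.sqrt; ring.
have -> : - (1 / 2 * V2 * n%:R * (y / (V2 * n%:R))) = - y / 2.
  by field; rewrite !lt0r_neq0.
rewrite mulrBl expRD expR_tau// -mulNr.
have VnE : V2 * n%:R = Num.sqrt (V2 * n%:R) ^+ 2 by rewrite sqr_sqrtr// ltW.
set a := Num.sqrt (V2 * n%:R) in sVn VnE *; rewrite VnE.
set b := Num.sqrt (2 * pi) in sp *; have := expR_gt0 (- y / 2).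
by move: b (expR _) sp => b c sp c0; field; rewrite !lt0r_neq0.
Qed.

(** If y is asymptotic to c ln n, the correction (ln n)/y tends to 1/c. The gap is then of order
    sqrt(ln n / n), well inside the range where the cubic term is negligible. *)
Lemma prob_min_le_equiv_ln (y : nat -> R) (c : R) : 0 < c ->
  y n / ln n%:R @[n --> \oo] --> c ->
  expR ((tau n - y n) / 2) @[n --> \oo] --> (0 : R) ->
  asym_equiv
    (fun n => prob_min_le (P n) (sigma n) (t1 - Num.sqrt (y n) / Num.sqrt (V2 * n%:R)))
    (fun n => c^-1 * expR ((tau n - y n) / 2)).
Proof.
move=> c0 yc b0.
have y_near : \forall n \near \oo, 0 < ln n%:R :> R /\
    c / 2 * ln n%:R <= y n <= (c + 1) * ln n%:R.
  near=> n.
  have l0 : 0 < ln n%:R :> R.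
    by apply: (@lt_le_trans _ _ 1) => //; near: n; exact: ln_ge_near.
  have : `|y n / ln n%:R - c| <= Num.min (c / 2) 1.
    near: n; apply: cvg0_le_near; last by rewrite lt_min ltr01 divr_gt0.
    by rewrite -(subrr c); apply: cvgB => //; exact: cvg_cst.
  rewrite le_min !ler_norml => /andP[/andP[h1 _] /andP[_ h2]]; split=> //.
  by apply/andP; split; [rewrite -ler_pdivlMr|rewrite -ler_pdivrMr] => //; lra.
have y_ge (A : R) : \forall n \near \oo, A <= y n.
  near=> n; have [l0 /andP[h _]] : 0 < ln n%:R :> R /\
    c / 2 * ln n%:R <= y n <= (c + 1) * ln n%:R by near: n.
  apply: le_trans h; rewrite mulrC -ler_pdivrMr ?divr_gt0//.
  by near: n; exact: ln_ge_near.
have sV2 : 0 < Num.sqrt V2 by rewrite sqrtr_gt0.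
pose g n : R := Num.sqrt (y n) / Num.sqrt (V2 * n%:R).
have g_gt0 : \forall n \near \oo, 0 < g n.
  near=> n; have nR : 0 < n%:R :> R by rewrite ltr0n; near: n; exact: nbhs_infty_gt.
  have y1 : 1 <= y n by near: n.
  by rewrite divr_gt0// sqrtr_gt0 ?mulr_gt0// (lt_le_trans ltr01).
have g2 n : (0 < n)%N -> 0 < y n -> n%:R * g n ^+ 2 = y n / V2.
  move=> n0 y0; have nR : 0 < n%:R :> R by rewrite ltr0n.
  rewrite /g exprMn exprVn !sqr_sqrtr ?mulr_ge0 ?(ltW V2_gt0) ?(ltW y0)//.
  by field; rewrite !lt0r_neq0.
apply: prob_min_le_equiv3 => //.
(* Since (n g^3)^2 = (y/V2)^3 / n and y <= (c+1) ln n, the claim n g^3 <= e follows from K (ln n)^3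
   <= n with this K. *)
- apply: cvg0P => e e0; pose K := (c + 1) ^+ 3 / (e ^+ 2 * V2 ^+ 3).
  have K0 : 0 < K.
    by rewrite divr_gt0 ?mulr_gt0 ?exprn_gt0// addr_gt0.
  near=> n; have n0 : (0 < n)%N by near: n; exact: nbhs_infty_gt.
  have nR : 0 < n%:R :> R by rewrite ltr0n.
  have gn : 0 < g n by near: n.
  have y1 : 1 <= y n by near: n.
  have y0 : 0 < y n by exact: lt_le_trans ltr01 y1.
  have [l0 /andP[_ yl]] : 0 < ln n%:R :> R /\
    c / 2 * ln n%:R <= y n <= (c + 1) * ln n%:R by near: n.
  have ln3 : (1 + K) * ln n%:R <= n%:R `^ (1 / 3) by near: n; exact: ln_le_powR_near.
  have Kl : K * ln n%:R ^+ 3 <= n%:R.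
    have h1 : ((1 + K) * ln n%:R) ^+ 3 <= (n%:R `^ (1 / 3)) ^+ 3.
      by rewrite lerXn2r ?nnegrE ?powR_ge0// mulr_ge0 ?(ltW l0)// addr_ge0// ltW.
    have n3 : (n%:R `^ (1 / 3)) ^+ 3 = n%:R :> R.
      rewrite -powR_mulrn ?powR_ge0// -powRrM (_ : 1 / 3 * 3 = 1); last by field.
      by rewrite powRr1 ?ltW.
    rewrite n3 in h1.
    apply: le_trans h1; rewrite exprMn ler_wpM2r ?exprn_ge0 ?(ltW l0)//.
    have -> : (1 + K) ^+ 3 = 1 + 3 * K + 3 * K ^+ 2 + K ^+ 3 by ring.
    by have := exprn_gt0 2 K0; have := exprn_gt0 3 K0; move: K0; lra.
  have ng0 : 0 < n%:R * g n ^+ 3 by rewrite mulr_gt0// exprn_gt0.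
  rewrite (gtr0_norm ng0) -(@ler_pXn2r _ 2)// ?nnegrE ?(ltW ng0) ?(ltW e0)//.
  have -> : (n%:R * g n ^+ 3) ^+ 2 = (n%:R * g n ^+ 2) ^+ 3 / n%:R.
    by field; rewrite lt0r_neq0.
  rewrite g2// ler_pdivrMr// exprMn exprVn ler_pdivrMr ?exprn_gt0//.
  have : y n ^+ 3 <= ((c + 1) * ln n%:R) ^+ 3.
    by rewrite lerXn2r ?nnegrE ?(ltW y0)// mulr_ge0 ?(ltW l0)// addr_ge0// ltW.
  move=> /le_trans; apply; rewrite exprMn.
  have -> : (c + 1) ^+ 3 = K * (e ^+ 2 * V2 ^+ 3).
    by rewrite divfK// lt0r_neq0// mulr_gt0// exprn_gt0.
  have -> : K * (e ^+ 2 * V2 ^+ 3) * ln n%:R ^+ 3 = K * ln n%:R ^+ 3 * (e ^+ 2 * V2 ^+ 3) by ring.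
  have -> : e ^+ 2 * n%:R * V2 ^+ 3 = n%:R * (e ^+ 2 * V2 ^+ 3) by ring.
  by rewrite ler_wpM2r// mulr_ge0// exprn_ge0// ltW.
- have : V2 * (y n)^-1 @[n --> \oo] --> (V2 * 0 : R).
    by apply: cvgM; [exact: cvg_cst|exact: cvg0_inv].
  rewrite mulr0; apply: near_cvg; near=> n.
  have n0 : (0 < n)%N by near: n; exact: nbhs_infty_gt.
  have y0 : 0 < y n by apply: (lt_le_trans ltr01); near: n.
  by rewrite g2// invf_div mulrC.
- have : c / (y n / ln n%:R) @[n --> \oo] --> (c / c : R).
    by apply: cvgM; [exact: cvg_cst|apply: cvgV => //; rewrite lt0r_neq0].
  rewrite divff ?lt0r_neq0//; apply: near_cvg; near=> n.
  have [l0 _] : 0 < ln n%:R :> R /\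
    c / 2 * ln n%:R <= y n <= (c + 1) * ln n%:R by near: n.
  have y0 : 0 < y n by apply: (lt_le_trans ltr01); near: n.
  rewrite /g approx3E//; have := expR_gt0 ((tau n - y n) / 2).
  by move=> E0; field; rewrite !lt0r_neq0.
- by rewrite -(mulr0 c^-1); apply: cvgM => //; exact: cvg_cst.
Unshelve. all: by end_near. Qed.

Lemma V_t1_le (t : R) : 0 < t -> t < t1 -> V t1 <= V t.
Proof.
move=> t0 tt1.
have dV (r : R) : 0 < r -> is_derive r 1 V (derive1 V r) by exact: is_derive_V.
have cV : {within `[t, t1], continuous V}.
  apply: continuous_in_subspaceT => z; rewrite inE/= in_itv/= => /andP[tz _].
  by apply: continuous_V; exact: lt_le_trans tz.
have [|z zt E] := MVT tt1 (df := derive1 V) _ cV.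
  by move=> z; rewrite in_itv/= => /andP[tz _]; apply: dV; exact: lt_trans tz.
move: zt; rewrite in_itv/= => /andP[tz zt1].
rewrite -subr_le0 E pmulr_lle0 ?subr_gt0// ltW// V1_neg//.
exact: lt_trans tz.
Qed.

Lemma prob_min_le_fixed (t : R) : 0 < t -> t < t1 ->
  asym_equiv (fun n => prob_min_le (P n) (sigma n) t) (fun n => approx n t).
Proof.
move=> t0 tt1; apply: (@prob_min_le_equiv t (fun=> t)) => //.
- by near=> n.
- apply: cvg0_inv => A; near=> n.
  rewrite -ler_pdivrMr; last by rewrite exprn_gt0// subr_gt0.
  by near: n; exact: natr_ge_near.
pose k : R := Num.sqrt V2 * t1 * t / ((t1 ^+ 2 - t ^+ 2) * - derive1 V t).
have Vt := V1_neg t0 tt1; have Vle := V_t1_le t0 tt1.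
have sqr_lt : 0 < t1 ^+ 2 - t ^+ 2.
  by rewrite subr_gt0 ltrXn2r// ?nnegrE ltW.
have k0 : 0 < k.
  by rewrite divr_gt0 ?mulr_gt0 ?sqrtr_gt0 ?oppr_gt0.
have : k * (Num.sqrt (2 * pi * n%:R))^-1 @[n --> \oo] --> (k * 0 : R).
  apply: cvgM; first exact: cvg_cst.
  by apply: cvg0_inv => A; apply: sqrt_ge_near; rewrite mulr_gt0 ?pi_gt0.
rewrite mulr0; apply: cvg0_squeeze; near=> n.
have n0 : (0 < n)%N by near: n; exact: nbhs_infty_gt.
have sn : 0 < Num.sqrt (2 * pi * n%:R) :> R.
  by rewrite sqrtr_gt0 !mulr_gt0 ?pi_gt0 ?ltr0n.
have -> : approx n t = k / Num.sqrt (2 * pi * n%:R) * expR (- (n%:R * V t) + n%:R * V t1).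
  rewrite /approx -/V2 /k; move: sn; set a := Num.sqrt (_ * n%:R) => sn.
  by congr (_ * _); field; rewrite (lt_eqF Vt) !lt0r_neq0.
have ks : 0 < k / Num.sqrt (2 * pi * n%:R) by rewrite divr_gt0.
rewrite gtr0_norm; last by rewrite (mulr_gt0 ks)// expR_gt0.
apply: ler_piMr; first exact: ltW.
rewrite -expR0 ler_expR addrC -mulrBr.
by apply: mulr_ge0_le0; rewrite ?ler0n// subr_le0.
Unshelve. all: by end_near. Qed.

Lemma prob_min_le_sqrt_tau (t : R) : 1 < t ->
  asym_equiv
    (fun n => prob_min_le (P n) (sigma n)
       (t1 - t * Num.sqrt (tau n) / Num.sqrt (V2 * n%:R)))
    (fun n => t ^- 2 * (8 * pi * ln n%:R ^+ 2 / (V2 * n%:R * t1 ^+ 2))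
       `^ ((t ^+ 2 - 1) / 2)).
Proof.
move=> t_gt1; have t0 : 0 < t by exact: lt_trans t_gt1.
have t2 : 0 < t ^+ 2 by rewrite exprn_gt0.
have t21 : 0 < t ^+ 2 - 1 by rewrite subr_gt0 exprn_egt1.
have : asym_equiv (fun n => prob_min_le (P n) (sigma n)
    (t1 - Num.sqrt (t ^+ 2 * tau n) / Num.sqrt (V2 * n%:R)))
    (fun n => (t ^+ 2)^-1 * expR ((tau n - t ^+ 2 * tau n) / 2)).
  apply: (prob_min_le_equiv_ln t2).
  - rewrite -[X in _ --> X]mulr1.
    have : t ^+ 2 * (tau n / ln n%:R) @[n --> \oo] --> (t ^+ 2 * 1 : R).
      by apply: cvgM; [exact: cvg_cst|exact: cvg_tau_ln].
    by apply: near_cvg; near=> n; rewrite mulrA.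
  - apply: (@near_cvg _ (fun n => expR (- ((t ^+ 2 - 1) / 2 * tau n)))).
      by near=> n; congr expR; ring.
    apply: cvg0_expRN => A; near=> n.
    rewrite mulrC -ler_pdivrMr ?divr_gt0//.
    by near: n; exact: tau_ge_near.
apply: near_asym_equiv; near=> n.
  by rewrite sqrtrM ?(ltW t2)// sqrtr_sqr gtr0_norm.
have l0 : 0 < ln n%:R :> R.
  by apply: (@lt_le_trans _ _ 1) => //; near: n; exact: ln_ge_near.
have nR : 0 < n%:R :> R by rewrite ltr0n; near: n; exact: nbhs_infty_gt.
have p0 := pi_gt0 R.
set z := 8 * pi * _ / _.
have z0 : 0 < z by rewrite divr_gt0 ?mulr_gt0 ?exprn_gt0.
(* The base of the power is e^(-tau), so the power is e^(-(t^2-1) tau / 2). *)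
have tz : tau n = - ln z.
  rewrite -lnV ?posrE// /Defs.tau -/V2 /z invf_div; congr ln.
  by congr (_ / _); ring.
rewrite /powR gt_eqF//; congr (_ * expR _); rewrite tz; ring.
Unshelve. all: by end_near. Qed.

Lemma prob_min_le_moderate (v : nat -> R) :
  asym_ll (fun=> 1) v -> asym_ll v (fun n => ln n%:R) ->
  asym_equiv
    (fun n => prob_min_le (P n) (sigma n)
       (t1 - Num.sqrt (tau n) / Num.sqrt (V2 * n%:R)
           - v n / Num.sqrt (V2 * n%:R * tau n)))
    (fun n => expR (- v n - v n ^+ 2 / (2 * tau n))).
Proof.
move=> [v_gt0 v_inv] [_ v_ln].
have v_ge A : \forall n \near \oo, A <= v n.
  apply: cvg0_inv_ge => //; apply: near_cvg v_inv.
  by near=> n; rewrite div1r.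
(* This is (sqrt tau + v / sqrt tau)^2, the square of the rescaled gap; it is asymptotic to ln n
   because v is negligible before ln n. *)
pose y n := tau n + 2 * v n + v n ^+ 2 / tau n.
have tau_gt0 : \forall n \near \oo, 0 < tau n.
  by near=> n; apply: (lt_le_trans ltr01); near: n; exact: tau_ge_near.
have l_gt0 : \forall n \near \oo, 0 < ln n%:R :> R.
  by near=> n; apply: (lt_le_trans ltr01); near: n; exact: ln_ge_near.
have yE : \forall n \near \oo, (tau n - y n) / 2 = - v n - v n ^+ 2 / (2 * tau n).
  near=> n; have t0 : 0 < tau n by near: n.
  by rewrite /y; field; rewrite lt0r_neq0.
have : asym_equiv (fun n => prob_min_le (P n) (sigma n)
    (t1 - Num.sqrt (y n) / Num.sqrt (V2 * n%:R)))
    (fun n => 1^-1 * expR ((tau n - y n) / 2)).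
  apply: prob_min_le_equiv_ln => //.
  - have h : tau n / ln n%:R + 2 * (v n / ln n%:R) +
        (v n / ln n%:R) ^+ 2 / (tau n / ln n%:R) @[n --> \oo] --> (1 + 2 * 0 + 0 * 0 / 1 : R).
      apply: cvgD; first apply: cvgD.
      - exact: cvg_tau_ln.
      - by apply: cvgM => //; exact: cvg_cst.
      apply: cvgM; first exact: cvgM.
      by apply: cvgV; [exact: oner_neq0|exact: cvg_tau_ln].
    rewrite !mulr0 mul0r !addr0 in h; apply: near_cvg h; near=> n.
    have t0 : 0 < tau n by near: n.
    have l0 : 0 < ln n%:R :> R by near: n.
    by rewrite /y; field; rewrite !lt0r_neq0.
  - apply: (@cvg0_squeeze _ _ (fun n => expR (- v n))); last exact: cvg0_expRN.
    near=> n; have t0 : 0 < tau n by near: n.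
    rewrite gtr0_norm ?expR_gt0// (_ : (tau n - y n) / 2 = - v n - v n ^+ 2 / (2 * tau n)).
      by rewrite ler_expR gerBl divr_ge0 ?sqr_ge0// mulr_ge0// ltW.
    by near: n.
apply: near_asym_equiv; near=> n; have t0 : 0 < tau n by near: n.
  have vn : 0 < v n by near: n.
  have st : 0 < Num.sqrt (tau n) by rewrite sqrtr_gt0.
  have nR : 0 < n%:R :> R by rewrite ltr0n; near: n; exact: nbhs_infty_gt.
  have sVn : 0 < Num.sqrt (V2 * n%:R) by rewrite sqrtr_gt0 mulr_gt0.
  have -> : y n = (Num.sqrt (tau n) + v n / Num.sqrt (tau n)) ^+ 2.
    have tE : tau n = Num.sqrt (tau n) ^+ 2 by rewrite sqr_sqrtr// ltW.
    rewrite /y [in LHS]tE; field; by rewrite lt0r_neq0.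
  rewrite sqrtr_sqr gtr0_norm; last by rewrite addr_gt0// divr_gt0.
  rewrite [Num.sqrt (_ * tau n)]sqrtrM ?mulr_ge0 ?(ltW V2_gt0)//; congr prob_min_le.
  by field; rewrite !lt0r_neq0.
rewrite invr1 mul1r; congr expR; by near: n.
Unshelve. all: by end_near. Qed.

(** * Gaps much larger than the logarithmic scale *)

Lemma gaussian_prefactor_cvg0 (g : nat -> R) (k : R) : 0 < k ->
  (\forall n \near \oo, 0 < g n) ->
  (forall A : R, \forall n \near \oo, A * ln n%:R <= n%:R * g n ^+ 2) ->
  t1 / (2 * Num.sqrt (2 * pi * V2 * n%:R) * g n ^+ 2)
    * expR (- (k * (n%:R * g n ^+ 2))) @[n --> \oo] --> (0 : R).
Proof.
move=> k0 g_gt0 dom.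
have : t1 / 2 * (Num.sqrt (2 * pi * V2 * n%:R))^-1 @[n --> \oo] --> (t1 / 2 * 0 : R).
  apply: cvgM; first exact: cvg_cst.
  by apply: cvg0_inv => A; apply: sqrt_ge_near; rewrite !mulr_gt0 ?pi_gt0.
rewrite mulr0; apply: cvg0_squeeze; near=> n.
have gn : 0 < g n by near: n.
have nR : 0 < n%:R :> R by rewrite ltr0n; near: n; exact: nbhs_infty_gt.
have ln1 : 1 <= ln n%:R :> R by near: n; exact: ln_ge_near.
have g2 : 0 < g n ^+ 2 by rewrite exprn_gt0.
have x1 : 1 <= n%:R * g n ^+ 2.
  by apply: (le_trans ln1); rewrite -[leLHS]mul1r; near: n.
have kx : ln n%:R <= k * (n%:R * g n ^+ 2).
  by rewrite mulrC -ler_pdivrMr// mulrC; near: n.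
(* Domination of ln n makes the Gaussian factor at most 1/n, which turns the singular factor 1/g^2
   into 1/(n g^2) <= 1. *)
have e1 : expR (- (k * (n%:R * g n ^+ 2))) <= n%:R^-1.
  rewrite -[n%:R in leRHS]lnK ?posrE// -expRN ler_expR lerN2; exact: kx.
have sn : 0 < Num.sqrt (2 * pi * V2 * n%:R) by rewrite sqrtr_gt0 !mulr_gt0 ?pi_gt0.
set a := Num.sqrt _ in sn *.
have c0 : 0 < t1 / (2 * a * g n ^+ 2) by rewrite divr_gt0// mulr_gt0// mulr_gt0.
rewrite gtr0_norm; last by rewrite (mulr_gt0 c0)// expR_gt0.
apply: (le_trans (ler_wpM2l (ltW c0) e1)).
have -> : t1 / (2 * a * g n ^+ 2) / n%:R = t1 / 2 * a^-1 * (n%:R * g n ^+ 2)^-1.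
  by field; rewrite !lt0r_neq0.
apply: ler_piMr; first by rewrite mulr_ge0 ?invr_ge0 ?(ltW sn)// divr_ge0// ltW.
by rewrite invf_le1// (lt_le_trans ltr01).
Unshelve. all: by end_near. Qed.

Let gap_cvg0 (g : nat -> R) :
  (forall A : R, \forall n \near \oo, A * ln n%:R <= n%:R * g n ^+ 2) ->
  (n%:R * g n ^+ 2)^-1 @[n --> \oo] --> (0 : R).
Proof.
move=> dom; apply: cvg0_inv => A; near=> n.
have ln1 : 1 <= ln n%:R :> R by near: n; exact: ln_ge_near.
have : Num.max A 0 * ln n%:R <= n%:R * g n ^+ 2 by near: n.
apply: le_trans; apply: (@le_trans _ _ (Num.max A 0)); first by rewrite le_max lexx.
by rewrite -[leLHS]mulr1 ler_wpM2l// le_max lexx orbT.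
Unshelve. all: by end_near. Qed.

Let asym_refl (b : nat -> R) : (\forall n \near \oo, b n != 0) -> asym_equiv b b.
Proof.
move=> b0; apply: (@near_cvg _ (fun=> 1)); last exact: cvg_cst.
by apply: filterS b0 => n bn; rewrite divff.
Qed.

Lemma prob_min_le_gaussian (g : nat -> R) : (forall n, 0 < g n) ->
  asym_ll (fun n => Num.sqrt (ln n%:R) / Num.sqrt n%:R) g ->
  asym_ll g (fun n => n%:R `^ (- (1 / 3))) ->
  asym_equiv (fun n => prob_min_le (P n) (sigma n) (t1 - g n))
    (fun n => approx3 n (g n)).
Proof.
move=> g_gt0 [_ lo] [_ hi].
have near_g : \forall n \near \oo, 0 < g n by near=> n.
have dom (A : R) : \forall n \near \oo, A * ln n%:R <= n%:R * g n ^+ 2.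
  pose B : R := Num.max A 1; have B0 : 0 < B by rewrite lt_max ltr01 orbT.
  have sB : 0 < Num.sqrt B by rewrite sqrtr_gt0.
  near=> n.
  have nR : 0 < n%:R :> R by rewrite ltr0n; near: n; exact: nbhs_infty_gt.
  have l0 : 0 <= ln n%:R :> R by near: n; exact: ln_ge_near.
  have sn : 0 < Num.sqrt n%:R :> R by rewrite sqrtr_gt0.
  have : `|Num.sqrt (ln n%:R) / Num.sqrt n%:R / g n| <= (Num.sqrt B)^-1.
    by near: n; apply: cvg0_le_near => //; rewrite invr_gt0.
  rewrite ger0_norm; last by rewrite !divr_ge0 ?sqrtr_ge0// ltW.
  rewrite ler_pdivrMr// ler_pdivrMr// mulrAC -mulrA mulrC ler_pdivlMr// => h.
  apply: (@le_trans _ _ (B * ln n%:R)); first by rewrite ler_wpM2r// le_max lexx.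
  have : (Num.sqrt (ln n%:R) * Num.sqrt B) ^+ 2 <= (Num.sqrt n%:R * g n) ^+ 2.
    by rewrite lerXn2r ?nnegrE ?mulr_ge0 ?sqrtr_ge0// ltW.
  by rewrite !exprMn !sqr_sqrtr ?(ltW B0) ?(ltW nR)// [B * _]mulrC.
apply: prob_min_le_equiv3 => //.
- have : (g n / n%:R `^ (- (1 / 3))) ^+ 3 @[n --> \oo] --> (0 ^+ 3 : R).
    by rewrite exprS expr2; under eq_fun do rewrite exprS expr2; apply: cvgM => //; exact: cvgM.
  rewrite expr0n/=; apply: near_cvg; near=> n.
  have nR : 0 < n%:R :> R by rewrite ltr0n; near: n; exact: nbhs_infty_gt.
  rewrite exprMn exprVn -[(n%:R `^ _) ^+ 3]powR_mulrn ?powR_ge0// -powRrM.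
  rewrite (_ : - (1 / 3) * 3 = - 1); last by field.
  by rewrite powRN powRr1 ?(ltW nR)// invrK mulrC.
- exact: gap_cvg0.
- apply: asym_refl; near=> n.
  have n0 : (0 < n)%N by near: n; exact: nbhs_infty_gt.
  by rewrite gt_eqF// approx3_gt0.
have k0 : 0 < V2 / 2 by rewrite divr_gt0.
have := gaussian_prefactor_cvg0 k0 near_g dom.
apply: near_cvg; near=> n; rewrite /approx3 -/V2; congr (_ * expR _); by field.
Unshelve. all: by end_near. Qed.

(** A gap of order at least n^(-1/3) makes n g^2 at least of order n^(1/3), far above ln n. The
    cubic remainder need not vanish, so V stays in the exponent of the equivalent. *)
Lemma prob_min_le_large (g : nat -> R) : (forall n, 0 < g n) ->
  asym_lesssim (fun n => n%:R `^ (- (1 / 3))) g ->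
  asym_ll g (fun=> 1) ->
  asym_equiv (fun n => prob_min_le (P n) (sigma n) (t1 - g n))
    (fun n => approx2 n (g n)).
Proof.
move=> g_gt0 [C C0 lo] [_ hi].
have near_g : \forall n \near \oo, 0 < g n by near=> n.
have g0 : g n @[n --> \oo] --> (0 : R).
  by apply: near_cvg hi; near=> n; rewrite divr1.
have dom (A : R) : \forall n \near \oo, A * ln n%:R <= n%:R * g n ^+ 2.
  near=> n.
  have nR : 0 < n%:R :> R by rewrite ltr0n; near: n; exact: nbhs_infty_gt.
  have h1 : A * C ^+ 2 * ln n%:R <= n%:R `^ (1 / 3) :> R.
    by near: n; apply: ln_le_powR_near; rewrite divr_gt0.
  have h2 : n%:R `^ (- (1 / 3)) <= C * g n by near: n.
  have h3 : (n%:R `^ (- (1 / 3))) ^+ 2 <= (C * g n) ^+ 2.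
    by rewrite lerXn2r ?nnegrE ?powR_ge0// mulr_ge0// ltW.
  have h4 : n%:R * (n%:R `^ (- (1 / 3))) ^+ 2 = n%:R `^ (1 / 3) :> R.
    rewrite -powR_mulrn ?powR_ge0// -powRrM -{1}(powRr1 (ltW nR)) -powRD.
      by congr (_ `^ _); field.
    by apply/implyP => _; rewrite gt_eqF.
  have C2 : 0 < C ^+ 2 by rewrite exprn_gt0.
  rewrite -(ler_pM2l C2); have := ler_wpM2l (ltW nR) h3; rewrite h4 exprMn.
  by move: h1; lra.
have [del /andP[del0 delt1] [K K0 gapP]] := approx_gap.
have near_gap : \forall n \near \oo, exists E : R, `|E| <= K * g n ^+ 3 /\
    approx2 n (g n) = approx3 n (g n) * expR (- (n%:R * E)).
  near=> n; have n0 : (0 < n)%N by near: n; exact: nbhs_infty_gt.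
  have [|rho [E [_ E1 _ E2]]] := gapP n (g n) n0 (g_gt0 n).
    by apply: (le_trans (ler_norm _)); near: n; exact: cvg0_le_near.
  by exists E.
apply: prob_min_le_equiv2 => //.
- exact: gap_cvg0.
- apply: asym_refl; near=> n.
  have n0 : (0 < n)%N by near: n; exact: nbhs_infty_gt.
  have [E [_ ->]] : exists E : R, `|E| <= K * g n ^+ 3 /\
    approx2 n (g n) = approx3 n (g n) * expR (- (n%:R * E)) by near: n.
  by rewrite mulf_neq0// gt_eqF ?expR_gt0 ?approx3_gt0.
have k0 : 0 < V2 / 4 by rewrite divr_gt0.
apply: (cvg0_squeeze _ (gaussian_prefactor_cvg0 k0 near_g dom)); near=> n.
have n0 : (0 < n)%N by near: n; exact: nbhs_infty_gt.
have nR : 0 < n%:R :> R by rewrite ltr0n.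
have gn := g_gt0 n.
have [E [E1 ->]] : exists E : R, `|E| <= K * g n ^+ 3 /\
  approx2 n (g n) = approx3 n (g n) * expR (- (n%:R * E)) by near: n.
rewrite gtr0_norm; last by rewrite mulr_gt0 ?expR_gt0// approx3_gt0.
rewrite /approx3 -/V2 -mulrA -expRD; apply: ler_wpM2l.
  by rewrite divr_ge0 ?(ltW t1_gt0)// mulr_ge0 ?sqr_ge0// mulr_ge0// sqrtr_ge0.
rewrite ler_expR.
have gK : g n <= V2 / 4 / K.
  by apply: (le_trans (ler_norm _)); near: n; apply: cvg0_le_near; rewrite // divr_gt0.
(* As g tends to 0, the cubic remainder consumes at most half of the quadratic exponent, so the
   equivalent still tends to 0. *)
have h : n%:R * - E <= n%:R * g n ^+ 2 * (V2 / 4).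
  rewrite -mulrA ler_wpM2l ?(ltW nR)//.
  apply: (le_trans (ler_norm _)); rewrite normrN; apply: (le_trans E1).
  rewrite exprSr mulrCA ler_wpM2l ?sqr_ge0//.
  by rewrite mulrC -ler_pdivlMr.
by move: h; lra.
Unshelve. all: by end_near. Qed.

(** * The Gumbel limit and its rate *)

Definition edge n (t : R) : R :=
  t1 - Num.sqrt (tau n) / Num.sqrt (V2 * n%:R) + t / Num.sqrt (V2 * n%:R * tau n).

(** The rescaled gap is sqrt tau - t / sqrt tau, whose square is y; t < tau is needed for it to be
    the positive root. *)
Lemma edge_sqrt n (t : R) : (0 < n)%N -> 0 < tau n -> t < tau n ->
  let y := tau n - 2 * t + t ^+ 2 / tau n in
  edge n t = t1 - Num.sqrt y / Num.sqrt (V2 * n%:R).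
Proof.
move=> n0 t0 tt y; have nR : 0 < n%:R :> R by rewrite ltr0n.
have st : 0 < Num.sqrt (tau n) by rewrite sqrtr_gt0.
have sVn : 0 < Num.sqrt (V2 * n%:R) by rewrite sqrtr_gt0 mulr_gt0.
have tE : tau n = Num.sqrt (tau n) ^+ 2 by rewrite sqr_sqrtr// ltW.
have -> : y = (Num.sqrt (tau n) - t / Num.sqrt (tau n)) ^+ 2.
  by rewrite /y [in LHS]tE; field; rewrite lt0r_neq0.
rewrite sqrtr_sqr gtr0_norm; last first.
  by rewrite subr_gt0 ltr_pdivrMr// -expr2 -tE.
rewrite /edge [Num.sqrt (_ * tau n)]sqrtrM ?mulr_ge0 ?(ltW V2_gt0)//.
by field; rewrite !lt0r_neq0.
Qed.

Let rate_ln_near (A : R) : \forall n \near \oo, A * (ln n%:R * rate n) <= 1 :> R.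
Proof.
near=> n; have n0 : (0 < n)%N by near: n; exact: nbhs_infty_gt.
have h : A * ln n%:R <= n%:R `^ (1 / 10) by near: n; exact: ln_le_powR_near.
have p0 : 0 < n%:R `^ (1 / 10) :> R by rewrite powR_gt0// ltr0n.
by rewrite /rate powRN mulrA ler_pdivrMr// (mul1r (_ `^ _)).
Unshelve. all: by end_near. Qed.

(** Restricting to |t| <= ln ln n keeps t^2 / ln n small and e^t at most ln n, so all errors are
    uniformly O((1+t^2) / ln n); the explicit 2 ln ln n / ln n comes from (ln n)/y. *)
Lemma prob_min_ge_gumbel : exists2 K : R, 0 <= K & \forall n \near \oo,
  forall t : R, `|t| <= ln (ln n%:R) ->
  let lam := 2 * ln (ln n%:R) / ln n%:R in
  let kap := K * (1 + t ^+ 2) / ln n%:R in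
  expR (- (expR t * (1 + lam + kap))) <= prob_min_ge (P n) (sigma n) (edge n t) /\
  prob_min_ge (P n) (sigma n) (edge n t) <= expR (- (expR t * (1 + lam - kap))).
Proof.
have [del /andP[del0 delt1] [C2 C20 gapP]] := approx_gap.
have t1del : 0 < t1 - del by rewrite subr_gt0.
have t1del' : t1 - del < t1 by rewrite gtrBl.
have [C1 C10 bounds] := prob_min_ge_bounds t1del t1del'.
pose k := ln (V2 * t1 ^+ 2 / (8 * pi)).
(* Dominates, in units of 1 / ln n, the product correction m, the tail-sum error e, and the errors
   in [rho] and E, in this order. *)
pose K0 : R := 8 * C1 + C1 * (2 * V2 + 1) + 2 * C2.
have C1V : 0 <= C1 * (2 * V2 + 1).
  by rewrite mulr_ge0 ?(ltW C10)// addr_ge0// mulr_ge0// ltW.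
have K00 : 0 < K0 by rewrite /K0; lra.
exists (2 * `|k| + 7 + 10 * K0).
  by rewrite addr_ge0 ?mulr_ge0 ?(ltW K00)// addr_ge0// mulr_ge0.
near=> n => t tL.
have n0 : (0 < n)%N by near: n; exact: nbhs_infty_gt.
have nR : 0 < n%:R :> R by rewrite ltr0n.
have L160 : 160 <= ln (ln n%:R) :> R by near: n; exact: ln_ln_ge_near.
have L1 : 1 <= ln (ln n%:R) :> R by near: n; exact: ln_ln_ge_near.
have kL : `|k| <= ln (ln n%:R) by near: n; exact: ln_ln_ge_near.
have l1 : 1 <= ln n%:R :> R by near: n; exact: ln_ge_near.
have lK : 10 * K0 <= ln n%:R by near: n; exact: ln_ge_near.
have rl : 1 * (ln n%:R * rate n) <= 1 :> R by near: n; exact: rate_ln_near.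
have rV : 2 / V2 * (ln n%:R * rate n) <= 1 by near: n; exact: rate_ln_near.
have rdel : rate n <= del by near: n; exact: rate_le_near.
have [_ bnd] : (0 < n)%N /\ forall s, t1 - del <= s -> s < t1 ->
  let e : R := C1 * ((n%:R * (t1 - s) ^+ 2)^-1 + rate n) in
  [/\ 0 < approx n s,
    prob_min_ge (P n) (sigma n) s <= expR (- (approx n s * (1 - e))) &
    C1 * (t1 - s) * approx n s <= 1 / 2 ->
    expR (- ((1 + 2 * (C1 * (t1 - s) * approx n s)) * (approx n s * (1 + e)))) <=
      prob_min_ge (P n) (sigma n) s] by near: n.
have l0 : 0 < ln n%:R :> R by exact: lt_le_trans l1.
have tE : tau n = ln n%:R - 2 * ln (ln n%:R) + k by rewrite tauE.
have Ll : 100 * ln (ln n%:R) ^+ 2 <= ln n%:R :> R.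
  by have := sqr_le_exp L160; rewrite lnK ?posrE.
have r0 : 0 < rate n :> R := rate_gt0 n0; have rX := rateX n0 : n%:R * rate n ^+ 10 = 1 :> R.
have el : expR (ln (ln n%:R)) = ln n%:R :> R by rewrite lnK.
move: (tau_shift_bounds L1 tL kL Ll); rewrite /= -tE => -[u2 tu [y2 y2'] Uy].
have u0 : 0 < tau n by apply: lt_le_trans u2; rewrite divr_gt0.
rewrite (edge_sqrt n0 u0 tu).
set y := tau n - 2 * t + t ^+ 2 / tau n in y2 y2' Uy *.
have y0 : 0 < y by apply: lt_le_trans y2; rewrite divr_gt0.
have a3 := approx3E l0 y0.
have Vn : 0 < V2 * n%:R by rewrite mulr_gt0.
set g := Num.sqrt y / Num.sqrt (V2 * n%:R) in a3 *.
have g0 : 0 < g by rewrite divr_gt0// sqrtr_gt0.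
have g2 : g ^+ 2 = y / (V2 * n%:R) by rewrite /g exprMn exprVn !sqr_sqrtr// ltW.
have yt : (tau n - y) / 2 = t - t ^+ 2 / (2 * tau n) by rewrite /y; field; rewrite lt0r_neq0.
rewrite yt in a3.
set l := ln n%:R in l1 lK rl rV l0 u2 y2 y2' Uy a3 el Ll L160 L1 kL tL *.
set r : R := rate n in rl rV rdel r0 rX bnd.
have r_l : r <= 1 / l by rewrite ler_pdivlMr// mulrC; lra.
have r1 : r <= 1 by apply: (le_trans r_l); rewrite ler_pdivrMr// mul1r.
(* Here g^2 is at most (2 ln n / V2) r^10, and both (2/V2) r ln n and the next power of r are at
   most 1. This gives n g^3 <= n r^12 = r^2. *)
have gr : g <= r ^+ 4.
  rewrite -(@ler_pXn2r _ 2)// ?nnegrE ?exprn_ge0 ?(ltW g0) ?(ltW r0)// g2.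
  have -> : y / (V2 * n%:R) = y / V2 * r ^+ 10.
    have -> : r ^+ 10 = n%:R^-1.
      by apply: (mulfI (lt0r_neq0 nR)); rewrite rX divff ?lt0r_neq0.
    by field; rewrite !lt0r_neq0.
  apply: (@le_trans _ _ (2 * l / V2 * r ^+ 10)).
    by rewrite ler_wpM2r ?exprn_ge0 ?(ltW r0)// ler_wpM2r// invr_ge0 ltW.
  have -> : 2 * l / V2 * r ^+ 10 = 2 / V2 * (l * r) * (r * (r ^+ 4) ^+ 2) by ring.
  have r8 : 0 <= (r ^+ 4) ^+ 2 by rewrite sqr_ge0.
  apply: (@le_trans _ _ (1 * (1 * (r ^+ 4) ^+ 2))); last by rewrite !mul1r.
  apply: ler_pM => //; last by rewrite ler_wpM2r.
    by rewrite mulr_ge0 ?divr_ge0 ?mulr_ge0 ?(ltW V2_gt0) ?(ltW l0) ?(ltW r0).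
  by rewrite mulr_ge0// ltW.
have rX_le j : r ^+ j.+1 <= r by rewrite exprS ler_piMr ?(ltW r0)// exprn_ile1// ltW.
have g_r : g <= r by exact: le_trans gr (rX_le 3).
have ng3 : n%:R * g ^+ 3 <= r ^+ 2.
  have : g ^+ 3 <= (r ^+ 4) ^+ 3.
    by rewrite lerXn2r ?nnegrE ?exprn_ge0 ?(ltW g0) ?(ltW r0).
  move=> /(ler_wpM2l (ltW nR)) /le_trans; apply.
  have -> : n%:R * (r ^+ 4) ^+ 3 = n%:R * r ^+ 10 * r ^+ 2 by ring.
  by rewrite rX mul1r.
have gdel : g <= del by exact: le_trans g_r rdel.
have [rho [E [rho1 E1 aE a2E]]] := gapP n g n0 g0 gdel.
have [||A0 hi lo] := bnd (t1 - g).
- by rewrite lerD2l lerN2.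
- by rewrite gtrBl.
rewrite /= in hi lo.
have gE : t1 - (t1 - g) = g by ring.
rewrite !gE in hi lo.
clear bnd rX rdel gdel rV tE yt L160 kL gE.
set a : R := K0 / l.
have a0 : 0 <= a by rewrite divr_ge0 ?(ltW K00) ?(ltW l0).
have a1 : a <= 1 / 10 by rewrite ler_pdivrMr//; move: lK; lra.
have il0 : 0 <= 1 / l by rewrite divr_ge0// ltW.
have a_ge (c : R) : 0 <= c -> c <= K0 -> c * (1 / l) <= a.
  by move=> c0 cK; rewrite /a mul1r ler_wpM2r// invr_ge0 ltW.
have rho_a : 1 - a <= rho <= 1 + a.
  have : `|rho - 1| <= a.
    apply: (le_trans rho1); apply: le_trans (a_ge C2 (ltW C20) _).
      by rewrite ler_wpM2l ?(ltW C20)// (le_trans g_r).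
    by rewrite /K0; lra.
  by rewrite ler_norml => /andP[? ?]; apply/andP; split; lra.
have nE : `|n%:R * E| <= a / 2.
  rewrite normrM normr_nat.
  have h : n%:R * `|E| <= C2 * (1 / l).
    apply: (@le_trans _ _ (C2 * (n%:R * g ^+ 3))).
      by rewrite mulrCA ler_wpM2l// ltW.
    rewrite ler_wpM2l ?(ltW C20)//; apply: (le_trans ng3).
    exact: le_trans (rX_le 1%N) r_l.
  have h' : 2 * C2 * (1 / l) <= a.
    by apply: a_ge; [rewrite mulr_ge0// ltW|rewrite /K0; lra].
  by apply: (le_trans h); rewrite ler_pdivlMr// mulrC mulrA.
have p1_a : 1 - a <= expR (- (n%:R * E)) <= 1 + a.
  move: nE; rewrite ler_norml => /andP[nE1 nE2]; apply/andP; split.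
    by apply: le_trans (expR_ge1Dx _); lra.
  have a20 : 0 <= a / 2 by lra.
  have a22 : a / 2 <= 1 / 2 by lra.
  apply: (@le_trans _ _ (expR (a / 2))); first by rewrite ler_expR; lra.
  by apply: le_trans (expR_le_affine a20 a22) _; lra.
have t2L : t ^+ 2 <= ln l ^+ 2.
  by rewrite -(real_normK (num_real t)) lerXn2r ?nnegrE// (le_trans ler01).
have t20 := sqr_ge0 t.
set b := t ^+ 2 / l.
have b01 : 0 <= b <= 1.
  rewrite divr_ge0 ?(ltW l0)//= ler_pdivrMr// mul1r (le_trans t2L)//.
  by apply: le_trans Ll; rewrite ler_peMl ?sqr_ge0// ler1n.
have tu2 : 0 <= t ^+ 2 / (2 * tau n) <= b.
  have tau2 : 0 < 2 * tau n by rewrite mulr_gt0.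
  apply/andP; split; first by rewrite divr_ge0// ltW.
  by rewrite /b ler_wpM2l// lef_pV2 ?posrE// -ler_pdivrMl// mulrC.
have p0_b : 1 - b <= expR (- (t ^+ 2 / (2 * tau n))) <= 1.
  have /andP[h1 h2] := tu2; apply/andP; split.
    by apply: le_trans (expR_ge1Dx _); lra.
  by rewrite -[leRHS]expR0 ler_expR oppr_le0.
have U2 : 0 <= l / y <= 2.
  by rewrite divr_ge0 ?(ltW l0) ?(ltW y0)//= ler_pdivrMr//; lra.
have AE : approx n (t1 - g) = expR t * (l / y * expR (- (t ^+ 2 / (2 * tau n))) *
    expR (- (n%:R * E)) * rho).
  by rewrite aE a2E a3 expRD; ring.
set p0 := expR (- (t ^+ 2 / _)) in p0_b AE.
set p1 := expR (- (n%:R * E)) in p1_a AE.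
set e := C1 * (_ + r) in hi lo.
have e_a : 0 <= e <= a.
  have ng2 : (n%:R * g ^+ 2)^-1 = V2 / y.
    by rewrite g2; field; rewrite !lt0r_neq0.
  rewrite /e ng2 mulr_ge0 ?addr_ge0 ?divr_ge0 ?(ltW C10) ?(ltW V2_gt0) ?(ltW y0) ?(ltW r0)//=.
  apply: (@le_trans _ _ (C1 * (2 * V2 + 1) * (1 / l))); last first.
    by apply: a_ge => //; rewrite /K0; lra.
  rewrite -mulrA ler_wpM2l ?(ltW C10)// mulrDl; apply: lerD; last by rewrite (mul1r (1 / l)).
  have -> : 2 * V2 * (1 / l) = V2 / (l / 2) by field; rewrite lt0r_neq0.
  by rewrite ler_wpM2l ?(ltW V2_gt0)// lef_pV2 ?posrE// divr_gt0.
set m := 2 * (C1 * g * approx n (t1 - g)) in lo.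
have m_a : 0 <= m <= a.
  have Cg0 : 0 <= C1 * g by rewrite mulr_ge0// ltW.
  have m0 : 0 <= m by rewrite /m; apply: mulr_ge0 => //; exact: mulr_ge0 (ltW A0).
  rewrite m0/=.
  (* The factor e^t is at most ln n and the others multiply to less than 4; since g <= r^4, the
     single tails are then O(r^4 ln n). *)
  have A4 : approx n (t1 - g) <= l * 4.
    have p00 : 0 <= p0 := expR_ge0 _; have p10 : 0 <= p1 := expR_ge0 _.
    have /andP[_ q2] := p0_b; have /andP[_ q4] := p1_a; have /andP[q5 q6] := rho_a.
    have /andP[q7 q8] := U2.
    have q9 : 0 <= rho by apply: le_trans q5; rewrite subr_ge0 (le_trans a1)// ler_pdivrMr// mul1r ler1n.
    have a11 : 1 + a <= 11 / 10 by apply: (@le_trans _ _ (1 + 1 / 10)); [rewrite lerD2l|rewrite le_eqVlt; apply/orP; left; apply/eqP; field].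
    have q4' := le_trans q4 a11; have q6' := le_trans q6 a11.
    have Up := mulr_ge0 q7 p00; have Up1 := mulr_ge0 Up p10.
    rewrite AE; apply: ler_pM; rewrite ?expR_ge0//.
    - exact: mulr_ge0.
    - by rewrite -el ler_expR; move: tL; rewrite ler_norml => /andP[].
    apply: (@le_trans _ _ (2 * 1 * (11 / 10) * (11 / 10))).
      exact: ler_pM Up1 q9 (ler_pM Up p10 (ler_pM q7 p00 q8 q2) q4') q6'.
    have -> : 2 * 1 * (11 / 10) * (11 / 10) = 121 / 50 :> R by field.
    by rewrite ler_pdivrMr// -natrM ler_nat.
  apply: (@le_trans _ _ (2 * (C1 * r ^+ 4 * (l * 4)))).
    rewrite ler_wpM2l//; apply: (ler_pM Cg0 (ltW A0) _ A4).
    by rewrite ler_wpM2l// ltW.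
  have -> : 2 * (C1 * r ^+ 4 * (l * 4)) = 8 * C1 * (r ^+ 3 * (l * r)) by ring.
  have C18 : 0 <= 8 * C1 by rewrite mulr_ge0// ltW.
  apply: (@le_trans _ _ (8 * C1 * (1 / l))); last by apply: a_ge => //; rewrite /K0; lra.
  rewrite ler_wpM2l//; apply: le_trans r_l; rewrite -[leRHS]mulr1.
  rewrite mul1r in rl; apply: ler_pM (rX_le 2%N) rl; first by rewrite exprn_ge0// ltW.
  by rewrite mulr_ge0// ltW.
have [up low] := near_one_factors (introT andP (conj a0 a1)) b01 U2 p0_b p1_a rho_a e_a m_a.
move: Uy; rewrite ler_norml => /andP[Uy1 Uy2].
have kapE : (2 * `|k| + 7 + 10 * K0) * (1 + t ^+ 2) / l >=
    (2 * `|k| + 5 + 2 * t ^+ 2) / l + 10 * a + 2 * b.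
  have -> : (2 * `|k| + 5 + 2 * t ^+ 2) / l + 10 * a + 2 * b =
      (2 * `|k| + 5 + 4 * t ^+ 2 + 10 * K0) / l by rewrite /a /b; ring.
  rewrite ler_wpM2r ?invr_ge0 ?(ltW l0)//.
  have : 0 <= (2 * `|k| + 10 * K0) * t ^+ 2.
    by rewrite mulr_ge0// addr_ge0 ?mulr_ge0// ltW.
  by move: t20; lra.
have b0 : 0 <= b by have /andP[] := b01.
split.
  apply: le_trans (lo _); last first.
    by have /andP[_] := m_a; rewrite /m; lra.
  rewrite ler_expR lerN2.
  have -> : (1 + m) * (approx n (t1 - g) * (1 + e)) =
    expR t * (l / y * p0 * p1 * rho * (1 + e) * (1 + m)) by rewrite AE; ring.
  rewrite ler_wpM2l ?expR_ge0//; apply: (le_trans up).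
  by move: kapE Uy2 b0; lra.
apply: (le_trans hi); rewrite ler_expR lerN2.
have -> : approx n (t1 - g) * (1 - e) = expR t * (l / y * p0 * p1 * rho * (1 - e)).
  by rewrite AE; ring.
rewrite ler_wpM2l ?expR_ge0//; apply: le_trans low; move: kapE Uy1 a0; lra.
Unshelve. all: by end_near. Qed.

Let prob_min_ge_01 n (s : R) : (0 < n)%N -> 0 <= prob_min_ge (P n) (sigma n) s <= 1.
Proof.
move=> n0; have [s0|s0] := leP s 0; first by rewrite prob_min_ge_npos// ler01 lexx.
rewrite (prob_min_geE n0 continuous_V (sigma_density n0) s0).
have tail01 (j : 'I_n) : 0 <= left_tail V n j (ln s) <= 1.
  by rewrite left_tail_ge0 (left_tail_le1 n0 continuous_V (sigma_density n0)).
by have [] := prod_one_sub_ge tail01.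
Qed.

Let prob_min_ge_anti n (s s' : R) : (0 < n)%N -> s <= s' ->
  prob_min_ge (P n) (sigma n) s' <= prob_min_ge (P n) (sigma n) s.
Proof.
move=> n0 ss'; have [s0|s0] := leP s 0.
  by rewrite [leRHS]prob_min_ge_npos//; have /andP[] := prob_min_ge_01 s' n0.
have s'0 : 0 < s' := lt_le_trans s0 ss'.
rewrite (prob_min_geE n0 continuous_V (sigma_density n0) s0).
rewrite (prob_min_geE n0 continuous_V (sigma_density n0) s'0).
apply: ler_prod => j _; rewrite subr_ge0.
rewrite (left_tail_le1 n0 continuous_V (sigma_density n0))/= lerD2l lerN2.
by apply: (left_tail_le n0 continuous_V (sigma_density n0)); rewrite ler_ln ?posrE.
Qed.

Let edge_le n (t t' : R) : t <= t' -> edge n t <= edge n t'.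
Proof. by move=> tt'; rewrite lerD2l ler_wpM2r// invr_ge0 sqrtr_ge0. Qed.

Let gumbel_distance n (t : R) : R :=
  `|prob_min_ge (P n) (sigma n) (edge n t) - expR (- expR t)|.

(** For |t| beyond ln ln n both laws are monotone in t and the Gumbel value at the boundary is
    within 1 / ln n of its limit, so the bound extends at the cost of 1 / ln n. *)
Lemma gumbel_distance_bounds : exists2 K : R, 0 <= K & \forall n \near \oo,
  let lam := 2 * ln (ln n%:R) / ln n%:R in
  (forall t, gumbel_distance n t <= lam / expR 1 + (66 * K + 1) / ln n%:R) /\
  (lam - K / ln n%:R - lam ^+ 2) / expR 1 <= gumbel_distance n 0.
Proof.
have [K K0 bounds] := prob_min_ge_gumbel.
exists K => //; near=> n.
have n0 : (0 < n)%N by near: n; exact: nbhs_infty_gt.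
have l1 : 1 <= ln n%:R :> R by near: n; exact: ln_ge_near.
have L1 : 1 <= ln (ln n%:R) :> R by near: n; exact: ln_ln_ge_near.
have LK : 4 * K * 256 <= ln (ln n%:R) :> R by near: n; exact: ln_ln_ge_near.
have LK2 : K <= 2 * ln (ln n%:R) :> R by move: LK L1 K0; lra.
have bnd : forall t : R, `|t| <= ln (ln n%:R) ->
  let lam := 2 * ln (ln n%:R) / ln n%:R in
  let kap := K * (1 + t ^+ 2) / ln n%:R in
  expR (- (expR t * (1 + lam + kap))) <= prob_min_ge (P n) (sigma n) (edge n t) /\
  prob_min_ge (P n) (sigma n) (edge n t) <= expR (- (expR t * (1 + lam - kap))).
  by near: n.
have l0 : 0 < ln n%:R :> R by exact: lt_le_trans l1.
have el : expR (ln (ln n%:R)) = ln n%:R :> R by rewrite lnK ?posrE.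
rewrite /=; move: l1 L1 LK LK2 bnd l0 el; rewrite /gumbel_distance.
set L := ln (ln n%:R); set l := ln n%:R; move=> l1 L1 LK LK2 bnd l0 el.
have L0 : 0 <= L by exact: le_trans L1.
set lam := 2 * L / l; have lam0 : 0 <= lam by rewrite divr_ge0 ?mulr_ge0 ?(ltW l0).
(* Makes the perturbation K(1+t^2)/l at most 1/2 for |t| <= L, as [gumbel_gap_le] requires. *)
have KL : 4 * K * L ^+ 2 <= l.
  have h := expR_quarter_sqr (divr_ge0 L0 (ler0n _ 2)).
  have : (L ^+ 2 / 16) ^+ 2 <= l.
    rewrite -el [in leRHS](splitr L) expRD -expr2.
    apply: lerXn2r; rewrite ?nnegrE ?expR_ge0 ?divr_ge0 ?sqr_ge0//.
    by move: h; rewrite expr_div_n; lra.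
  apply: le_trans; have -> : (L ^+ 2 / 16) ^+ 2 = L ^+ 2 / 256 * L ^+ 2 by field.
  rewrite ler_wpM2r ?sqr_ge0// ler_pdivlMr// (le_trans LK)//.
  by rewrite expr2 ler_peMl.
have inner t : `|t| <= L ->
    `|prob_min_ge (P n) (sigma n) (edge n t) - expR (- expR t)| <=
      lam / expR 1 + 66 * K / l.
  move=> tL; have [lo hi] := bnd t tL; apply: (gumbel_gap_le l0 lam0 K0 _ lo hi).
  have t2L : t ^+ 2 <= L ^+ 2.
    by rewrite -(real_normK (num_real t)) lerXn2r ?nnegrE.
  have L2 : 1 <= L ^+ 2 by rewrite exprn_ege1.
  have h := ler_wpM2l K0 t2L; have h2 := ler_wpM2l K0 L2.
  by rewrite ler_pdivrMr//; move: KL h h2; lra.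
have il0 : 0 < 1 / l by rewrite divr_gt0.
set B := lam / expR 1 + 66 * K / l in inner.
have -> : lam / expR 1 + (66 * K + 1) / l = B + 1 / l by rewrite /B; ring.
(* With L = ln l, e^(-L) = 1/l at the left boundary, and e^(-l) <= 1/l at the right one. *)
have GL : 1 - 1 / l <= expR (- expR (- L)).
  by rewrite [expR (- L)]expRN el div1r; exact: expR_ge1Dx.
have GU : expR (- expR L) <= 1 / l.
  rewrite el expRN div1r lef_pV2 ?posrE ?expR_gt0//.
  by apply: le_trans (expR_ge1Dx _); rewrite lerDr.
have F01 t := prob_min_ge_01 (edge n t) n0.
split=> [t|].
  have [tL|Lt] := leP `|t| L; first by apply: (le_trans (inner t tL)); rewrite lerDl ltW.
  have /andP[F0 F1] := F01 t.
  have [t0|t0] := leP 0 t.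
    rewrite ger0_norm// in Lt.
    have LL : `|L| <= L by rewrite ger0_norm.
    have /(le_trans (ler_norm _)) FL := inner L LL.
    have FF := prob_min_ge_anti n0 (edge_le n (ltW Lt)).
    have GG : expR (- expR t) <= expR (- expR L) by rewrite ler_expR lerN2 ler_expR ltW.
    have G0 := expR_ge0 (- expR t); have B0 : 0 <= B by exact: le_trans (inner L LL).
    by rewrite ler_norml; apply/andP; split; lra.
  rewrite ltr0_norm// ltrNr in Lt.
  have LL : `|- L| <= L by rewrite normrN ger0_norm.
  have /(le_trans (ler_norm _)) := inner (- L) LL; have := inner (- L) LL.
  rewrite ler_norml => /andP[FL _] _.
  have FF := prob_min_ge_anti n0 (edge_le n (ltW Lt)).
  have GG : expR (- expR (- L)) <= expR (- expR t) by rewrite ler_expR lerN2 ler_expR ltW.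
  have G1 : expR (- expR t) <= 1 by rewrite -[leRHS]expR0 ler_expR oppr_le0 expR_ge0.
  have B0 : 0 <= B by exact: le_trans (inner (- L) LL).
  by rewrite ler_norml; apply/andP; split; lra.
have L00 : `|0 : R| <= L by rewrite normr0.
have [_] := bnd 0 L00; rewrite expR0 mul1r expr0n/= addr0 mulr1 => h0.
by apply: gumbel_gap_ge => //; rewrite ler_wpM2r// invr_ge0 ltW.
Unshelve. all: by end_near. Qed.

(** The upper bound for all t and the lower bound at t = 0 share the main term 2L/(el), with L = ln
    ln n and l = ln n; their relative errors are O(1/L) and O(L/l), which tend to 0. *)
Lemma sup_gumbel_distance :
  asym_equiv (fun n => sup (range (gumbel_distance n)))
    (fun n => 2 * ln (ln n%:R) / (expR 1 * ln n%:R)).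
Proof.
have [K K0 bounds] := gumbel_distance_bounds.
have e1 : 0 < expR 1 :> R by exact: expR_gt0.
have e11 : 1 <= expR 1 :> R by apply: le_trans (expR_ge1Dx _); rewrite lerDl.
pose c : R := expR 1 * (66 * K + 1).
have lnln0 : c * (ln (ln n%:R))^-1 + 2 * (ln n%:R / ln (ln n%:R))^-1
    @[n --> \oo] --> (c * 0 + 2 * 0 : R).
  apply: cvgD; apply: cvgM; try exact: cvg_cst.
    by apply: cvg0_inv => A; exact: ln_ln_ge_near.
  apply: cvg0_inv => A; near=> n.
  have L0 : 0 < ln (ln n%:R) :> R.
    by apply: (lt_le_trans ltr01); near: n; exact: ln_ln_ge_near.
  by rewrite ler_pdivlMr//; near: n; exact: ln_ln_le_near.
rewrite !mulr0 addr0 in lnln0; apply: cvg1_sub; apply: cvg0_squeeze lnln0; near=> n.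
have l0 : 0 < ln n%:R :> R.
  by apply: (lt_le_trans ltr01); near: n; exact: ln_ge_near.
have L0 : 0 < ln (ln n%:R) :> R.
  by apply: (lt_le_trans ltr01); near: n; exact: ln_ln_ge_near.
have [up lo] : let lam := 2 * ln (ln n%:R) / ln n%:R in
  (forall t, gumbel_distance n t <= lam / expR 1 + (66 * K + 1) / ln n%:R) /\
  (lam - K / ln n%:R - lam ^+ 2) / expR 1 <= gumbel_distance n 0 by near: n.
have ubd : ubound (range (gumbel_distance n))
    (2 * ln (ln n%:R) / ln n%:R / expR 1 + (66 * K + 1) / ln n%:R).
  by move=> _ [t _ <-]; exact: up.
have sup_le : sup (range (gumbel_distance n)) <=
    2 * ln (ln n%:R) / ln n%:R / expR 1 + (66 * K + 1) / ln n%:R.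
  by apply: ge_sup => //; exists (gumbel_distance n 0), 0.
have sup_ge : gumbel_distance n 0 <= sup (range (gumbel_distance n)).
  by apply: ub_le_sup; [eexists; exact: ubd|exists 0].
have {lo sup_ge} := le_trans lo sup_ge; move: sup_le; rewrite /c.
move: (sup _) (ln n%:R) (ln (ln n%:R)) (expR 1) e1 e11 l0 L0 => D l L e e1 e11 l0 L0 up' lo'.
have w0 : 0 < 2 * L / (e * l) by rewrite divr_gt0 ?mulr_gt0.
have -> : D / (2 * L / (e * l)) - 1 = (D - 2 * L / (e * l)) / (2 * L / (e * l)).
  by field; rewrite !lt0r_neq0.
rewrite normrM normfV (gtr0_norm w0) ler_pdivrMr//.
have -> : (e * (66 * K + 1) * L^-1 + 2 * (l / L)^-1) * (2 * L / (e * l)) =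
    2 * ((66 * K + 1) / l) + (2 * L / l) ^+ 2 / e by field; rewrite !lt0r_neq0.
have we : 2 * L / l / e = 2 * L / (e * l) by field; rewrite !lt0r_neq0.
have k1 : 0 <= (66 * K + 1) / l by rewrite divr_ge0 ?(ltW l0)// addr_ge0// mulr_ge0.
have k2 : K / l / e <= (66 * K + 1) / l.
  rewrite ler_pdivrMr// (@le_trans _ _ ((66 * K + 1) / l))//; last by rewrite ler_peMr.
  by rewrite ler_wpM2r ?invr_ge0 ?(ltW l0)//; move: K0; lra.
have k3 : 0 <= (2 * L / l) ^+ 2 / e by rewrite divr_ge0 ?sqr_ge0// ltW.
move: lo'; rewrite !mulrBl we => lo'; rewrite we in up'.
by rewrite ler_norml; apply/andP; split; lra.
Unshelve. all: by end_near. Qed.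

End smallest_modulus.

Theorem theorem4 (R : realType) (V : R -> R) (t1 : R)
    (d : nat -> measure_display) (Omega : forall n, measurableType (d n))
    (P : forall n, probability (Omega n) R)
    (sigma : forall n, {RV (P n) >-> n.-tuple R[i]})
    (V_C3 : C3_on_pos V)
    (t1_gt0 : 0 < t1)
    (t1_unique : forall r : R, 0 < r -> (derive1 V r = 0 <-> r = t1))
    (V2_gt0 : 0 < derive1n 2 V t1)
    (rV'_incr : forall r s : R, 0 < r -> r < s -> r * derive1 V r < s * derive1 V s)
    (sigma_density : forall n, (0 < n)%N ->
      density_proportional_to (sigma n) (joint_weight V (n := n))) :
  [/\ (* (1) *)
      asym_equiv
        (fun n => sup (range (fun t : R =>
          `| prob_min_ge (P n) (sigma n)
               (t1 - Num.sqrt (tau V t1 n) / Num.sqrt (derive1n 2 V t1 * n%:R)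
                   + t / Num.sqrt (derive1n 2 V t1 * n%:R * tau V t1 n))
             - expR (- expR t) |)))
        (fun n => 2 * ln (ln n%:R) / (expR 1 * ln n%:R)),
      (* (2) *)
      forall t : R, 0 < t -> t < t1 ->
      asym_equiv
        (fun n => prob_min_le (P n) (sigma n) t)
        (fun n => Num.sqrt (derive1n 2 V t1) * t1 * t
                  / (Num.sqrt (2 * pi * n%:R) * (t1 ^+ 2 - t ^+ 2)
                     * (- derive1 V t))
                  * expR (- (n%:R * V t) + n%:R * V t1)),
      (* (3) *)
      forall t : R, 1 < t ->
      asym_equiv
        (fun n => prob_min_le (P n) (sigma n)
          (t1 - t * Num.sqrt (tau V t1 n) / Num.sqrt (derive1n 2 V t1 * n%:R)))
        (fun n => t ^- 2 *
          (8 * pi * ln n%:R ^+ 2 / (derive1n 2 V t1 * n%:R * t1 ^+ 2))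
            `^ ((t ^+ 2 - 1) / 2)),
      (* (4) *)
      forall v : nat -> R,
      asym_ll (fun=> 1) v -> asym_ll v (fun n => ln n%:R) ->
      asym_equiv
        (fun n => prob_min_le (P n) (sigma n)
          (t1 - Num.sqrt (tau V t1 n) / Num.sqrt (derive1n 2 V t1 * n%:R)
              - v n / Num.sqrt (derive1n 2 V t1 * n%:R * tau V t1 n)))
        (fun n => expR (- v n - v n ^+ 2 / (2 * tau V t1 n))) &
      (* (5) *)
      forall dn : nat -> R, (forall n, 0 < dn n) ->
      (asym_ll (fun n => Num.sqrt (ln n%:R) / Num.sqrt n%:R) dn ->
       asym_ll dn (fun n => n%:R `^ (- (1 / 3))) ->
       asym_equiv
         (fun n => prob_min_le (P n) (sigma n) (t1 - dn n))
         (fun n => t1 / (2 * Num.sqrt (2 * pi * derive1n 2 V t1 * n%:R) * dn n ^+ 2)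
                   * expR (- (1 / 2 * derive1n 2 V t1 * n%:R * dn n ^+ 2)))) /\
      (asym_lesssim (fun n => n%:R `^ (- (1 / 3))) dn ->
       asym_ll dn (fun=> 1) ->
       asym_equiv
         (fun n => prob_min_le (P n) (sigma n) (t1 - dn n))
         (fun n => t1 * expR (- (n%:R * V (t1 - dn n)) + n%:R * V t1)
                   / (2 * Num.sqrt (2 * pi * derive1n 2 V t1 * n%:R) * dn n ^+ 2)))].
Proof.
have V1_t1 := (t1_unique t1 t1_gt0).2 erefl.
split.
- exact: (sup_gumbel_distance V_C3 t1_gt0 V1_t1 V2_gt0 rV'_incr sigma_density).
- exact: (prob_min_le_fixed V_C3 t1_gt0 V1_t1 V2_gt0 rV'_incr sigma_density).
- exact: (prob_min_le_sqrt_tau V_C3 t1_gt0 V1_t1 V2_gt0 rV'_incr sigma_density).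
- exact: (prob_min_le_moderate V_C3 t1_gt0 V1_t1 V2_gt0 rV'_incr sigma_density).
move=> dn dn_gt0; split.
  exact: (prob_min_le_gaussian V_C3 t1_gt0 V1_t1 V2_gt0 rV'_incr sigma_density dn_gt0).
exact: (prob_min_le_large V_C3 t1_gt0 V1_t1 V2_gt0 rV'_incr sigma_density dn_gt0).
Qed.
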